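(* Let $\mathbf{p}_j,\mathbf{p}_k\in\mathfrak{Z}$ be distinct and let $\gamma_*\in Lip_{\mathfrak{Z}}(\mathbf{p}_j,\mathbf{p}_k)$ be a minimizing geodesic. Write $0=t_1<t_2<\dots<t_J=1$ (with $J\ge 2$) for the times $t$ at which $\gamma_*(t)\in\mathfrak{Z}$. If $J=2$, that is, if a minimizing geodesic connecting the two zeros $\mathbf{p}_j$ and $\mathbf{p}_k$ of $W$ avoids any other zeros of $W$ along the way, or equivalently, if the strict triangle inequality $$d(\mathbf{p}_j,\mathbf{p}_k)<d(\mathbf{p}_j,\mathbf{p}_\ell)+d(\mathbf{p}_\ell,\mathbf{p}_k)\quad\text{holds for all }\mathbf{p}_\ell\in\mathfrak{Z}\setminus\{\mathbf{p}_j,\mathbf{p}_k\},$$ then, under an equipartition parametrization, this geodesic represents an $H$-minimizing heteroclinic connection between the two zeros $\mathbf{p}_j$ and $\mathbf{p}_k$.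
   Context: Let $N\ge 2$, $m\ge 2$, and let $W:\mathbb{R}^N\to[0,\infty)$ be a continuous function such that: (i) its zero set is $\mathfrak{Z}=\{\mathbf{p}_1,\dots,\mathbf{p}_m\}$, consisting of $m$ distinct points (the wells), and $W>0$ elsewhere; (ii) $\liminf_{|p|\to\infty}W(p)>0$; (iii) $W\in C^{1,\alpha}_{loc}(\mathbb{R}^N\setminus\mathfrak{Z})$ with $\alpha\in(0,1)$; (iv) there are positive numbers $C,\delta$ such that $W(p)\le C|p-\mathbf{p}_j|^2$ whenever $|p-\mathbf{p}_j|<\delta$, $j=1,\dots,m$. Set $F:=\sqrt{W}$. For a continuous curve $\gamma:[0,1]\to\mathbb{R}^N$ put $\mathcal{T}_\gamma:=\{t\in[0,1]:\gamma(t)\in\mathfrak{Z}\}$. The class $Lip_{\mathfrak{Z}}([0,1];\mathbb{R}^N)$ consists of all continuous $\gamma:[0,1]\to\mathbb{R}^N$ that are locally Lipschitz (in the Euclidean metric) on $[0,1]\setminus\mathcal{T}_\gamma$; $Lip_{\mathfrak{Z}}(p,q)$ is the subset of those with $\gamma(0)=p$, $\gamma(1)=q$. Define $E(\gamma):=\int_0^1F(\gamma(t))|\gamma'(t)|\,dt$ and the metric $d(p,q):=\inf\{E(\gamma):\gamma\in Lip_{\mathfrak{Z}}(p,q)\}$ on $\mathbb{R}^N$. The length $L(\gamma)$ of a curve is the supremum of $\sum_{i}d(\gamma(s_i),\gamma(s_{i+1}))$ over finite partitions $\{s_i\}$ of $[0,1]$. A minimizing geodesic between distinct points $p,q$ is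 a curve $\gamma_*\in Lip_{\mathfrak{Z}}(p,q)$ with $L(\gamma_* )=\inf_{\gamma\in Lip_{\mathfrak{Z}}(p,q)}L(\gamma)=d(p,q)=E(\gamma_* )$. For $U\in H^1_{loc}(\mathbb{R},\mathbb{R}^N)$ set $H(U):=\int_{-\infty}^{+\infty}\left(\frac12|U'|^2+W(U)\right)dx$. An $H$-minimizing heteroclinic connection between wells $\mathbf{a},\mathbf{b}\in\mathfrak{Z}$ is a solution $U:\mathbb{R}\to\mathbb{R}^N$ of $U''-\nabla W(U)=0$ on $(-\infty,\infty)$ with $U(-\infty)=\mathbf{a}$, $U(+\infty)=\mathbf{b}$, which minimizes $H$ among all $V\in H^1_{loc}(\mathbb{R},\mathbb{R}^N)$ with $V(x)\to\mathbf{a}$ as $x\to-\infty$ and $V(x)\to\mathbf{b}$ as $x\to+\infty$. Equipartition parametrization: given a parametrization of $\gamma_*$ that is $C^{2,\alpha}$ with non-vanishing derivative on $(0,1)$, one sets $x(t):=\int_{1/2}^t\frac{|\gamma_*'(u)|}{\sqrt{2W(\gamma_*(u))}}\,du$ for $t\in(0,1)$ and reparametrizes the curve as $U_*(x):=\gamma_*(t(x))$, $x\in\mathbb{R}$, where $t(\cdot)$ is the inverse of $x(\cdot)$; then $\frac12|U_*'|^2=W(U_* )$ pointwise. That the geodesic represents the connection under this parametrization means that $U_*$ is the connection.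
   Formalization: The equivalence with the strict triangle inequality is proved for ''every minimizing geodesic has J=2'': for one geodesic, J=2 does not force strictness, as another minimizer of equal length may pass a third well. The connection still follows from J=2 for the given geodesic alone. *)

(* Defs.v *)
From HB Require Import structures.
From mathcomp Require Import all_boot all_order all_algebra.
From mathcomp Require Import all_classical all_reals all_analysis.

Set Implicit Arguments.
Unset Strict Implicit.
Unset Printing Implicit Defensive.

Import Order.TTheory GRing.Theory Num.Theory.
Import numFieldNormedType.Exports.

Local Open Scope ring_scope.
Local Open Scope classical_set_scope.

Notation lebesgue := (@lebesgue_measure _).

(* The canonical norm `|v| on 'rV[R]_n is the sup norm; it is used below only
   through the topology and the derivatives it induces. *)
Definition enorm (R : realType) (n : nat) (v : 'rV[R]_n) : R :=
  Num.sqrt (\sum_(i < n) v 0 i ^+ 2).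

Section Potential.
Context {R : realType} {N : nat}.
Implicit Types (W : 'rV[R]_N -> R) (p : 'rV[R]_N).

Definition zero_set W : set 'rV[R]_N := [set p | W p = 0].

Definition liminf_infty W : \bar R :=
  limf_einf (EFin \o W)
    (filter_from setT (fun r : R => [set p : 'rV[R]_N | r < enorm p])).

Definition gradient W p : 'rV[R]_N := \row_i 'D_(delta_mx 0 i) W p.

End Potential.

(* C^{0,alpha}_loc(D): alpha-Hoelder on every compact subset of D. *)
Definition holder_loc (R : realType) (T : topologicalType) (dist : T -> T -> R)
    (n : nat) (alpha : R) (D : set T) (f : T -> 'rV[R]_n) : Prop :=
  forall K : set T, compact K -> K `<=` D ->
    exists C : R, forall x y, K x -> K y ->
      enorm (f x - f y) <= C * dist x y `^ alpha.

Definition C1alpha_loc (R : realType) (N : nat) (alpha : R)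
    (D : set 'rV[R]_N) (W : 'rV[R]_N -> R) : Prop :=
  (forall p, D p -> differentiable W p) /\
  holder_loc (fun p q : 'rV[R]_N => enorm (p - q)) alpha D (gradient W).

Definition C2alpha_loc (R : realType) (N : nat) (alpha : R)
    (D : set R) (g : R -> 'rV[R]_N) : Prop :=
  (forall t, D t -> derivable g t 1 /\ derivable (derive1 g) t 1) /\
  holder_loc (fun s t : R => `|s - t|) alpha D (derive1 (derive1 g)).

(* A curve [0,1] -> R^N is represented by a function on R whose values outside
   [0,1] are irrelevant. *)
Section Geodesics.
Context {R : realType} {N : nat}.
Variable W : 'rV[R]_N -> R.
Implicit Types (g : R -> 'rV[R]_N) (p q : 'rV[R]_N).

Definition F p : R := Num.sqrt (W p).

Definition zero_times g : set R :=
  [set t | t \in `[0, 1]%R /\ zero_set W (g t)].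

Definition locally_lipschitz_on (A : set R) g : Prop :=
  forall t, A t -> exists2 eps : R, 0 < eps & exists K : R,
    forall s s', A s -> A s' -> `|s - t| < eps -> `|s' - t| < eps ->
      enorm (g s - g s') <= K * `|s - s'|.

Definition LipZ p q : set (R -> 'rV[R]_N) :=
  [set g | [/\ {within `[0 : R, 1], continuous g},
               locally_lipschitz_on (`[0, 1] `\` zero_times g) g,
               g 0 = p & g 1 = q]].

(* At times where g is not differentiable, derive1 g has an irrelevant value:
   outside zero_times g they form a null set (Rademacher), and on zero_times g
   the factor F (g t) vanishes. *)
Definition energy g : \bar R :=
  (\int[lebesgue]_(t in `[0%R : R, 1%R]) (F (g t) * enorm (derive1 g t))%:E)%E.

Definition dist p q : \bar R := ereal_inf [set energy g | g in LipZ p q].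

(* itv_partition 0 1 s says that 0 :: s is increasing and ends at 1. *)
Definition dlength g : \bar R :=
  ereal_sup [set (\sum_(i < size s)
      dist (g (nth 0%R (0%R :: s) i)) (g (nth 0%R (0%R :: s) i.+1)))%E
    | s in itv_partition (0 : R) 1].

Definition minimizing_geodesic p q g : Prop :=
  [/\ LipZ p q g,
      dlength g = ereal_inf [set dlength h | h in LipZ p q],
      dlength g = dist p q
    & dist p q = energy g].

(* 0 = t_1 < ... < t_J = 1 are the times at which g visits a well; J = size ts. *)
Definition enumerates_zero_times g (ts : seq R) : Prop :=
  [/\ sorted <%R ts, head 0 ts = 0, last 0 ts = 1 & zero_times g = [set` ts]].

End Geodesics.

Section Heteroclinic.
Context {R : realType} {N : nat}.
Variable W : 'rV[R]_N -> R.
Implicit Types (U V G : R -> 'rV[R]_N) (a b : 'rV[R]_N).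

Definition L2loc U : Prop :=
  (forall i, measurable_fun setT (fun x => U x 0 i)) /\
  (forall r s : R,
    (\int[lebesgue]_(x in `[r, s]) (enorm (U x) ^+ 2)%:E < +oo)%E).

(* C^1_c(R). In dimension one these test functions define the same weak
   derivatives as C^oo_c(R) (Brezis, Functional Analysis, Section 8.2). *)
Definition test_function (phi : R -> R) : Prop :=
  [/\ forall x, derivable phi x 1,
      continuous (derive1 phi)
    & exists M : R, forall x, M < `|x| -> phi x = 0].

Definition is_weak_derivative U G : Prop :=
  forall phi, test_function phi -> forall i : 'I_N,
    \int[lebesgue]_x (U x 0 i * derive1 phi x) = - \int[lebesgue]_x (G x 0 i * phi x).

Definition H1loc_derivatives U : set (R -> 'rV[R]_N) :=
  [set G | L2loc G /\ is_weak_derivative U G].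

Definition H1loc U : Prop := L2loc U /\ H1loc_derivatives U !=set0.

(* Well defined up to a null set when H1loc U. *)
Definition weak_derivative U : R -> 'rV[R]_N :=
  xget (fun=> 0) (H1loc_derivatives U).

Definition Hfun U : \bar R :=
  (\int[lebesgue]_x (2^-1 * enorm (weak_derivative U x) ^+ 2 + W (U x))%:E)%E.

Definition connects a b U : Prop :=
  U x @[x --> -oo%R] --> a /\ U x @[x --> +oo%R] --> b.

Definition solves_ODE U : Prop :=
  forall x, [/\ derivable U x 1, derivable (derive1 U) x 1
              & derive1 (derive1 U) x - gradient W (U x) = 0].

Definition minimizing_heteroclinic a b U : Prop :=
  [/\ solves_ODE U, connects a b U, H1loc U
    & forall V, H1loc V -> connects a b V -> (Hfun U <= Hfun V)%E].

End Heteroclinic.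

Section Equipartition.
Context {R : realType} {N : nat}.
Variable W : 'rV[R]_N -> R.
Implicit Types (g c : R -> 'rV[R]_N) (a b : 'rV[R]_N).

(* The monotone change of parameter need not be injective: g may pause,
   whereas a parametrization with non-vanishing derivative may not. *)
Definition reparametrizes c g : Prop :=
  exists phi : R -> R,
    [/\ {within `[0 : R, 1], continuous phi},
        {in `[0 : R, 1]%R &, {homo phi : s t / s <= t}},
        phi 0 = 0, phi 1 = 1
      & {in `[0 : R, 1]%R, forall t, g t = c (phi t)}].

Definition regular_parametrization (alpha : R) g c : Prop :=
  [/\ {within `[0 : R, 1], continuous c},
      reparametrizes c g,
      C2alpha_loc alpha `]0, 1[ c
    & {in `]0 : R, 1[%R, forall t, derive1 c t != 0}].

(* x(t), as an oriented integral from 1/2 to t. *)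
Definition equipartition c (t : R) : R :=
  let f u := enorm (derive1 c u) / Num.sqrt (2 * W (c u)) in
  if 2^-1 <= t then \int[lebesgue]_(u in `[2^-1, t]) f u
  else - \int[lebesgue]_(u in `[t, 2^-1]) f u.

Definition represents_heteroclinic (alpha : R) g a b : Prop :=
  (exists c, regular_parametrization alpha g c) /\
  (forall c, regular_parametrization alpha g c ->
     exists tau : R -> R,
       [/\ forall x, tau x \in `]0, 1[%R,
           cancel tau (equipartition c),
           {in `]0 : R, 1[%R, cancel (equipartition c) tau}
         & minimizing_heteroclinic W a b (c \o tau)]).

End Equipartition.

(* Main.v *)
Require Import Defs.
From HB Require Import structures.
From mathcomp Require Import all_boot all_order all_algebra.
From mathcomp Require Import all_classical all_reals all_analysis.
From mathcomp Require Import measurable_realfun.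
From mathcomp Require Import ring lra.

Set Implicit Arguments.
Unset Strict Implicit.
Unset Printing Implicit Defensive.

Import Order.TTheory GRing.Theory Num.Theory.
Import numFieldNormedType.Exports.

Local Open Scope ring_scope.
Local Open Scope classical_set_scope.

(** Write [d] for the degenerate metric [dist W], [F = sqrt W], and call an arc a
curve [c] with [d (c s) (c t) = rho t - rho s] for [s <= t] and some function [rho].

Why the two conditions are equivalent. Along a minimizing geodesic from [p j] to
[p k] the triangle inequality is an equality at every time, so a third well met on
the way violates the strict triangle inequality ([strict_triangle_on],
[no_intermediate_wells]). Conversely, if the triangle inequality is an equality at
some third well [p l], Menger's argument builds a geodesic through [p l]
([betweenness], [geodesic_through]). Run at unit speed it is a minimizing curve of
the required class, it meets each well at most once, so its zero times can be
listed, and the list has an entry strictly between [0] and [1]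
([strict_triangle_of_two]).

Why the geodesic is a heteroclinic connection. Young's inequality gives, along any
curve, [|V'|^2 / 2 + W V >= sqrt 2 * F V * |V'|], so that the action of a
competitor is at least [sqrt 2 * d p q]. For a competitor in H^1_loc this needs an
absolutely continuous representative, obtained by testing the weak derivative with
smooth plateaus ([weak_representation]), and a bound of [d] by the energy of
absolutely continuous curves ([dr_le_acurve], [Hfun_lower]). An arc without inner
wells, run at the equipartition speed [|U'| = sqrt 2 * F U], attains the bound
([Hfun_upper]).

The differential equation has the same origin. On a short interval such an arc
minimizes the action among curves with the same ends that stay in a small ball,
where [W] is C^{1,alpha}. The first variation, tested with the field of du
Bois-Reymond, says that the a priori merely Lipschitz arc has a derivative which is
a primitive of [gradient W U] ([euler_lagrange_ball], [arc_ode]).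

It remains to see that the equipartition time runs over the whole line. Near a well
[z] the assumption [W y <= C |y - z|^2] bounds the speed by a multiple of
[|U - z|], and by Gronwall's inequality the arc cannot reach [z] in finite time
([enorm_gronwall], [equipartition_heteroclinic]).

Finally, the geodesic has a parametrization of class C^{2,alpha}: the one
proportional to [d]-arc length is [U o X] with [U] the heteroclinic just obtained
and [X' = D / (sqrt 2 * W)], and its second derivative is a polynomial in Hoelder
functions ([unit_speed_C2alpha]). Conversely, every regular parametrization is an
arc that avoids the wells at inner times ([regular_heteroclinic]). *)

(** * Gluing on an interval; derivatives of Lipschitz functions *)

Section Segment.
Context {R : realType}.

(** Compactness of [a, b] in the form that glues local estimates: the supremum
of the points that can be reached from [a] is reached, and unless it is [b] it
can be passed. *)
Lemma cousin (P : R -> R -> Prop) (a b : R) : a <= b ->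
  (forall s t u, a <= s -> s <= t -> t <= u -> u <= b -> P s t -> P t u -> P s u) ->
  (forall t, a <= t <= b -> exists2 e, 0 < e & forall s s', a <= s -> s <= s' -> s' <= b ->
     `|s - t| < e -> `|s' - t| < e -> P s s') ->
  P a b.
Proof.
move=> ab add loc.
pose S := [set x | a <= x <= b /\ P a x].
have Sa : S a.
  split; first by rewrite lexx.
  have [e e0 eP] := loc a (introT andP (conj (lexx a) ab)).
  by apply: eP => //; rewrite subrr normr0.
have ubS : ubound S b by move=> x [/andP[]].
have hS : has_sup S by split; [exists a|exists b].
pose c := sup S.
have ac : a <= c by apply: ub_le_sup => //; exists b.
have cb : c <= b by apply: ge_sup => //; exists a.
have [e e0 eP] := loc c (introT andP (conj ac cb)).
have [x [/andP[ax xb] Px] xc] := sup_adherent e0 hS.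
have xlec : x <= c by apply: ub_le_sup; [exists b|split; [rewrite ax|]].
have ext y : x <= y -> y <= b -> y < c + e -> P a y.
  move=> xy yb yce; apply: (add a x y) => //; apply: eP => //.
    by move: xc xlec e0; rewrite -/c ltr_norml; clear; lra.
  by move: xc xlec yce xy e0; rewrite -/c ltr_norml; clear; lra.
have bc : b < c + e.
  rewrite ltNge; apply/negP => ceb.
  have xc2 : x <= c + e / 2 by move: xlec e0; clear; lra.
  have c2b : c + e / 2 <= b by move: ceb e0; clear; lra.
  have c2e : c + e / 2 < c + e by move: e0; clear; lra.
  have /(ub_le_sup (ex_intro _ b ubS)) : S (c + e / 2).
    by split; [rewrite c2b (le_trans ax xc2)|exact: ext].
  by rewrite -/c; move: e0; clear; lra.
exact: ext.
Qed.

Definition clampi (a b x : R) := Num.max a (Num.min x b).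

Lemma clampi_itv a b x : a <= b -> a <= clampi a b x <= b.
Proof. by move=> ab; rewrite /clampi le_max lexx/= ge_max ab/= ge_min lexx orbT. Qed.

Lemma clampi_id a b x : a <= x <= b -> clampi a b x = x.
Proof. by move=> /andP[ax xb]; rewrite /clampi (min_idPl xb) (max_idPr ax). Qed.

Lemma clampi_lip a b x y : a <= b -> `|clampi a b x - clampi a b y| <= `|x - y|.
Proof.
move=> ab.
have cl1 u v : u <= v -> 0 <= clampi a b v - clampi a b u <= v - u.
  rewrite /clampi /Order.max /Order.min => uv.
  by repeat case: ifPn; rewrite -?leNgt; move=> *; lra.
have [xy|yx] := leP x y.
  rewrite distrC [leRHS]distrC; have /andP[h1 h2] := cl1 _ _ xy.
  by rewrite !ger0_norm ?subr_ge0// -subr_ge0; lra.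
have /andP[h1 h2] := cl1 _ _ (ltW yx).
by rewrite !ger0_norm ?subr_ge0// -subr_ge0; lra.
Qed.

End Segment.

Section LipschitzDensity.
Context {R : realType}.
Implicit Types (f g : R -> R) (a b c K : R).
Notation mu := (@lebesgue_measure R).

Lemma lipschitz_continuous_real f K :
  (forall x y, `|f x - f y| <= K * `|x - y|) -> continuous f.
Proof.
move=> fK x; apply/cvgrPdist_le => e e0.
have K0 : 0 < `|K| + 1 by rewrite ltr_wpDl.
apply/nbhs_ballP; exists (e / (`|K| + 1)); first by rewrite /= divr_gt0.
move=> y; rewrite /ball/= => xy; apply: (le_trans (fK x y)).
apply: (@le_trans _ _ ((`|K| + 1) * `|x - y|)).
  by rewrite ler_wpM2r// (le_trans (ler_norm _))// lerDl.
by rewrite mulrC -ler_pdivlMr// ltW.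
Qed.

Let cumul g (nd : nondecreasing g) (rc : right_continuous g) : cumulative R R :=
  HB.pack g (isCumulative.Build _ _ _ g nd rc).

(** As [g1 + g2] is linear, the Stieltjes measures of [g1] and [g2] add up to a
multiple of Lebesgue measure. The first one is therefore absolutely continuous,
and Radon-Nikodym provides its density. *)
Lemma stieltjes_density g1 g2 a b K : a < b -> 0 < K ->
  nondecreasing g1 -> nondecreasing g2 -> continuous g1 -> continuous g2 ->
  (forall x, g1 x + g2 x = K * x) ->
  exists h : R -> R, [/\ measurable_fun setT h, mu.-integrable setT (EFin \o h) &
    forall x y, a <= x -> x <= y -> y <= b ->
      (\int[mu]_(t in `]x, y]) (h t)%:E = (g1 y - g1 x)%:E)%E].
Proof.
move=> ab K0 nd1 nd2 c1 c2 g12.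
pose G1 := cumul nd1 (right_continuousW c1).
pose G2 := cumul nd2 (right_continuousW c2).
have lsE (G : cumulative R R) x y : x <= y ->
    lebesgue_stieltjes_measure G `]x, y] = (G y - G x)%:E.
  move=> xy; rewrite /lebesgue_stieltjes_measure /measure_extension.
  by rewrite measurable_mu_extE/= ?wlength_itv_bnd//; exact: is_ocitv.
pose n1 : {measure set (measurableTypeR R) -> \bar R} :=
  lebesgue_stieltjes_measure G1.
pose n2 : {measure set (measurableTypeR R) -> \bar R} :=
  lebesgue_stieltjes_measure G2.
have n1E x y : x <= y -> n1 `]x, y] = (g1 y - g1 x)%:E by exact: lsE.
have n2E x y : x <= y -> n2 `]x, y] = (g2 y - g2 x)%:E by exact: lsE.
have Ki0 : 0 <= K^-1 by rewrite invr_ge0 ltW.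
pose n12 := mscale (NngNum Ki0) (measure_add n1 n2).
have n12v B : n12 B = (K^-1%:E * (n1 B + n2 B))%E.
  by rewrite /n12 /mscale -measure_addE.
have n12E A : measurable A -> mu A = n12 A.
  apply: lebesgue_measure_unique => X /ocitvP[->|[[x y]/= xy ->]].
    by rewrite !measure0.
  apply: (etrans _ (esym (n12v _))).
  rewrite n1E ?n2E ?ltW// lebesgue_measure_itv/=.
  rewrite lte_fin xy -EFinD -EFinM; congr EFin.
  have -> : g1 y - g1 x + (g2 y - g2 x) = K * y - K * x by rewrite -!g12; ring.
  by rewrite -mulrBr mulrA mulVf ?mul1r// gt_eqF.
have mD : measurable (`]a, b] : set (measurableTypeR R)) by exact: measurable_itv.
have n1oo : (n1 `]a, b] < +oo)%E by rewrite n1E ?ltry// ltW.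
pose nu : {finite_measure set (measurableTypeR R) -> \bar R} := mfrestr mD n1oo.
have numu : nu `<< (mu : measure _ _).
  apply/null_content_dominatesP => A mA muA0.
  apply: le_anti; apply/andP; split; last exact: measure_ge0.
  have n1A : (n1 A <= 0)%E.
    move: (n12E _ mA); rewrite muA0 n12v => /esym/eqP.
    rewrite mule_eq0 eqe invr_eq0 gt_eqF//= => /eqP n0.
    by rewrite -n0 leeDl// measure_ge0.
  apply: le_trans n1A; rewrite /nu /= /mfrestr /mrestr.
  by apply: le_measure => //; rewrite ?inE//; apply: measurableI.
have [f [f0 ffin intf fE]] := radon_nikodym_sigma_finite numu.
exists (fine \o f).
have feq : EFin \o (fine \o f) = f.
  by apply/funext => x /=; rewrite fineK.
split.
- by apply/measurable_EFinP; rewrite feq; case/integrableP : intf.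
- by rewrite feq.
move=> x y ax xy yb; rewrite -n1E//.
have -> : n1 `]x, y] = nu `]x, y].
  rewrite /nu /= /mfrestr /mrestr; congr (n1 _).
  rewrite setIidl//; move=> t /=; rewrite !in_itv/= => /andP[xt ty].
  by rewrite (le_lt_trans ax xt) (le_trans ty yb).
by rewrite fE//; apply: eq_integral => t _; rewrite /= fineK.
Qed.

Lemma aeW (P : R -> Prop) : (forall x, P x) -> {ae mu, forall x, P x}.
Proof. by move=> PT; exists set0; split => // x /= /(_ (PT x)). Qed.

Lemma aeS (P Q : R -> Prop) : (forall x, P x -> Q x) ->
  {ae mu, forall x, P x} -> {ae mu, forall x, Q x}.
Proof. by apply: filterS; exact: (ae_filter_ringOfSetsType mu). Qed.

Lemma aeS2 (P Q S : R -> Prop) : (forall x, P x -> Q x -> S x) ->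
  {ae mu, forall x, P x} -> {ae mu, forall x, Q x} -> {ae mu, forall x, S x}.
Proof. by apply: filterS2; exact: (ae_filter_ringOfSetsType mu). Qed.

Lemma aeS3 (P Q S T : R -> Prop) : (forall x, P x -> Q x -> S x -> T x) ->
  {ae mu, forall x, P x} -> {ae mu, forall x, Q x} -> {ae mu, forall x, S x} ->
  {ae mu, forall x, T x}.
Proof. by apply: filterS3; exact: (ae_filter_ringOfSetsType mu). Qed.

Lemma ae_neq c : {ae mu, forall x, x != c}.
Proof.
exists [set c]; split; [exact: measurable_set1|exact: lebesgue_measure_set1|].
by move=> x /= /negP; rewrite negbK => /eqP.
Qed.

Lemma derivable_near (V : normedModType R) (f g : R -> V) (x : R) :
  (\forall y \near x, f y = g y) ->
  derivable g x 1 -> derivable f x 1 /\ f^`() x = g^`() x.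
Proof.
move=> fg dg; split.
  by apply: near_eq_derivable dg; near=> y; apply/esym; near: y.
by rewrite !derive1E; apply: near_eq_derive.
Unshelve. all: by end_near. Qed.

Lemma derive1_cvg (V : normedModType R) (f : R -> V) x : derivable f x 1 ->
  h^-1 *: (f (h + x) - f x) @[h --> 0^'] --> f^`() x.
Proof.
move=> df; rewrite /derive1; apply/cvg_ex; case/cvg_ex : df => l /= df.
exists l; move: df; rewrite /derive.
by under eq_fun do rewrite [_ *: 1]mulr1.
Qed.

Lemma lipschitz_derive_le f (x : R) K :
  (\forall y \near x, `|f y - f x| <= K * `|y - x|) ->
  derivable f x 1 -> `|f^`() x| <= K.
Proof.
move=> fK /derive1_cvg df.
apply: (cvgr_to_le (cvg_norm df)).
have : \forall h \near 0^', `|f (h + x) - f x| <= K * `|h|.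
  have : \forall h \near 0, `|f (h + x) - f x| <= K * `|h|.
    move/nbhs_ballP : fK => -[e /= e0 fK]; apply/nbhs_ballP; exists e => //= h.
    rewrite /ball/= sub0r normrN => he.
    have := fK (h + x); rewrite addrK; apply.
    by rewrite /ball/= distrC addrK.
  exact: cvg_within.
move=> fK'; near=> h.
have h0 : h != 0 by near: h; exact: nbhs_dnbhs_neq.
rewrite normrZ normfV mulrC ler_pdivrMr ?normr_gt0//.
by near: h.
Unshelve. all: by end_near. Qed.

(** Rademacher's theorem in dimension one. For [K1 > K] the functions [K1 x + f
x] and [K1 x - f x] are nondecreasing with a linear sum, so [stieltjes_density]
applies, and Lebesgue differentiation identifies the density with the
derivative. *)
Lemma lipschitz_density f a b K : a < b -> 0 <= K ->
  (forall x y, a <= x <= b -> a <= y <= b -> `|f x - f y| <= K * `|x - y|) ->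
  exists h : R -> R, [/\ measurable_fun setT h, forall x, `|h x| <= K,
    forall x y, a <= x -> x <= y -> y <= b ->
      f y - f x = \int[mu]_(t in `[x, y]) h t &
    {ae mu, forall x, a < x < b -> derivable f x 1 /\ f^`() x = h x}].
Proof.
move=> ab K0 fK.
have leab := ltW ab; pose fc x := f (clampi a b x).
have fcK x y : `|fc x - fc y| <= K * `|x - y|.
  by rewrite (le_trans (fK _ _ (clampi_itv x leab) (clampi_itv y leab)))// ler_wpM2l// clampi_lip.
have cfc : continuous fc by exact: lipschitz_continuous_real fcK.
pose K1 := K + 1.
have K10 : 0 < K1 by rewrite ltr_wpDl.
have fcK1 x y : x <= y -> `|fc y - fc x| <= K1 * (y - x).
  move=> xy; rewrite (le_trans (fcK _ _))// (ger0_norm (_ : 0 <= y - x)) ?subr_ge0//.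
  by rewrite ler_wpM2r ?subr_ge0// lerDl.
pose g1 x := fc x + K1 * x.
pose g2 x := K1 * x - fc x.
have nd1 : nondecreasing g1.
  by move=> x y xy; have := fcK1 _ _ xy; rewrite ler_norml /g1; lra.
have nd2 : nondecreasing g2.
  by move=> x y xy; have := fcK1 _ _ xy; rewrite ler_norml /g2; lra.
have cK1 : continuous (fun x : R => K1 * x).
  by move=> x; apply: cvgM; [exact: cvg_cst|exact: cvg_id].
have c1 : continuous g1 by move=> x; apply: cvgD; [exact: cfc|exact: cK1].
have c2 : continuous g2 by move=> x; apply: cvgB; [exact: cK1|exact: cfc].
have K20 : 0 < 2 * K1 by rewrite mulr_gt0.
have g12 x : g1 x + g2 x = 2 * K1 * x by rewrite /g1 /g2; ring.
have [h0 [mh0 ih0 h0E]] := stieltjes_density ab K20 nd1 nd2 c1 c2 g12.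
pose h1 t := h0 t - K1.
have mh1 : measurable_fun setT h1 by apply: measurable_funB.
have icst x y : mu.-integrable `[x, y] (EFin \o cst K1).
  apply: continuous_compact_integrable; first exact: segment_compact.
  by apply: continuous_subspaceT; exact: cst_continuous.
have ih1 x y : mu.-integrable `[x, y] (EFin \o h1).
  have -> : EFin \o h1 = ((EFin \o h0) \- (EFin \o cst K1))%E.
    by apply/funext => t /=; rewrite EFinB.
  apply: integrableB => //=.
  by apply: integrableS ih0.
have h1E x y : a <= x -> x <= y -> y <= b ->
    f y - f x = \int[mu]_(t in `[x, y]) h1 t.
  move=> ax xy yb.
  rewrite /h1 RintegralB//=; last by apply: integrableS ih0.
  rewrite Rintegral_cst//= lebesgue_measure_itv/= lte_fin.
  have -> : fine (if x < y then (y%:E - x%:E)%E else 0%E) = y - x.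
    case: ifPn => //; rewrite -leNgt => yx.
    by have -> : x = y by [apply/le_anti; rewrite xy yx]; rewrite subrr.
  rewrite -(@Rintegral_itv_obnd_cbnd _ x (BRight y)); last first.
    by apply: integrableS ih0.
  rewrite {1}/Rintegral h0E//= /g1 /fc !clampi_id ?ax ?yb ?(le_trans ax xy) ?(le_trans xy yb)//.
  by ring.
pose G y := \int[mu]_(t in `[a, y]) h1 t.
have lh1 : locally_integrable setT h1.
  apply: locally_integrableB; first exact: open_integrable_locally openT ih0.
  split; [by []|exact: openT|move=> C _ cC].
  rewrite integral_cst/=; last exact: compact_measurable.
  by rewrite lte_mul_pinfty//; exact: compact_finite_measure.
have aeG : {ae mu, forall x, a < x -> derivable G x 1 /\ G^`() x = h1 x}.
  exact: (@FTC1 R h1 (BLeft a) (fun y => ih1 a y) lh1).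
have aef : {ae mu, forall x, a < x < b -> derivable f x 1 /\ f^`() x = h1 x}.
  apply: aeS aeG => x Gx /andP[ax xb]; have [dG <-] := Gx ax.
  have fG : \forall y \near x, f y = f a + G y.
    near=> y; rewrite /G -(h1E a y)//; first by ring.
      by apply: ltW; near: y; exact: lt_nbhsr.
    by apply: ltW; near: y; exact: lt_nbhsl.
  have [df ->] := derivable_near fG (derivableD (derivable_cst _ _ _) dG).
  split; first exact: df.
  by rewrite derive1E; have -> := deriveD (derivable_cst (f a) x 1) dG; rewrite derive_cst add0r -derive1E.
have aeK : {ae mu, forall x, a < x < b -> `|h1 x| <= K}.
  apply: aeS aef => x fx axb; have [df <-] := fx axb.
  have /andP[ax xb] := axb; apply: lipschitz_derive_le df; near=> y; apply: fK.
    apply/andP; split; apply: ltW; near: y; first exact: lt_nbhsr.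
    exact: lt_nbhsl.
  by rewrite !ltW.
(* the density is only bounded by [K] almost everywhere; force it *)
pose h t := if `|h1 t| <= K then h1 t else 0.
have hh1 t : `|h1 t| <= K -> h t = h1 t by rewrite /h => ->.
exists h; split.
- apply: measurable_fun_ifT => //.
  by apply: measurable_fun_ler => //; exact: measurableT_comp.
- by move=> t; rewrite /h; case: ifPn => //; rewrite normr0.
- move=> x y ax xy yb; rewrite h1E//.
  rewrite /Rintegral; congr fine; apply: ae_eq_integral => //.
  - by apply/measurable_EFinP; exact: measurable_funTS.
  - apply/measurable_EFinP; apply: measurable_funTS; apply: measurable_fun_ifT => //.
    by apply: measurable_fun_ler => //; exact: measurableT_comp.
  apply: aeS3 aeK (ae_neq a) (ae_neq b) => t hK ta tb /=.
  rewrite in_itv/= => /andP[xt ty]; rewrite hh1// hK//.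
  by rewrite !lt_neqAle eq_sym ta tb (le_trans ax xt) (le_trans ty yb).
- apply: aeS2 aef aeK => x fx hx axb.
  by rewrite hh1//; [exact: fx|exact: hx].
Unshelve. all: by end_near. Qed.

End LipschitzDensity.

(** * The Euclidean norm and curves in Euclidean space *)

Section EuclideanNorm.
Context {R : realType} {n : nat}.
Implicit Types (u v w : 'rV[R]_n) (a : R).

Definition dot u v : R := \sum_(i < n) u 0 i * v 0 i.

Lemma dotC u v : dot u v = dot v u.
Proof. by apply: eq_bigr => i _; rewrite mulrC. Qed.

Lemma dotDl u v w : dot (u + v) w = dot u w + dot v w.
Proof. by rewrite /dot -big_split/=; apply: eq_bigr => i _; rewrite !mxE mulrDl. Qed.

Lemma dotDr u v w : dot w (u + v) = dot w u + dot w v.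
Proof. by rewrite dotC dotDl !(dotC w). Qed.

Lemma dotZl a u w : dot (a *: u) w = a * dot u w.
Proof. by rewrite /dot mulr_sumr; apply: eq_bigr => i _; rewrite !mxE mulrA. Qed.

Lemma dotZr a u w : dot w (a *: u) = a * dot w u.
Proof. by rewrite dotC dotZl dotC. Qed.

Lemma dotNl u w : dot (- u) w = - dot u w.
Proof. by rewrite -scaleN1r dotZl mulN1r. Qed.

Lemma dotNr u w : dot w (- u) = - dot w u.
Proof. by rewrite dotC dotNl dotC. Qed.

Lemma dot0l u : dot 0 u = 0.
Proof. by rewrite /dot big1// => i _; rewrite mxE mul0r. Qed.

Lemma enorm_ge0 u : 0 <= enorm u.
Proof. exact: sqrtr_ge0. Qed.

Lemma sqr_enorm u : enorm u ^+ 2 = dot u u.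
Proof.
rewrite /enorm sqr_sqrtr; first by apply: eq_bigr => i _; rewrite expr2.
by apply: sumr_ge0 => i _; exact: sqr_ge0.
Qed.

Lemma enormE u : enorm u = Num.sqrt (dot u u).
Proof. by rewrite -sqr_enorm sqrtr_sqr ger0_norm// enorm_ge0. Qed.

Lemma enorm0 : enorm (0 : 'rV[R]_n) = 0.
Proof. by rewrite enormE dot0l sqrtr0. Qed.

Lemma enormZ a u : enorm (a *: u) = `|a| * enorm u.
Proof. by rewrite !enormE dotZl dotZr mulrA -expr2 sqrtrM ?sqr_ge0// sqrtr_sqr. Qed.

Lemma enormN u : enorm (- u) = enorm u.
Proof. by rewrite -scaleN1r enormZ normrN1 mul1r. Qed.

Lemma enormB u v : enorm (u - v) = enorm (v - u).
Proof. by rewrite -enormN opprB. Qed.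

Lemma coord_le_enorm u i : `|u 0 i| <= enorm u.
Proof.
rewrite -sqrtr_sqr; apply: ler_wsqrtr.
by rewrite (bigD1 i)//= lerDl; apply: sumr_ge0 => j _; exact: sqr_ge0.
Qed.

Lemma enorm_eq0 u : enorm u = 0 -> u = 0.
Proof.
move=> u0; apply/rowP => i; rewrite mxE; apply/eqP; rewrite -normr_le0 -u0.
exact: coord_le_enorm.
Qed.

Lemma dot_le u v : dot u v <= enorm u * enorm v.
Proof.
have [/enorm_eq0 ->|u0] := eqVneq (enorm u) 0.
  by rewrite dot0l enorm0 mul0r.
have [/enorm_eq0 ->|v0] := eqVneq (enorm v) 0.
  by rewrite dotC dot0l enorm0 mulr0.
have up : 0 < enorm u by rewrite lt_neqAle eq_sym u0 enorm_ge0.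
have vp : 0 < enorm v by rewrite lt_neqAle eq_sym v0 enorm_ge0.
have : 0 <= enorm (enorm v *: u - enorm u *: v) ^+ 2 by exact: sqr_ge0.
rewrite sqr_enorm !(dotDl, dotDr, dotNl, dotNr, dotZl, dotZr) -!sqr_enorm (dotC v u).
set a := enorm u; set b := enorm v; set c := dot u v => H.
have : 0 <= (2 * a * b) * (a * b - c) by apply: le_trans H _; rewrite le_eqVlt; apply/orP; left; apply/eqP; ring.
by rewrite pmulr_rge0 ?subr_ge0// !mulr_gt0.
Qed.

Lemma ler_enormD u v : enorm (u + v) <= enorm u + enorm v.
Proof.
rewrite -(@ler_pXn2r _ 2)// ?nnegrE ?addr_ge0 ?enorm_ge0//.
rewrite sqr_enorm !(dotDl, dotDr) -!sqr_enorm (dotC v u).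
by have := dot_le u v; nra.
Qed.

Lemma ler_enorm_trans w u v : enorm (u - v) <= enorm (u - w) + enorm (w - v).
Proof. by rewrite (le_trans _ (ler_enormD _ _))// addrA subrK. Qed.

Lemma ler_distB_enorm u v : `|enorm u - enorm v| <= enorm (u - v).
Proof.
have := ler_enormD (u - v) v; have := ler_enormD (v - u) u.
rewrite !subrK enormB ler_norml => h1 h2; apply/andP; lra.
Qed.

Lemma norm_le_enorm u : `|u| <= enorm u.
Proof.
rewrite /Num.Def.normr/= mx_normrE; apply: bigmax_le; first exact: enorm_ge0.
by move=> [i j] _ /=; rewrite (ord1 i); exact: coord_le_enorm.
Qed.

Lemma coord_le_norm u i : `|u 0 i| <= `|u|.
Proof.
rewrite [leRHS]/Num.Def.normr/= mx_normrE.
by apply: le_trans; last exact: (le_bigmax _ _ (0, i)).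
Qed.

Lemma enorm_le_sum u : enorm u <= \sum_(i < n) `|u 0 i|.
Proof.
rewrite -(@ler_pXn2r _ 2)// ?nnegrE ?enorm_ge0//; last exact: sumr_ge0.
rewrite sqr_enorm expr2 mulr_suml; apply: ler_sum => i _.
rewrite (le_trans (ler_norm _))// normrM ler_wpM2l// (bigD1 i)//= lerDl.
exact: sumr_ge0.
Qed.

Lemma enorm_le_norm u : enorm u <= n%:R * `|u|.
Proof.
apply: (le_trans (enorm_le_sum u)).
have -> : n%:R * `|u| = \sum_(i < n) `|u|.
  by rewrite sumr_const card_ord mulr_natl.
by apply: ler_sum => i _; exact: coord_le_norm.
Qed.

Lemma nbhs_enormP (x : 'rV[R]_n) (A : set 'rV[R]_n) :
  nbhs x A <-> exists2 e, 0 < e & forall y, enorm (y - x) < e -> A y.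
Proof.
split.
  move=> /nbhs_ballP[e /= e0 eA]; exists e => // y yx; apply: eA.
  by rewrite -ball_normE/= -normrN opprB (le_lt_trans (norm_le_enorm _)).
move=> [e e0 eA]; apply/nbhs_ballP; exists (e / n.+1%:R); first by rewrite /= divr_gt0.
move=> y; rewrite -ball_normE/= => xy; apply: eA.
rewrite enormB (le_lt_trans (enorm_le_norm _))//.
apply: (@le_lt_trans _ _ (n.+1%:R * `|x - y|)); first by rewrite ler_wpM2r// ler_nat.
by rewrite mulrC -ltr_pdivlMr.
Qed.

Lemma near_enorm (x : 'rV[R]_n) (e : R) : 0 < e -> \forall y \near x, enorm (y - x) < e.
Proof. by move=> e0; apply/nbhs_enormP; exists e. Qed.

Lemma continuous_enormB (x : 'rV[R]_n) : continuous (fun y : 'rV[R]_n => enorm (y - x)).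
Proof.
move=> y A /nbhs_ballP[e /= e0 eA]; apply/nbhs_enormP; exists e => // z zy.
apply: eA; rewrite /ball/= (le_lt_trans (ler_distB_enorm _ _))//.
by rewrite opprB addrA subrK enormB.
Qed.

Lemma continuous_enorm : continuous (@enorm R n).
Proof.
have -> : @enorm R n = fun y => enorm (y - 0) by apply/funext => y; rewrite subr0.
exact: continuous_enormB.
Qed.

Lemma compact_enorm_ball (x : 'rV[R]_n) (r : R) : compact [set y | enorm (y - x) <= r].
Proof.
apply: bounded_closed_compact.
  exists (`|x| + r); split; first exact: num_real.
  move=> M xM y /= yx; apply: ltW; apply: le_lt_trans xM.
  rewrite -[y](subrK x) addrC (le_trans (ler_normD _ _))// lerD2l.
  exact: le_trans (norm_le_enorm _) yx.
apply: (preimage_closed (f:=fun y : 'rV[R]_n => enorm (y - x)) (D:=[set t | t <= r])).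
  by move=> y _; exact: continuous_enormB.
exact: closed_le.
Qed.

End EuclideanNorm.

Section VectorCurves.
Context {R : realType} {n : nat}.
Implicit Types (U G : R -> 'rV[R]_n) (a b K : R).
Notation mu := (@lebesgue_measure R).

Lemma derivable_coord U t (i : 'I_n) : derivable U t 1 ->
  derivable (fun x => U x 0 i) t 1 /\ (fun x => U x 0 i)^`() t = U^`() t 0 i.
Proof.
move=> dU; split; first exact: (derivable_mxP U t 1).1 dU 0 i.
by rewrite !derive1E derive_mx// mxE.
Qed.

Lemma derivable_coords U t : (forall i, derivable (fun x => U x 0 i) t 1) ->
  derivable U t 1.
Proof. by move=> dU; apply/derivable_mxP => i j; rewrite (ord1 i). Qed.

Lemma derive1_coords U t (V : 'rV[R]_n) :
  (forall i, derivable (fun x => U x 0 i) t 1 /\ (fun x => U x 0 i)^`() t = V 0 i) ->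
  derivable U t 1 /\ U^`() t = V.
Proof.
move=> dU; have dUt : derivable U t 1 by apply: derivable_coords => i; have [] := dU i.
split => //; apply/rowP => i; have [_ <-] := derivable_coord i dUt.
by have [_ ->] := dU i.
Qed.

Lemma measurable_coord_enorm (D : set R) G : (forall i, measurable_fun D (fun t => G t 0 i)) ->
  measurable_fun D (fun t => enorm (G t)).
Proof.
move=> mG; apply: (@measurableT_comp _ _ _ _ _ _ (@Num.sqrt R)).
  by apply: continuous_measurable_fun; exact: sqrt_continuous.
by apply: measurable_sum => i; exact: measurable_funX.
Qed.

Lemma cvg_coords (T : Type) (F : set_system T) (FF : Filter F) (f : T -> 'rV[R]_n) (l : 'rV[R]_n) :
  (forall i, f x 0 i @[x --> F] --> l 0 i) -> f @ F --> l.
Proof.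
move=> fl A /nbhs_ballP[e /= e0 eA].
have : \forall x \near F, forall i, ball (l 0 i) e (f x 0 i).
  by apply: filter_forall => i; apply: fl; exact: nbhsx_ballx.
by apply: filterS => x fx; apply: eA; split => // i j; rewrite (ord1 i).
Qed.

Lemma cvg_coord (T : Type) (F : set_system T) (FF : Filter F) (f : T -> 'rV[R]_n) (l : 'rV[R]_n) i :
  f @ F --> l -> f x 0 i @[x --> F] --> l 0 i.
Proof.
move=> fl A /nbhs_ballP[e /= e0 eA].
have : \forall x \near F, ball l e (f x) by apply: fl; exact: nbhsx_ballx.
by apply: filterS => x [_ fx]; apply: eA; exact: fx.
Qed.

Lemma lipschitz_curve_density U a b K : a < b -> 0 <= K ->
  (forall x y, a <= x <= b -> a <= y <= b -> enorm (U x - U y) <= K * `|x - y|) ->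
  exists G : R -> 'rV[R]_n, [/\ forall i, measurable_fun setT (fun t => G t 0 i),
    forall t i, `|G t 0 i| <= K,
    forall i x y, a <= x -> x <= y -> y <= b ->
      U y 0 i - U x 0 i = \int[mu]_(t in `[x, y]) G t 0 i &
    {ae mu, forall x, a < x < b -> derivable U x 1 /\ U^`() x = G x}].
Proof.
move=> ab K0 UK.
have H i := @lipschitz_density R (fun x => U x 0 i) a b K ab K0.
have UKi i x y : a <= x <= b -> a <= y <= b -> `|U x 0 i - U y 0 i| <= K * `|x - y|.
  move=> xab yab; rewrite (le_trans _ (UK x y xab yab))//.
  by have := coord_le_enorm (U x - U y) i; rewrite !mxE.
pose h i := sval (cid (H i (UKi i))).
pose G t := \row_i h i t.
have hP i := svalP (cid (H i (UKi i))).
exists G; split.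
- by move=> i; under eq_fun do rewrite mxE; have [] := hP i.
- by move=> t i; rewrite mxE; have [_ + _ _] := hP i; exact.
- move=> i x y ax xy yb; have [_ _ + _] := hP i => -> //.
  by apply: eq_Rintegral => t _; rewrite mxE.
have : {ae mu, forall x, forall i : 'I_n, a < x < b ->
    derivable (fun x => U x 0 i) x 1 /\ (fun x => U x 0 i)^`() x = h i x}.
  have : {ae mu, forall x, forall k : nat, forall i : 'I_n, i = k :> nat -> a < x < b ->
    derivable (fun x => U x 0 i) x 1 /\ (fun x => U x 0 i)^`() x = h i x}.
    apply: ae_foralln => k.
    have [kn|nk] := ltnP k n; last first.
      by apply: aeW => x i ik; move: nk; rewrite -ik leqNgt ltn_ord.
    have [_ _ _] := hP (Ordinal kn); apply: aeS => x hx i ik.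
    by have -> : i = Ordinal kn by exact: val_inj.
  by apply: aeS => x hx i; exact: (hx i i erefl).
apply: aeS => x hx axb; apply: derive1_coords => i; rewrite mxE; exact: hx.
Qed.

(** Absolute continuity of [U] on [a, b], with [G] as its derivative. *)
Definition acurve U G a b := forall i, mu.-integrable `[a, b] (fun t => (G t 0 i)%:E) /\
  forall x y, a <= x -> x <= y -> y <= b -> U y 0 i - U x 0 i = \int[mu]_(t in `[x, y]) G t 0 i.

Lemma integrable_coord_enorm (D : set R) G : measurable D ->
  (forall i, mu.-integrable D (fun t => (G t 0 i)%:E)) ->
  mu.-integrable D (fun t => (enorm (G t))%:E).
Proof.
move=> mD iG.
have iS : mu.-integrable D (fun t => (\sum_(i < n) `|G t 0 i|)%:E).
  under eq_fun do rewrite -sumEFin.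
  by apply: integrable_sum => // i _; exact: integrable_abse (iG i).
apply: le_integrable iS => //.
  apply/measurable_EFinP; apply: measurable_coord_enorm => i.
  by apply/measurable_EFinP; case/integrableP : (iG i).
move=> t Dt; rewrite /= lee_fin ger0_norm ?enorm_ge0// ger0_norm; first exact: enorm_le_sum.
exact: sumr_ge0.
Qed.

Lemma Rintegral_sum (I : Type) (s : seq I) (D : set R) (f : I -> R -> R) : measurable D ->
  (forall i, mu.-integrable D (EFin \o f i)) ->
  \int[mu]_(t in D) (\sum_(i <- s) f i t) = \sum_(i <- s) \int[mu]_(t in D) f i t.
Proof.
move=> mD fi; elim: s => [|i s IH].
  rewrite big_nil; under eq_Rintegral do rewrite big_nil.
  by rewrite Rintegral_cst// mul0r.
rewrite big_cons -IH -RintegralD//.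
  by apply: eq_Rintegral => t _; rewrite big_cons.
have -> : EFin \o (fun t => \sum_(j <- s) f j t) =
    (fun t => (\sum_(j <- s) (EFin \o f j) t)%E).
  by apply/funext => t /=; rewrite sumEFin.
by apply: integrable_sum => // j _; exact: fi.
Qed.

Lemma integrableZ_real (D : set R) (f : R -> R) (c : R) : measurable D ->
  mu.-integrable D (EFin \o f) -> mu.-integrable D (EFin \o (fun t => c * f t)).
Proof.
move=> mD fi; have -> : EFin \o (fun t => c * f t) = (fun t => c%:E * (EFin \o f) t)%E.
  by apply/funext => t /=; rewrite EFinM.
exact: integrableZl.
Qed.

(** Pairing both sides with [v] reduces the inequality to Cauchy-Schwarz under
the integral sign. *)
Lemma enorm_Rintegral (D : set R) G (v : 'rV[R]_n) : measurable D ->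
  (forall i, mu.-integrable D (fun t => (G t 0 i)%:E)) ->
  (forall i, v 0 i = \int[mu]_(t in D) G t 0 i) ->
  enorm v <= \int[mu]_(t in D) enorm (G t).
Proof.
move=> mD iG vE.
have [v0|v0] := eqVneq (enorm v) 0.
  by rewrite v0; apply: Rintegral_ge0 => t _; exact: enorm_ge0.
have vp : 0 < enorm v by rewrite lt_neqAle eq_sym v0 enorm_ge0.
rewrite -(ler_pM2l vp) -expr2 sqr_enorm.
have iN := integrable_coord_enorm mD iG.
have iZ i : mu.-integrable D (EFin \o (fun t => v 0 i * G t 0 i)).
  by apply: integrableZ_real => //; exact: iG.
have -> : dot v v = \int[mu]_(t in D) dot v (G t).
  rewrite /dot Rintegral_sum//; apply: eq_bigr => i _.
  by rewrite {2}vE RintegralZl//; exact: iG.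
rewrite -RintegralZl//; apply: le_Rintegral => //.
- have -> : EFin \o (fun t => dot v (G t)) =
    (fun t => (\sum_(j < n) (EFin \o (fun t => (v 0 j * G t 0 j)%R)) t)%E).
    by apply/funext => t /=; rewrite sumEFin.
  by apply: integrable_sum => // j _; exact: iZ.
- exact: integrableZ_real.
- by move=> t _; exact: dot_le.
Qed.

Lemma acurve_enorm U G a b x y : acurve U G a b -> a <= x -> x <= y -> y <= b ->
  enorm (U y - U x) <= \int[mu]_(t in `[x, y]) enorm (G t).
Proof.
move=> UG ax xy yb; apply: enorm_Rintegral => // i.
  have [iG _] := UG i; apply: integrableS iG => //.
  by apply: subset_itv; rewrite bnd_simp.
by have [_ UGi] := UG i; rewrite !mxE UGi.
Qed.

End VectorCurves.

Section LowerIntegral.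
Context {R : realType}.
Notation mu := (@lebesgue_measure R).
Import HBNNSimple.
Implicit Types (f g w : R -> R) (D : set R).

(** The integral of a nonnegative function is a supremum over the simple
functions below it, so this comparison is free of measurability conditions. That
matters for integrands containing [derive1 g], about which nothing is known on
the wells. *)
Lemma le_integral_ge0 D (f g : R -> \bar R) : (forall x, D x -> 0 <= f x)%E ->
  (forall x, D x -> f x <= g x)%E ->
  (\int[mu]_(x in D) f x <= \int[mu]_(x in D) g x)%E.
Proof.
move=> f0 fg; have g0 x : D x -> (0 <= g x)%E by move=> Dx; exact: le_trans (f0 x Dx) (fg x Dx).
rewrite !ge0_integralE//=; apply: ereal_sup_le => _ [h hf <-].
exists h => //= x; apply: le_trans (hf x) _.
by rewrite !patchE; case: ifPn => // xD; apply: fg; rewrite inE in xD.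
Qed.

(** A simple function below [f] is first set to zero on the exceptional null
set. *)
Lemma ae_le_integral_ge0 D (f g : R -> \bar R) : measurable D ->
  (forall x, D x -> 0 <= f x)%E -> (forall x, D x -> 0 <= g x)%E ->
  {ae mu, forall x, D x -> (f x <= g x)%E} ->
  (\int[mu]_(x in D) f x <= \int[mu]_(x in D) g x)%E.
Proof.
move=> mD f0 g0 [N [mN N0 fgN]].
rewrite !ge0_integralE//=; apply: ge_ereal_sup => _ [h hf <-].
have mNC : measurable (~` N) by exact: measurableC.
have mNCi : measurable_fun setT (\1_(~` N) : R -> R) by exact: measurable_indic.
pose h' : {nnsfun (measurableTypeR R) >-> R} := proj_nnsfun h mNC.
have -> : sintegral mu h = sintegral mu h'.
  rewrite -!integralT_nnsfun//; apply: ge0_ae_eq_integral => //.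
  - exact/measurable_EFinP.
  - exact/measurable_EFinP.
  - by move=> x _; rewrite lee_fin.
  - by move=> x _; rewrite lee_fin.
  exists N; split => // x /= /not_implyP[_]; apply: contra_notP => xN.
  by rewrite /proj_nnsfun/= /mindic indicE mem_set ?mulr1.
apply: ereal_sup_ubound; exists h' => // x.
rewrite patchE /proj_nnsfun/= /mindic indicE; case: (asboolP (N x)) => xN.
  have -> : (x \in ~` N) = false by apply: memNset => xNN; exact: xNN xN.
  rewrite mulr0.
  by case: ifPn => // xD; apply: g0; rewrite inE in xD.
rewrite mem_set//= mulr1; apply: le_trans (hf x) _; rewrite patchE.
case: ifPn => // xD; apply: contrapT => nfg; apply: xN; apply: fgN => /=.
by apply/not_implyP; split => //; rewrite inE in xD.
Qed.

Lemma ae_eq_integral_ge0 D (f g : R -> \bar R) : measurable D ->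
  (forall x, D x -> 0 <= f x)%E -> (forall x, D x -> 0 <= g x)%E ->
  {ae mu, forall x, D x -> f x = g x} ->
  (\int[mu]_(x in D) f x = \int[mu]_(x in D) g x)%E.
Proof.
move=> mD f0 g0 fg; apply: le_anti; apply/andP; split; apply: ae_le_integral_ge0 => //.
  by apply: aeS fg => x fx Dx; rewrite fx.
by apply: aeS fg => x fx Dx; rewrite fx.
Qed.

Section Affine.
Variables (al c : R).
Hypothesis c0 : 0 < c.
Let phi (s : R) : R := al + c * s.

Let mphi : measurable_fun [set: measurableTypeR R] (phi : _ -> measurableTypeR R).
Proof. by apply: measurable_funD => //; exact: measurable_funM. Qed.

Lemma affine_preimage_itv (b1 b2 : bool) (x y : R) :
  phi @^-1` [set` Interval (BSide b1 (phi x)) (BSide b2 (phi y))] =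
  [set` Interval (BSide b1 x) (BSide b2 y)].
Proof.
have phile s t : (phi s <= phi t) = (s <= t) by rewrite lerD2l ler_pM2l.
have philt s t : (phi s < phi t) = (s < t) by rewrite ltrD2l ltr_pM2l.
apply/seteqP; split => t /=; rewrite !in_itv/=.
  by case: b1; case: b2; rewrite /= ?phile ?philt.
by case: b1; case: b2; rewrite /= ?phile ?philt.
Qed.

(** Both sides are measures in [A], and they agree on half-open intervals. *)
Lemma affine_measure (A : set R) : measurable A ->
  mu A = (c%:E * mu (phi @^-1` A))%E.
Proof.
pose pf0 := (pushforward mu (phi : _ -> measurableTypeR R) :
  {measure set (measurableTypeR R) -> \bar R}).
pose m' := mscale (NngNum (ltW c0)) (pf0 mphi).
move=> mA; rewrite (_ : (c%:E * mu (phi @^-1` A))%E = m' A)//.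
apply: lebesgue_measure_unique => //= X /ocitvP[->|[[x y]/= xy ->]].
  by rewrite !measure0.
pose x' := c^-1 * (x - al); pose y' := c^-1 * (y - al).
have cn : c != 0 by rewrite gt_eqF.
have xE : x = phi x' by rewrite /phi /x' mulrA mulfV// mul1r addrC subrK.
have yE : y = phi y' by rewrite /phi /y' mulrA mulfV// mul1r addrC subrK.
apply: (@etrans _ _ (c%:E * mu (phi @^-1` `]x, y]))%E) => //.
rewrite {2}xE {2}yE affine_preimage_itv !lebesgue_measure_itv/= !lte_fin xy.
have -> : x' < y' by rewrite ltr_pM2l ?invr_gt0// ltrD2r.
by rewrite -!EFinD -EFinM; congr EFin; rewrite xE yE /phi; ring.
Qed.

Lemma affine_ae (P : R -> Prop) : {ae mu, forall x, P x} -> {ae mu, forall s, P (phi s)}.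
Proof.
move=> [N [mN N0 PN]]; exists (phi @^-1` N); split.
- by rewrite -[X in measurable X]setTI; exact: mphi.
- have := affine_measure mN; rewrite N0 => /esym/eqP.
  by rewrite mule_eq0 eqe gt_eqF//= => /eqP.
- by move=> s /= nP; apply: PN.
Qed.

Lemma affine_integral (w : R -> R) (a b : R) : measurable_fun setT w -> (forall t, 0 <= w t) ->
  (\int[mu]_(t in `[phi a, phi b]) (w t)%:E =
   \int[mu]_(s in `[a, b]) (c * w (phi s))%:E)%E.
Proof.
move=> mw w0.
have mwE : measurable_fun `[phi a, phi b] (EFin \o w).
  by apply/measurable_EFinP; exact: measurable_funTS.
pose pf0 := (pushforward mu (phi : _ -> measurableTypeR R) :
  {measure set (measurableTypeR R) -> \bar R}).
transitivity (\int[mscale (NngNum (ltW c0)) (pf0 mphi)]_(t in `[phi a, phi b]) (w t)%:E)%E.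
  by apply: eq_measure_integral => A mA _; exact: affine_measure.
rewrite ge0_integral_mscale//=; last by move=> x _; rewrite lee_fin.
rewrite ge0_integral_pushforward//=; last by move=> x _; rewrite lee_fin.
rewrite (affine_preimage_itv true false) -ge0_integralZl//.
- apply/measurable_EFinP; apply: measurable_funTS.
  exact: (measurableT_comp mw mphi).
- by move=> x _; rewrite lee_fin.
- by rewrite lee_fin ltW.
Qed.

End Affine.
End LowerIntegral.

Section LocalLipschitz.
Context {R : realType}.
Implicit Types (f : R -> R) (a b : R).

(** By [cousin]: on two adjacent intervals the sum of the two Lipschitz
constants will do. *)
Lemma locally_lipschitz_itv f a b : a <= b ->
  (forall t, a <= t <= b -> exists2 e, 0 < e & exists K, forall s s',
     a <= s <= b -> a <= s' <= b -> `|s - t| < e -> `|s' - t| < e ->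
     `|f s - f s'| <= K * `|s - s'|) ->
  exists2 K, 0 <= K & forall s s', a <= s <= b -> a <= s' <= b ->
    `|f s - f s'| <= K * `|s - s'|.
Proof.
move=> ab loc; pose P x y := exists2 K, 0 <= K & forall s s', x <= s <= y -> x <= s' <= y ->
    `|f s - f s'| <= K * `|s - s'|.
have sym K x y : (forall s s', x <= s -> s <= s' -> s' <= y -> `|f s - f s'| <= K * (s' - s)) ->
    forall s s', x <= s <= y -> x <= s' <= y -> `|f s - f s'| <= K * `|s - s'|.
  move=> H s s' /andP[xs sy] /andP[xs' sy']; have [ss|/ltW ss] := leP s s'.
    by rewrite [X in K * X]distrC (ger0_norm (_ : 0 <= s' - s)) ?subr_ge0//; exact: H.
  by rewrite distrC (ger0_norm (_ : 0 <= s - s')) ?subr_ge0//; exact: H.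
apply: (cousin (P := P) ab) => [x y z ax xy yz zb [K K0 fK] [L L0 fL]|t tab].
  exists (K + L); first exact: addr_ge0.
  have KL s s' : s <= s' -> K * (s' - s) <= (K + L) * (s' - s) /\ L * (s' - s) <= (K + L) * (s' - s).
    by move=> ss; rewrite !ler_wpM2r ?subr_ge0// ?lerDl ?lerDr.
  apply: sym => s s' xs ss sz; have [s'y|/ltW ys'] := leP s' y.
    apply: le_trans (KL s s' ss).1; rewrite -[s' - s]ger0_norm ?subr_ge0// [X in K * X]distrC.
    by apply: fK; apply/andP; split => //; [exact: le_trans ss s'y|exact: le_trans xs ss].
  have [ys|/ltW sy] := leP y s.
    apply: le_trans (KL s s' ss).2; rewrite -[s' - s]ger0_norm ?subr_ge0// [X in L * X]distrC.
    by apply: fL; apply/andP; split => //; exact: le_trans ss sz.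
  rewrite -(subrK (f y) (f s)) -addrA (le_trans (ler_normD _ _))//.
  have -> : (K + L) * (s' - s) = (K + L) * (y - s) + (K + L) * (s' - y) by ring.
  apply: lerD; [apply: le_trans (KL s y sy).1|apply: le_trans (KL y s' ys').2].
    by rewrite -[y - s]ger0_norm ?subr_ge0// [X in K * X]distrC fK// ?xs ?sy ?xy ?lexx.
  by rewrite -[s' - y]ger0_norm ?subr_ge0// [X in L * X]distrC fL// ?ys' ?sz ?yz ?lexx.
have [e e0 [K fK]] := loc t tab; exists e => // x y ax xy yb xt yt; exists `|K| => // s s'.
have near_t u : x <= u <= y -> a <= u <= b /\ `|u - t| < e.
  move=> /andP[xu uy]; rewrite (le_trans ax xu) (le_trans uy yb); split => //.
  by move: xt yt xu uy; rewrite !ltr_norml => /andP[? ?] /andP[? ?] ? ?; apply/andP; split; lra.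
move=> /near_t[sab st] /near_t[sab' st']; apply: (le_trans (fK _ _ sab sab' st st')).
by rewrite ler_wpM2r// ler_norm.
Qed.

End LocalLipschitz.

(** * Curves that are Lipschitz off the wells and their energy *)

Section WithinInterval.
Context {R : realType}.

(** An epsilon-delta form of continuity on [a, b] in which the ends need no
separate treatment. *)
Lemma within_itvP (T : topologicalType) (g : R -> T) (a b : R) :
  {within `[a, b], continuous g} <->
  (forall t, a <= t <= b -> forall A : set T, nbhs (g t) A ->
     exists2 d, 0 < d & forall s, a <= s <= b -> `|s - t| < d -> A (g s)).
Proof.
split=> [cg t tab A gA|H].
  have tA : `[a, b] t by rewrite /= in_itv.
  have := cg t A gA; rewrite /nbhs/= -(nbhs_subspace_in tA).
  move=> /nbhs_ballP[d /= d0 dA]; exists d => // s sab st.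
  by apply: dA; rewrite ?/ball/= ?in_itv//= distrC.
have key (t : R) (A : set T) : nbhs (g t) A -> (nbhs_subspace (t : subspace `[a, b])) (g @^-1` A).
  move=> gA; have [tA|tA] := pselect (`[a, b] t); last first.
    by rewrite -(nbhs_subspace_out tA) => s ->; exact: nbhs_singleton gA.
  rewrite -(nbhs_subspace_in tA).
  rewrite /= in_itv/= in tA; have [d d0 dA] := H t tA A gA.
  apply/nbhs_ballP; exists d => // s; rewrite /ball/= => st.
  by rewrite in_itv/= => sab; apply: dA => //; rewrite distrC.
by move=> t A gA; exact: key gA.
Qed.

Lemma within_itv_interior (T : topologicalType) (g : R -> T) (a b t : R) :
  {within `[a, b], continuous g} -> a < t < b -> {for t, continuous g}.
Proof.
move=> /within_itvP cg /andP[at_ tb] A gA.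
have tab : a <= t <= b by rewrite !ltW.
have [d d0 dA] := cg t tab A gA.
have : \forall s \near t, A (g s).
  near=> s; apply: dA.
    by apply/andP; split; apply: ltW; near: s; [exact: lt_nbhsr|exact: lt_nbhsl].
  rewrite distrC; near: s; exact: nbhsx_ballx.
by [].
Unshelve. all: by end_near. Qed.

Lemma continuous_clamp (T : topologicalType) (g : R -> T) (a b : R) : a <= b ->
  {within `[a, b], continuous g} -> continuous (g \o clampi a b).
Proof.
move=> ab /within_itvP cg t A gA.
have [d d0 dA] := cg _ (clampi_itv t ab) A gA.
apply/nbhs_ballP; exists d => // s; rewrite /ball/= distrC => st.
by apply: dA; [exact: clampi_itv|exact: le_lt_trans (clampi_lip _ _ ab) st].
Qed.

Lemma cvg_harmonic_dnbhs : (fun n : nat => n.+1%:R^-1 : R) @ \oo --> (0 : R)^'.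
Proof.
move=> A [e /= e0 eA].
have : \forall n \near \oo, `|n.+1%:R^-1 : R| < e.
  have := @cvg_harmonic R; move=> /cvgrPdist_lt/(_ e e0).
  by apply: filterS => n; rewrite sub0r normrN.
apply: filterS => n ne; apply: eA => /=; first by rewrite sub0r normrN.
by rewrite invr_eq0.
Qed.

End WithinInterval.

Section Speed.
Context {R : realType} {N : nat}.
Variable W : 'rV[R]_N -> R.
Hypothesis Wcont : continuous W.
Implicit Types (g : R -> 'rV[R]_N) (a b t : R).
Notation mu := (@lebesgue_measure R).

(** The regularity required by [LipZ], on any interval and with the bound stated
only near times off the wells. *)
Definition Zlip a b g := {within `[a, b], continuous g} /\
  forall t, a <= t <= b -> W (g t) != 0 -> exists2 e, 0 < e & exists K, forall s s',
    a <= s <= b -> a <= s' <= b -> W (g s) != 0 -> W (g s') != 0 ->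
    `|s - t| < e -> `|s' - t| < e -> enorm (g s - g s') <= K * `|s - s'|.

Lemma LipZP p q g : LipZ W p q g <-> [/\ Zlip 0 1 g, g 0 = p & g 1 = q].
Proof.
have E s : (`[0, 1] `\` zero_times W g) s <-> 0 <= s <= 1 /\ W (g s) != 0.
  split=> [[/=]|[s01 Ws]].
    rewrite in_itv/= => s01 ns; split => //; apply/negP => /eqP Ws; apply: ns.
    by split; rewrite ?in_itv.
  by split => /=; rewrite ?in_itv// => -[_ /eqP]; apply/negP.
split=> [[cg lg g0 g1]|[[cg lg] g0 g1]]; split => //.
  split => // t t01 Wt; have [e e0 [K eK]] := lg t ((E t).2 (conj t01 Wt)).
  exists e => //; exists K => s s' s01 s01' Ws Ws'.
  by apply: eK; apply/E.
move=> t /E[t01 Wt]; have [e e0 [K eK]] := lg t t01 Wt.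
exists e => //; exists K => s s' /E[s01 Ws] /E[s01' Ws'].
exact: eK.
Qed.

Lemma Zlip_sub a b c d g : Zlip a b g -> a <= c -> d <= b -> Zlip c d g.
Proof.
move=> [cg lg] ac db.
have sub s : c <= s <= d -> a <= s <= b.
  by move=> /andP[cs sd]; rewrite (le_trans ac cs) (le_trans sd db).
split.
  apply/within_itvP => t /sub tab A gA; move/within_itvP : cg => cg.
  have [e e0 eA] := cg t tab A gA; exists e => // s /sub sab; exact: eA.
move=> t /sub tab Wt; have [e e0 [K eK]] := lg t tab Wt.
by exists e => //; exists K => s s' /sub sab /sub sab'; exact: eK.
Qed.

Lemma Zlip_local a b g t : Zlip a b g -> a < t < b -> W (g t) != 0 ->
  exists2 r, 0 < r & [/\ a < t - r, t + r < b &
    exists2 K, 0 <= K & forall s s', t - r <= s <= t + r -> t - r <= s' <= t + r ->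
      enorm (g s - g s') <= K * `|s - s'|].
Proof.
move=> [cg lg] /andP[at_ tb] Wt.
have tab : a <= t <= b by rewrite !ltW.
have [e e0 [K eK]] := lg t tab Wt.
have cW : {within `[a, b], continuous (W \o g)}.
  apply/within_itvP => s sab A nA; move/within_itvP : cg => cg.
  exact: (cg s sab _ (Wcont nA)).
have nW : nbhs ((W \o g) t) [set x : R | x != 0].
  by apply: (open_nbhs_nbhs _); split => //; exact: open_neq.
have [d d0 dW] := (within_itvP _ _ _).1 cW t tab _ nW.
pose r := Num.min (Num.min (e / 2) (d / 2)) (Num.min ((t - a) / 2) ((b - t) / 2)).
have r0 : 0 < r by rewrite !lt_min !divr_gt0// subr_gt0.
have re : r <= e / 2 by rewrite !ge_min lexx.
have rd : r <= d / 2 by rewrite !ge_min lexx orbT.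
have ra : r <= (t - a) / 2 by rewrite !ge_min lexx !orbT.
have rb : r <= (b - t) / 2 by rewrite !ge_min lexx !orbT.
exists r => //; split; [lra|lra|].
exists `|K| => // s s' h h'.
have [h1 h2] : a <= s <= b /\ a <= s' <= b by split; lra.
have inr u x : t - r <= u <= t + r -> r <= x / 2 -> 0 < x -> `|u - t| < x.
  by move=> *; rewrite ltr_norml; apply/andP; split; lra.
rewrite (le_trans (eK s s' h1 h2 _ _ _ _)) ?ler_wpM2r ?ler_norm//; by
  [apply: dW => //; exact: inr|exact: inr].
Qed.

(** Around each time off the wells there is an interval with rational ends on
which the curve is Lipschitz; these intervals are countably many, so the
exceptional null sets add up to a null set. *)
Lemma Zlip_ae_derivable a b g : Zlip a b g ->
  {ae mu, forall t, a < t < b -> W (g t) != 0 -> derivable g t 1}.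
Proof.
move=> Zg.
have H : {ae mu, forall t, forall n, forall q : rat * rat, unpickle n = Some q ->
    ratr q.1 < t < ratr q.2 ->
    (exists2 K, 0 <= K & forall s s', ratr q.1 <= s <= ratr q.2 ->
       ratr q.1 <= s' <= ratr q.2 -> enorm (g s - g s') <= K * `|s - s'|) ->
    derivable g t 1}.
  apply: ae_foralln => n; case: (unpickle n) => [q|]; last by apply: aeW.
  have [q12|q12] := ltP (ratr q.1 : R) (ratr q.2); last first.
    by apply: aeW => t _ [<-] /andP[h1 h2]; move: (lt_trans h1 h2); rewrite ltNge q12.
  have [[K K0 qK]|nK] := pselect (exists2 K, 0 <= K & forall s s', ratr q.1 <= s <= ratr q.2 ->
       ratr q.1 <= s' <= ratr q.2 -> enorm (g s - g s') <= K * `|s - s'|); last first.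
    by apply: aeW => t _ [<-].
  have [G [_ _ _]] := lipschitz_curve_density q12 K0 qK.
  by apply: aeS => t gt _ [<-] /gt[].
apply: aeS H => t H tab Wt.
have [r r0 [ar rb [K K0 rK]]] := Zlip_local Zg tab Wt.
have tr1 : t - r < t by rewrite ltrBlDr ltrDl.
have tr2 : t < t + r by rewrite ltrDl.
have [q1] := rat_in_itvoo tr1; rewrite in_itv/= => /andP[h1 h2].
have [q2] := rat_in_itvoo tr2; rewrite in_itv/= => /andP[h3 h4].
apply: (H (pickle (q1, q2)) (q1, q2)); rewrite ?pickleK//= ?h2//.
exists K => // s s' /andP[s1 s2] /andP[s3 s4]; apply: rK.
  by rewrite (le_trans (ltW h1) s1) (le_trans s2 (ltW h4)).
by rewrite (le_trans (ltW h1) s3) (le_trans s4 (ltW h4)).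
Qed.

Lemma F_ge0 p : 0 <= F W p. Proof. exact: sqrtr_ge0. Qed.

Lemma F_continuous : continuous (F W).
Proof. by move=> p; apply: continuous_comp; [exact: Wcont|exact: sqrt_continuous]. Qed.

Lemma F_eq0 p : W p = 0 -> F W p = 0.
Proof. by rewrite /F => ->; rewrite sqrtr0. Qed.

Lemma measurable_coord g i : continuous g -> measurable_fun setT (fun t => g t 0 i).
Proof.
move=> cg; apply: continuous_measurable_fun => t.
by apply: (@cvg_coord _ _ _ _ _ g (g t) i); exact: cg.
Qed.

(** The upper limit of difference quotients along [1 / n] is a measurable
substitute for the derivative. *)
Lemma Zlip_speed a b g : a < b -> Zlip a b g ->
  exists w : R -> R, [/\ measurable_fun setT w, forall t, 0 <= w t &
    {ae mu, forall t, a < t < b -> F W (g t) * enorm (derive1 g t) = w t}].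
Proof.
move=> ab Zg; have [cg _] := Zg.
pose g1 := g \o clampi a b.
have cg1 : continuous g1 by apply: continuous_clamp => //; exact: ltW.
pose q (n : nat) (i : 'I_N) t := (n.+1%:R^-1 : R)^-1 * (g1 (n.+1%:R^-1 + t) 0 i - g1 t 0 i).
pose v i t := fine (limn_esup (fun n => (q n i t)%:E)).
have mq n i : measurable_fun setT (q n i).
  apply: measurable_funM => //; apply: measurable_funB; last exact: measurable_coord.
  apply: (@measurable_coord (fun t => g1 (n.+1%:R^-1 + t))) => t.
  apply: (@continuous_comp _ _ _ (fun t => n.+1%:R^-1 + t) g1); last exact: cg1.
  by apply: continuousD; [exact: cst_continuous|exact: cvg_id].
have mv i : measurable_fun setT (v i).
  apply: (@measurableT_comp _ _ _ _ _ _ (@fine R)) => //.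
  by apply: measurable_fun_limn_esup => n; apply/measurable_EFinP; exact: mq.
exists (fun t => F W (g1 t) * enorm (\row_i v i t)); split.
- apply: measurable_funM.
    have cF : continuous (F W \o g1).
      by move=> t; apply: continuous_comp; [exact: cg1|exact: F_continuous].
    exact: continuous_measurable_fun.
  apply: measurable_coord_enorm => i.
  by rewrite (_ : (fun t => _) = v i); [exact: mv|apply/funext => t; rewrite mxE].
- by move=> t; rewrite mulr_ge0 ?F_ge0 ?enorm_ge0.
apply: aeS (Zlip_ae_derivable Zg) => t dg tab; have /andP[at_ tb] := tab.
have g1t : g1 t = g t by rewrite /g1/= clampi_id// !ltW.
rewrite g1t; have [Wt|Wt] := eqVneq (W (g t)) 0; first by rewrite F_eq0// !mul0r.
congr (_ * enorm _); apply/rowP => i; rewrite mxE.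
have {}dg := dg tab Wt.
have gg1 : \forall s \near t, g1 s = g s.
  near=> s; rewrite /g1/= clampi_id//; apply/andP; split; apply: ltW; near: s.
    exact: lt_nbhsr.
  exact: lt_nbhsl.
have [dg1 g1E] := derivable_near gg1 dg.
rewrite -g1E; have [di <-] := derivable_coord i dg1.
have /derive1_cvg dc := di.
set l := derive1 _ _ in dc *.
have qc : q n i t @[n --> \oo] --> l.
  exact: (cvg_comp _ _ (@cvg_harmonic_dnbhs R) dc).
have qcE : (q n i t)%:E @[n --> \oo] --> l%:E by apply/cvg_EFin => //; exact: nearW.
by rewrite /v (cvg_limn_einf_sup qcE).2.
Unshelve. all: by end_near. Qed.

Definition energy_on g a b : \bar R :=
  (\int[mu]_(t in `[a, b]) (F W (g t) * enorm (derive1 g t))%:E)%E.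

Lemma energyE g : energy W g = energy_on g 0 1.
Proof. by []. Qed.

Lemma energy_onE g a b (w : R -> R) : (forall t, 0 <= w t) ->
  {ae mu, forall t, a < t < b -> F W (g t) * enorm (derive1 g t) = w t} ->
  energy_on g a b = (\int[mu]_(t in `[a, b]) (w t)%:E)%E.
Proof.
move=> w0 wE; apply: ae_eq_integral_ge0 => //.
- by move=> t _; rewrite lee_fin mulr_ge0 ?F_ge0 ?enorm_ge0.
- by move=> t _; rewrite lee_fin.
apply: aeS3 wE (ae_neq a) (ae_neq b) => t wt ta tb; rewrite /= in_itv/= => /andP[h1 h2].
by rewrite wt// !lt_neqAle eq_sym ta tb h1 h2.
Qed.

Lemma energy_on_ge0 g a b : (0 <= energy_on g a b)%E.
Proof. by apply: integral_ge0 => t _; rewrite lee_fin mulr_ge0 ?F_ge0 ?enorm_ge0. Qed.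

Lemma energy_on_xx g a : energy_on g a a = 0%E.
Proof. by rewrite /energy_on set_itv1 integral_set1. Qed.

Lemma energy_on_split g a b c : a <= b -> b <= c -> Zlip a c g ->
  energy_on g a c = (energy_on g a b + energy_on g b c)%E.
Proof.
move=> ab bc Zg.
have [<-|anb] := eqVneq a b; first by rewrite energy_on_xx add0e.
have [<-|bnc] := eqVneq b c; first by rewrite energy_on_xx adde0.
have {}ab : a < b by rewrite lt_neqAle anb.
have {}bc : b < c by rewrite lt_neqAle bnc.
have [w [mw w0 wE]] := Zlip_speed (lt_trans ab bc) Zg.
rewrite (energy_onE w0 wE) (@energy_onE g a b w)//; last first.
  by apply: aeS wE => t wt /andP[h1 h2]; apply: wt; rewrite h1 (lt_trans h2 bc).
rewrite (@energy_onE g b c w)//; last first.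
  by apply: aeS wE => t wt /andP[h1 h2]; apply: wt; rewrite h2 (lt_trans ab h1).
have mwE D : measurable D -> measurable_fun D (EFin \o w).
  by move=> mD; apply/measurable_EFinP; exact: measurable_funTS.
rewrite (@itv_bndbnd_setU _ _ (BLeft a) (BRight b) (BRight c)) ?bnd_simp ?ltW//.
rewrite ge0_integral_setU//=.
- congr (_ + _)%E.
  by rewrite integral_itv_obnd_cbnd//; exact: mwE.
- by apply: mwE; exact: measurableU.
- by move=> x _; rewrite lee_fin.
- apply/disj_setPS => x [/=]; rewrite !in_itv/= => /andP[_ xb] /andP[bx _].
  by move: (lt_le_trans bx xb); rewrite ltxx.
Qed.

End Speed.

(** * The degenerate metric *)

Local Opaque F enorm derive1 energy_on.

Section Metric.
Context {R : realType} {N : nat}.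
Variable W : 'rV[R]_N -> R.
Hypothesis Wcont : continuous W.
Implicit Types (g : R -> 'rV[R]_N) (a b t : R) (p q r x y z : 'rV[R]_N).
Notation mu := (@lebesgue_measure R).

Lemma derive1_comp_vec g (f : R -> R) t : derivable f t 1 -> derivable g (f t) 1 ->
  derivable (g \o f) t 1 /\ derive1 (g \o f) t = derive1 f t *: derive1 g (f t).
Proof.
move=> df dg; apply: derive1_coords => i.
have [dgi giE] := derivable_coord i dg.
have E : (fun x : R => (g \o f) x 0 i) = (fun y : R => g y 0 i) \o f by [].
have dE := derive1_comp df dgi.
rewrite E dE giE mxE mulrC; split; last by reflexivity.
apply/derivable1_diffP; apply: differentiable_comp.
  by move/derivable1_diffP : df.
by move/derivable1_diffP : dgi.
Qed.

Lemma derive_affine (u c x : R) :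
  derivable (fun y : R => u + c * y) x 1 /\ derive1 (fun y : R => u + c * y) x = c.
Proof.
have d1 : derivable (cst u : R -> R) x 1 by exact: derivable_cst.
have d2 : derivable (cst c : R -> R) x 1 by exact: derivable_cst.
have d3 : derivable (id : R -> R) x 1 by exact: derivable_id.
have d4 : derivable (cst c * id : R -> R) x 1 := derivableM d2 d3.
split; first exact: (derivableD d1 d4).
rewrite derive1E; have -> := deriveD d1 d4; have -> := deriveM d2 d3.
by rewrite !derive_cst derive_id scaler0 addr0 add0r /GRing.scale/= mulr1.
Qed.

Lemma bounded_integrable (a b : R) (h : R -> R) K : measurable_fun setT h ->
  (forall t, `|h t| <= K) -> mu.-integrable `[a, b] (EFin \o h).
Proof.
move=> mh hK; have iK : mu.-integrable `[a, b] (EFin \o cst K).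
  apply: continuous_compact_integrable; first exact: segment_compact.
  by apply: continuous_subspaceT; exact: cst_continuous.
apply: le_integrable iK => //; first by apply/measurable_EFinP; exact: measurable_funTS.
by move=> t _; rewrite /= lee_fin (le_trans (hK t))// ler_norm.
Qed.

Lemma Zlip_eq a b g g' : (forall t, a <= t <= b -> g t = g' t) -> Zlip W a b g -> Zlip W a b g'.
Proof.
move=> gg' [/within_itvP cg lg]; split.
  apply/within_itvP => t tab A; rewrite -gg'// => gA.
  have [d d0 dA] := cg t tab A gA; exists d => // s sab st.
  by rewrite -gg'//; exact: dA.
move=> t tab; rewrite -gg'// => Wt; have [e e0 [K eK]] := lg t tab Wt.
exists e => //; exists K => s s' sab sab'; rewrite -!gg'//; exact: eK.
Qed.

Lemma energy_on_eq a b g g' : (forall t, a < t < b -> g t = g' t) ->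
  energy_on W g a b = energy_on W g' a b.
Proof.
move=> gg'; apply: ae_eq_integral_ge0 => //.
- by move=> t _; rewrite lee_fin mulr_ge0 ?F_ge0 ?enorm_ge0.
- by move=> t _; rewrite lee_fin mulr_ge0 ?F_ge0 ?enorm_ge0.
apply: aeS2 (ae_neq a) (ae_neq b) => t ta tb; rewrite /= in_itv/= => /andP[h1 h2].
have at_ : a < t by rewrite lt_neqAle eq_sym ta.
have tb' : t < b by rewrite lt_neqAle tb.
have gt : g t = g' t by apply: gg'; rewrite at_ tb'.
have nE : \forall s \near t, g s = g' s.
  near=> s; apply: gg'; apply/andP; split; near: s; [exact: lt_nbhsr|exact: lt_nbhsl].
have dE : derive1 g t = derive1 g' t.
  by rewrite (derive1E g) (derive1E g'); exact: near_eq_derive nE.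
by rewrite gt dE.
Unshelve. all: by end_near. Qed.

Lemma Zlip_paste a b c g : a <= b -> b <= c -> Zlip W a b g -> Zlip W b c g -> Zlip W a c g.
Proof.
move=> ab bc [/within_itvP c1 l1] [/within_itvP c2 l2].
have itv1 s : a <= s <= c -> s <= b -> a <= s <= b by move=> /andP[-> _] ->.
have itv2 s : a <= s <= c -> b <= s -> b <= s <= c by move=> /andP[_ ->] ->.
have bb1 : a <= b <= b by rewrite ab lexx.
have bb2 : b <= b <= c by rewrite bc lexx.
split.
  apply/within_itvP => t tac A gA.
  have [tb|bt|tb] := ltgtP t b.
  - have [d d0 dA] := c1 t (itv1 t tac (ltW tb)) A gA.
    exists (Num.min d (b - t)); first by rewrite lt_min d0 subr_gt0.
    move=> s sac; rewrite lt_min => /andP[sd sb]; apply: dA => //.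
    apply: itv1 => //; move: sb; rewrite ltr_norml; clear; lra.
  - have [d d0 dA] := c2 t (itv2 t tac (ltW bt)) A gA.
    exists (Num.min d (t - b)); first by rewrite lt_min d0 subr_gt0.
    move=> s sac; rewrite lt_min => /andP[sd sb]; apply: dA => //.
    apply: itv2 => //; move: sb; rewrite ltr_norml; clear; lra.
  - rewrite tb in gA *.
    have [d1 d10 dA1] := c1 b bb1 A gA; have [d2 d20 dA2] := c2 b bb2 A gA.
    exists (Num.min d1 d2); first by rewrite lt_min d10.
    move=> s sac; rewrite lt_min => /andP[s1 s2].
    by have [sb|bs] := leP s b; [apply: dA1 => //; exact: itv1|apply: dA2 => //; apply: itv2 => //; exact: ltW].
move=> t tac Wt.
have [tb|bt|tb] := ltgtP t b.
- have [d d0 [K dK]] := l1 t (itv1 t tac (ltW tb)) Wt.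
  exists (Num.min d (b - t)); first by rewrite lt_min d0 subr_gt0.
  exists K => s s' sac sac' Ws Ws'; rewrite !lt_min => /andP[sd sb] /andP[sd' sb'].
  apply: dK => //; apply: itv1 => //.
    by move: sb; rewrite ltr_norml; clear; lra.
  by move: sb'; rewrite ltr_norml; clear; lra.
- have [d d0 [K dK]] := l2 t (itv2 t tac (ltW bt)) Wt.
  exists (Num.min d (t - b)); first by rewrite lt_min d0 subr_gt0.
  exists K => s s' sac sac' Ws Ws'; rewrite !lt_min => /andP[sd sb] /andP[sd' sb'].
  apply: dK => //; apply: itv2 => //.
    by move: sb; rewrite ltr_norml; clear; lra.
  by move: sb'; rewrite ltr_norml; clear; lra.
- rewrite tb in Wt *.
  have [d1 d10 [K1 dK1]] := l1 b bb1 Wt; have [d2 d20 [K2 dK2]] := l2 b bb2 Wt.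
  exists (Num.min d1 d2); first by rewrite lt_min d10.
  pose K := Num.max `|K1| `|K2|.
  have KK1 : K1 <= K by rewrite le_max (ler_norm K1).
  have KK2 : K2 <= K by rewrite le_max (ler_norm K2) orbT.
  have key s s' : s <= s' -> a <= s <= c -> a <= s' <= c -> W (g s) != 0 -> W (g s') != 0 ->
      `|s - b| < Num.min d1 d2 -> `|s' - b| < Num.min d1 d2 -> enorm (g s - g s') <= K * `|s - s'|.
    move=> ss sac sac' Ws Ws'; rewrite !lt_min => /andP[s1 s2] /andP[s1' s2'].
    have [sb'|bs'] := leP s' b.
      rewrite (le_trans (dK1 _ _ _ _ _ _ _ _)) ?ler_wpM2r//; apply: itv1 => //.
      exact: le_trans sb'.
    have [sb|bs] := leP s b; last first.
      rewrite (le_trans (dK2 _ _ _ _ _ _ _ _)) ?ler_wpM2r//; apply: itv2 => //; exact: ltW.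
    apply: (le_trans (ler_enorm_trans (g b) _ _)).
    have h1 : enorm (g s - g b) <= K * `|s - b|.
      rewrite (le_trans (dK1 _ _ _ _ _ _ _ _)) ?ler_wpM2r//; first exact: itv1.
      by rewrite subrr normr0.
    have h2 : enorm (g b - g s') <= K * `|b - s'|.
      rewrite (le_trans (dK2 _ _ _ _ _ _ _ _)) ?ler_wpM2r//; last by rewrite subrr normr0.
      by apply: itv2 => //; exact: ltW.
    apply: (le_trans (lerD h1 h2)); rewrite -mulrDr ler_wpM2l ?le_max ?normr_ge0//.
    by rewrite !ler0_norm ?subr_le0 ?(ltW bs')//; clear; lra.
  exists K => s s' sac sac' Ws Ws' sd sd'.
  have [ss|/ltW ss] := leP s s'; first exact: key.
  by rewrite enormB distrC; exact: key.
Qed.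

Lemma affine_curve (al c : R) a b g : 0 < c -> a <= b ->
  Zlip W (al + c * a) (al + c * b) g ->
  Zlip W a b (g \o (fun s => al + c * s)) /\
  energy_on W (g \o (fun s => al + c * s)) a b = energy_on W g (al + c * a) (al + c * b).
Proof.
move=> c0 ab Zg; set phi := fun s => al + c * s.
have cn : c != 0 by rewrite gt_eqF.
have phile s t : (phi s <= phi t) = (s <= t) by rewrite lerD2l ler_pM2l.
have phid s t : `|phi s - phi t| = c * `|s - t|.
  by rewrite /phi opprD addrACA subrr add0r -mulrBr normrM gtr0_norm.
have phiab s : a <= s <= b -> phi a <= phi s <= phi b by rewrite !phile.
have phid' s t e : (`|s - t| < e / c) = (`|phi s - phi t| < e).
  by rewrite phid ltr_pdivlMr// mulrC.
split.
  have [/within_itvP cg lg] := Zg; split.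
    apply/within_itvP => t tab A gA; have [d d0 dA] := cg _ (phiab t tab) A gA.
    exists (d / c); first by rewrite divr_gt0.
    by move=> s sab; rewrite phid' => st; apply: dA => //; exact: phiab.
  move=> t tab Wt; have [d d0 [K dK]] := lg _ (phiab t tab) Wt.
  exists (d / c); first by rewrite divr_gt0.
  exists (K * c) => s s' sab sab' Ws Ws'; rewrite !phid' => sd sd'.
  by rewrite -mulrA -phid; apply: dK => //; exact: phiab.
have [->|anb] := eqVneq a b; first by rewrite !energy_on_xx.
have {}ab : a < b by rewrite lt_neqAle anb.
have pab : phi a < phi b by rewrite ltrD2l ltr_pM2l.
have [w [mw w0 wE]] := Zlip_speed Wcont pab Zg.
rewrite -/(phi a) -/(phi b) (energy_onE w0 wE) (affine_integral al c0)//.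
apply: energy_onE; first by move=> s; rewrite mulr_ge0// ltW.
have dg := affine_ae al c0 (Zlip_ae_derivable Wcont Zg).
apply: aeS2 dg (affine_ae al c0 wE) => s dg' wE' /andP[as_ sb].
have psab : phi a < phi s < phi b by rewrite !ltrD2l !ltr_pM2l// as_.
rewrite -wE'//=; have [Ws|Ws] := eqVneq (W (g (phi s))) 0.
  have F0 : F W (g (phi s)) = 0 by exact: F_eq0.
  have F1 : F W (g (al + c * s)) = 0 by exact: F0.
  by rewrite F0; move: (enorm _) (enorm _) => X Y; rewrite !mul0r mulr0.
have [dphi phiE] := derive_affine al c s.
have [_ ->] := derive1_comp_vec dphi (dg' psab Ws).
rewrite phiE enormZ (gtr0_norm c0) mulrCA; reflexivity.
Qed.

Lemma LipZ_concat p q r g1 g2 : LipZ W p q g1 -> LipZ W q r g2 ->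
  exists2 g, LipZ W p r g & energy W g = (energy W g1 + energy W g2)%E.
Proof.
move=> /LipZP[Z1 g10 g11] /LipZP[Z2 g20 g21].
pose h t := if t <= 1 then g1 t else g2 (t - 1).
have Zh1 : Zlip W 0 1 h by apply: Zlip_eq Z1 => t /andP[_ t1]; rewrite /h t1.
have Z2' : Zlip W (-1 + 1 * 1) (-1 + 1 * 2) g2.
  have -> : -1 + 1 * 1 = 0 :> R by rewrite mul1r addNr.
  have -> : -1 + 1 * 2 = 1 :> R by rewrite mul1r; lra.
  exact: Z2.
have h12 : 1 <= 2 :> R by rewrite ler1n.
have h02 : 0 < 2 :> R by exact: ltr0Sn.
have [Z2s E2s] := affine_curve ltr01 h12 Z2'.
have hE t : 1 <= t <= 2 -> (g2 \o (fun s => -1 + 1 * s)) t = h t.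
  move=> /andP[t1 _]; have e : -1 + 1 * t = t - 1 by rewrite mul1r addrC.
  rewrite /h [LHS]/= e; case: (leP t 1) => t1'; last by [].
  have t1E : t = 1 by apply/le_anti; rewrite t1 t1'.
  by rewrite t1E subrr g20 g11.
have Zh2 : Zlip W 1 2 h by apply: Zlip_eq hE Z2s.
have Zh : Zlip W 0 2 h by exact: (Zlip_paste ler01 h12 Zh1 Zh2).
have e0 : 0 + 2 * 0 = 0 :> R by rewrite mulr0 addr0.
have e1 : 0 + 2 * 1 = 2 :> R by rewrite add0r mulr1.
have e2 : 2 - 1 = 1 :> R by lra.
have e3 : (2 <= 1 :> R) = false by apply/negbTE; rewrite -ltNge; lra.
have Zh' : Zlip W (0 + 2 * 0) (0 + 2 * 1) h by rewrite e0 e1.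
have [Zg Eg] := affine_curve h02 ler01 Zh'.
exists (h \o (fun s => 0 + 2 * s)).
  apply/LipZP; split; [exact: Zg| |]; rewrite /comp ?e0 ?e1 /h.
    by rewrite ler01.
  by rewrite e3 e2.
have E1 : energy_on W h 0 1 = energy W g1.
  by rewrite energyE; apply: energy_on_eq => t /andP[_ /ltW t1]; rewrite /h t1.
have E2 : energy_on W h 1 2 = energy W g2.
  have m1 : -1 + 1 * 1 = 0 :> R by rewrite mul1r addNr.
  have m2 : -1 + 1 * 2 = 1 :> R by rewrite mul1r; lra.
  have EA : energy_on W h 1 2 = energy_on W (g2 \o (fun s => -1 + 1 * s)) 1 2.
    apply: energy_on_eq => t /andP[t1 t2]; apply: esym; apply: hE.
    by rewrite (ltW t1) (ltW t2).
  have EB := f_equal2 (energy_on W g2) m1 m2.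
  exact: (etrans EA (etrans E2s (etrans EB (esym (energyE W g2))))).
rewrite energyE Eg e0 e1 (energy_on_split Wcont ler01 h12 Zh) E1 E2; reflexivity.
Qed.

Lemma segment_LipZ p q (M : R) :
  (forall s, 0 <= s <= 1 -> F W (p + s *: (q - p)) <= M) ->
  exists2 g, LipZ W p q g & (energy W g <= (M * enorm (q - p))%:E)%E.
Proof.
move=> FM; pose g s := p + s *: (q - p).
have gB s s' : g s - g s' = (s - s') *: (q - p).
  by rewrite /g opprD addrACA subrr add0r scalerBl.
have glip s s' : enorm (g s - g s') = `|s - s'| * enorm (q - p) by rewrite gB enormZ.
exists g.
  apply/LipZP; split.
  - split.
      apply/within_itvP => t _ A /nbhs_enormP[e e0 eA].
      exists (e / (enorm (q - p) + 1)); first by rewrite divr_gt0// ltr_wpDl// enorm_ge0.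
      move=> s _; rewrite ltr_pdivlMr; last by rewrite ltr_wpDl// enorm_ge0.
      move=> st; apply: eA; rewrite glip (le_lt_trans _ st)// ler_wpM2l// lerDl.
      exact: ler01.
    by move=> t _ _; exists 1 => //; exists (enorm (q - p)) => s s' *; rewrite glip mulrC.
  - by rewrite /g scale0r addr0.
  - by rewrite /g scale1r addrC subrK.
have dg t : derivable g t 1 /\ derive1 g t = q - p.
  apply: derive1_coords => i.
  have E : (fun x : R => g x 0 i) = (fun x : R => p 0 i + x * (q - p) 0 i).
    by apply/funext => x; rewrite /g mxE [X in _ + X]mxE.
  have E' : (fun x : R => p 0 i + x * (q - p) 0 i) = (fun x : R => p 0 i + (q - p) 0 i * x).
    by apply/funext => x; rewrite mulrC.
  by rewrite E E'; exact: derive_affine.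
have -> : ((M * enorm (q - p))%:E = \int[mu]_(t in `[0%R : R, 1%R]) (M * enorm (q - p))%:E)%E.
  by rewrite integral_cst//= lebesgue_measure_itv/= lte01 oppr0 adde0 mule1.
apply: le_integral_ge0 => t /=; rewrite in_itv/= => t01.
  by rewrite lee_fin mulr_ge0 ?F_ge0 ?enorm_ge0.
by rewrite lee_fin (dg t).2 ler_wpM2r ?enorm_ge0// FM.
Qed.

Lemma segment_F_bound p q : exists2 M, 0 <= M & forall s, 0 <= s <= 1 -> F W (p + s *: (q - p)) <= M.
Proof.
have cF : {within `[0 : R, 1], continuous (fun s : R => F W (p + s *: (q - p)))}.
  apply: continuous_subspaceT => s; apply: (@continuous_comp _ _ _ (fun s : R => p + s *: (q - p)) (F W)).
    by apply: continuousD; [exact: cst_continuous|apply: scalel_continuous].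
  exact: F_continuous.
have [c _ cM] := EVT_max ler01 cF.
by exists (F W (p + c *: (q - p))); [exact: F_ge0|move=> s s01; apply: cM; rewrite in_itv].
Qed.

Lemma dist_ge0 p q : (0 <= dist W p q)%E.
Proof. by apply: le_ereal_inf_tmp => _ [g _ <-]; exact: energy_on_ge0. Qed.

Lemma dist_fin p q : dist W p q \is a fin_num.
Proof.
rewrite ge0_fin_numE ?dist_ge0//.
have [M M0 FM] := segment_F_bound p q; have [g Zg gM] := segment_LipZ FM.
by apply: le_lt_trans (ltry (M * enorm (q - p))); apply: le_trans gM; apply: ereal_inf_lbound; exists g.
Qed.

Definition dr p q : R := fine (dist W p q).

Lemma distE p q : dist W p q = (dr p q)%:E.
Proof. by rewrite /dr fineK// dist_fin. Qed.

Lemma dr_ge0 p q : 0 <= dr p q.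
Proof. by rewrite -lee_fin -distE dist_ge0. Qed.

Lemma dr_le_energy p q g : LipZ W p q g -> ((dr p q)%:E <= energy W g)%E.
Proof. by move=> Zg; rewrite -distE; apply: ereal_inf_lbound; exists g. Qed.

Lemma dr_adherent p q (e : R) : 0 < e -> exists2 g, LipZ W p q g & (energy W g < (dr p q + e)%:E)%E.
Proof.
move=> e0; have [_ [g Zg <-] ge] := lb_ereal_inf_adherent e0 (dist_fin p q).
by exists g => //; rewrite EFinD -distE.
Qed.

Lemma dr_triangle q p r : dr p r <= dr p q + dr q r.
Proof.
apply/ler_addgt0Pr => e e0.
have e2 : 0 < e / 2 by rewrite divr_gt0.
have [g1 Z1 E1] := dr_adherent p q e2; have [g2 Z2 E2] := dr_adherent q r e2.
have [g Zg Eg] := LipZ_concat Z1 Z2.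
rewrite -lee_fin (le_trans (dr_le_energy Zg))// Eg.
apply: (le_trans (leeD (ltW E1) (ltW E2))).
by rewrite -EFinD lee_fin; move: (dr p q) (dr q r) => u v; clear; lra.
Qed.

Lemma dr_segment p q (M : R) : (forall s, 0 <= s <= 1 -> F W (p + s *: (q - p)) <= M) ->
  dr p q <= M * enorm (q - p).
Proof.
move=> FM; have [g Zg gM] := segment_LipZ FM.
by rewrite -lee_fin (le_trans (dr_le_energy Zg)).
Qed.

Lemma dr_xx p : dr p p = 0.
Proof.
apply/le_anti; rewrite dr_ge0 andbT.
have [M _ FM] := segment_F_bound p p.
by have := dr_segment FM; rewrite subrr enorm0 mulr0.
Qed.

(** A curve on [a, b] is moved to [0, 1] by an affine change of time, which
preserves energy. *)
Lemma dr_le_energy_on a b g : a <= b -> Zlip W a b g ->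
  ((dr (g a) (g b))%:E <= energy_on W g a b)%E.
Proof.
move=> ab Zg; have [<-|anb] := eqVneq a b; first by rewrite dr_xx energy_on_xx.
have ba : 0 < b - a by rewrite subr_gt0 lt_neqAle anb.
have Zg' : Zlip W (a + (b - a) * 0) (a + (b - a) * 1) g.
  by rewrite mulr0 addr0 mulr1 addrC subrK.
have [Z E] := affine_curve ba ler01 Zg'.
have := E; rewrite mulr0 addr0 mulr1 [a + _]addrC subrK => <-.
apply: dr_le_energy; apply/LipZP; split; [exact: Z| |].
  by rewrite /comp mulr0 addr0.
by rewrite /comp mulr1 addrC subrK.
Qed.

(** Almost everywhere the derivative of [u (g t)] is at most [m * enorm (g' t)]
if [F W (g t) >= m], and zero otherwise; in both cases it is at most the energy
density. Such functions [u] are what bounds distances from below. *)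
Lemma calibration (u : 'rV[R]_N -> R) m p q g : 0 < m ->
  (forall x y, `|u x - u y| <= m * enorm (x - y)) ->
  (forall x, F W x < m -> \forall y \near x, u y = u x) ->
  LipZ W p q g -> (`|u p - u q|%:E <= energy W g)%E.
Proof.
move=> m0 um uc /LipZP[Zg g0 g1]; have [/within_itvP cg lg] := Zg.
pose f t := u (g t).
have WF x : ~~ (F W x < m) -> W x != 0.
  by apply: contra => /eqP Wx; rewrite F_eq0.
have loc t : 0 <= t <= 1 -> exists2 e, 0 < e & exists K, forall s s',
     0 <= s <= 1 -> 0 <= s' <= 1 -> `|s - t| < e -> `|s' - t| < e ->
     `|f s - f s'| <= K * `|s - s'|.
  move=> t01; have [Ft|Ft] := boolP (F W (g t) < m).
    have [d d0 dA] := cg t t01 _ (uc _ Ft); exists d => //; exists 0 => s s' s01 s01' st st'.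
    by rewrite /f !dA// subrr normr0 mul0r.
  have Wt := WF _ Ft.
  have nW0 : nbhs (W (g t)) [set x : R | x != 0].
    by apply: open_nbhs_nbhs; split => //; exact: open_neq.
  have nW : nbhs (g t) [set x | W x != 0] by exact: (Wcont nW0).
  have [d d0 dA] := cg t t01 _ nW; have [e e0 [K eK]] := lg t t01 Wt.
  exists (Num.min d e); first by rewrite lt_min d0.
  exists (m * K) => s s' s01 s01'; rewrite !lt_min => /andP[sd se] /andP[sd' se'].
  rewrite (le_trans (um _ _))// -mulrA ler_wpM2l ?(ltW m0)//.
  by apply: eK => //; exact: dA.
have [K K0 fK] := locally_lipschitz_itv ler01 loc.
have [h [mh hK fE fd]] := lipschitz_density ltr01 K0 fK.
have [w [mw w0 wE]] := Zlip_speed Wcont ltr01 Zg.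
rewrite energyE (energy_onE w0 wE).
have -> : `|u p - u q| = `|f 1 - f 0| by rewrite /f g0 g1 distrC.
rewrite (fE 0 1)//.
have ih : mu.-integrable `[0, 1] (EFin \o h) by exact: bounded_integrable hK.
apply: le_trans (_ : (\int[mu]_(t in `[0%R : R, 1%R]) `|h t|%:E <= _)%E).
  rewrite -[leRHS]fineK; last first.
    apply: integrable_fin_num => //; exact: (integrable_abse ih).
  by rewrite lee_fin; apply: le_normr_Rintegral.
apply: ae_le_integral_ge0 => //.
- by move=> t _; rewrite lee_fin w0.
apply: aeS2 (aeS2 (fun _ A B => conj A B) fd wE)
  (aeS3 (fun _ A B C => conj A (conj B C)) (Zlip_ae_derivable Wcont Zg) (ae_neq 0) (ae_neq 1)).
move=> t [fdt wt] [dgt [t0 t1]]; rewrite /= in_itv/= => /andP[t0' t1'].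
have t01 : 0 < t < 1 by rewrite !lt_neqAle eq_sym t0 t1 t0' t1'.
have t01' : 0 <= t <= 1 by rewrite t0'.
rewrite lee_fin -wt//; have [df <-] := fdt t01.
have cgt : {for t, continuous g}.
  by apply: within_itv_interior t01; have [] := Zg.
have [Ft|Ft] := boolP (F W (g t) < m).
  have fc : \forall s \near t, f s = cst (f t) s by exact: cgt (uc _ Ft).
  have [_ ->] := derivable_near fc (derivable_cst _ _ _).
  by rewrite derive1_cst normr0 mulr_ge0 ?F_ge0 ?enorm_ge0.
have dg := dgt t01 (WF _ Ft).
apply: le_trans (_ : m * enorm (derive1 g t) <= _); last first.
  by rewrite ler_wpM2r ?enorm_ge0// leNgt.
have c1 : `|e^-1 *: (f (e + t) - f t)| @[e --> 0^'] --> `|derive1 f t|.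
  exact: (cvg_norm (derive1_cvg df)).
have c2 : m * enorm (e^-1 *: (g (e + t) - g t)) @[e --> 0^'] --> m * enorm (derive1 g t).
  apply: cvgM; first exact: cvg_cst.
  by apply: continuous_cvg; [exact: continuous_enorm|exact: derive1_cvg].
apply: (ler_cvg_to c1 c2); near=> e.
rewrite normrZ enormZ mulrCA ler_wpM2l//; exact: um.
Unshelve. all: by end_near. Qed.

(** Calibration by a truncated Euclidean distance, which is locally constant off
the annulus. *)
Lemma dr_annulus p q x0 (m r1 r2 : R) : 0 < m -> r1 <= r2 ->
  (forall z, r1 <= enorm (z - x0) <= r2 -> m <= F W z) ->
  m * `|clampi r1 r2 (enorm (p - x0)) - clampi r1 r2 (enorm (q - x0))| <= dr p q.
Proof.
move=> m0 r12 mF; rewrite -lee_fin -distE; apply: le_ereal_inf_tmp => _ [g Zg <-].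
rewrite -[X in X * _](gtr0_norm m0) -normrM mulrBr.
apply: (@calibration (fun z => m * clampi r1 r2 (enorm (z - x0))) m) => //.
  move=> x y; rewrite -mulrBr normrM gtr0_norm// ler_wpM2l ?(ltW m0)//.
  apply: (le_trans (clampi_lip _ _ r12)); apply: (le_trans (ler_distB_enorm _ _)).
  by rewrite opprB addrA subrK.
move=> x Fx; have cx := @continuous_enormB R N x0 x.
have [xr1|r1x] := ltP (enorm (x - x0)) r1.
  near=> y; congr (_ * _).
  have yr1 : enorm (y - x0) < r1 by near: y; exact: (cx _ (lt_nbhsl xr1)).
  by rewrite /clampi !(max_idPl _)// ge_min ltW.
have r2x : r2 < enorm (x - x0).
  by rewrite ltNge; apply/negP => xr2; move: Fx; rewrite ltNge mF// r1x.
near=> y; congr (_ * _).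
have yr2 : r2 < enorm (y - x0) by near: y; exact: (cx _ (lt_nbhsr r2x)).
by rewrite /clampi !(min_idPr _)// ltW.
Unshelve. all: by end_near. Qed.

End Metric.

(** * Topology of the metric and absolutely continuous curves *)

Section IntegralSplit.
Context {R : realType}.

Lemma ge0_integral_split (f : R -> R) (a b c : R) : a <= b -> b <= c ->
  measurable_fun `[a, c] f -> (forall t, 0 <= f t) ->
  (\int[@lebesgue_measure R]_(t in `[a, c]) (f t)%:E =
   \int[@lebesgue_measure R]_(t in `[a, b]) (f t)%:E +
   \int[@lebesgue_measure R]_(t in `[b, c]) (f t)%:E)%E.
Proof.
move=> ab bc mf f0.
have U : `[a, c]%classic = `[a, b] `|` `]b, c].
  by rewrite -itv_bndbnd_setU ?bnd_simp.
have mU : measurable_fun (`[a, b] `|` `]b, c]) (EFin \o f).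
  by rewrite -U; apply/measurable_EFinP.
have mS D : measurable D -> D `<=` `[a, c]%classic -> measurable_fun D (EFin \o f).
  by move=> mD DS; apply/measurable_EFinP; exact: measurable_funS mf.
rewrite U ge0_integral_setU//=.
- congr (_ + _)%E; rewrite integral_itv_obnd_cbnd//; apply: mS => //.
  by apply: subset_itv; rewrite bnd_simp.
- by move=> x _; rewrite lee_fin.
- apply/disj_setPS => x [/=]; rewrite !in_itv/= => /andP[_ xb] /andP[bx _].
  by move: (lt_le_trans bx xb); rewrite ltxx.
Qed.

End IntegralSplit.

Section MetricTopology.
Context {R : realType} {N m : nat}.
Variables (W : 'rV[R]_N -> R) (w : 'I_m -> 'rV[R]_N).
Hypotheses (Wcont : continuous W) (W0 : forall q, 0 <= W q).
Hypothesis wZ : zero_set W = range w.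
Implicit Types (g : R -> 'rV[R]_N) (a b t : R) (p q r x y z : 'rV[R]_N).
Notation mu := (@lebesgue_measure R).
Notation d := (dr W).

Lemma W_eq0P x : W x = 0 <-> exists l, x = w l.
Proof.
split=> [Wx|[l ->]].
  by have : zero_set W x by []; rewrite wZ => -[l _ <-]; exists l.
by have : (range w) (w l) by [exists l]; rewrite -wZ.
Qed.

Lemma F_gt0 x : W x != 0 -> 0 < F W x.
Proof. by move=> Wx; rewrite sqrtr_gt0 lt_neqAle eq_sym Wx W0. Qed.

Lemma F_sqr x : F W x ^+ 2 = W x.
Proof. by rewrite sqr_sqrtr. Qed.

Lemma F_compact_min (K : set 'rV[R]_N) : compact K -> (forall x, K x -> W x != 0) ->
  exists2 c, 0 < c & forall x, K x -> c <= F W x.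
Proof.
move=> cK KW; have [K0|nK] := pselect (K !=set0); last first.
  by exists 1 => // x Kx; case: nK; exists x.
have cF : {within K, continuous (F W)} by apply: continuous_subspaceT; exact: F_continuous.
have [x xK xm] := EVT_min_rV K0 cK cF.
by exists (F W x); [apply: F_gt0; apply: KW; rewrite inE in xK|move=> y Ky; apply: xm; rewrite inE].
Qed.

Lemma F_compact_max (K : set 'rV[R]_N) : compact K ->
  exists2 c, 0 <= c & forall x, K x -> F W x <= c.
Proof.
move=> cK; have [K0|nK] := pselect (K !=set0); last first.
  by exists 0 => // x Kx; case: nK; exists x.
have cF : {within K, continuous (F W)} by apply: continuous_subspaceT; exact: F_continuous.
have [x xK xm] := EVT_max_rV K0 cK cF.
by exists (F W x); [exact: F_ge0|move=> y Ky; apply: xm; rewrite inE].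
Qed.

Lemma compact_annulus x (r1 r2 : R) : compact [set z | r1 <= enorm (z - x) <= r2].
Proof.
apply: (subclosed_compact _ (@compact_enorm_ball R N x r2)); last by move=> z /andP[].
have -> : [set z | r1 <= enorm (z - x) <= r2] =
    (fun y => enorm (y - x)) @^-1` [set t | r1 <= t] `&` (fun y => enorm (y - x)) @^-1` [set t | t <= r2].
  by apply/seteqP; split => z /=; [move=> /andP[]|move=> [-> ->]].
apply: closedI; (apply: preimage_closed; first by move=> y _; exact: continuous_enormB).
  exact: closed_ge.
exact: closed_le.
Qed.

(** There are finitely many wells: take [r2] at most half the distance from [x]
to each of the others. *)
Lemma annulus_avoiding_wells x (e : R) : 0 < e -> exists r1 r2 c : R, [/\ 0 < r1, r1 < r2, r2 <= e, 0 < c &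
  forall z, r1 <= enorm (z - x) <= r2 -> c <= F W z].
Proof.
move=> e0.
pose f (l : 'I_m) := if w l == x then e else enorm (w l - x) / 2.
pose r2 := \big[Num.min/e]_l f l.
have f0 l : 0 < f l.
  rewrite /f; case: eqP => // wx; rewrite divr_gt0// lt_neqAle enorm_ge0 andbT eq_sym.
  by apply/eqP => /enorm_eq0/eqP; rewrite subr_eq0 => /eqP.
have r20 : 0 < r2 by rewrite /r2; elim/big_ind : _ => // u v u0 v0; rewrite lt_min u0.
have r2e : r2 <= e by exact: bigmin_le_id.
have r2f l : r2 <= f l by exact: bigmin_le.
have [|c c0 cF] := @F_compact_min _ (@compact_annulus x (r2 / 2) r2); last first.
  by exists (r2 / 2), r2, c; split => //; [rewrite divr_gt0|move: r20; lra].
move=> z /= /andP[z1 z2]; apply/eqP => /W_eq0P[l zl].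
have := r2f l; rewrite /f -zl; case: eqP => [zx|_].
  by move: z1; rewrite zx subrr enorm0; move: r20; lra.
by move: z2 r20; lra.
Qed.

(** Leaving the Euclidean ball of radius [e] requires crossing an annulus free
of wells, at a positive cost. *)
Lemma dr_small x (e : R) : 0 < e -> exists2 de, 0 < de & forall y,
  d x y < de \/ d y x < de -> enorm (y - x) < e.
Proof.
move=> e0; have [r1 [r2 [c [r10 r12 r2e c0 cF]]]] := annulus_avoiding_wells x e0.
exists (c * (r2 - r1)); first by rewrite mulr_gt0// subr_gt0.
move=> y dxy; rewrite ltNge; apply/negP => ey.
have cx : clampi r1 r2 (enorm (x - x)) = r1.
  by rewrite subrr enorm0 /clampi (max_idPl _)// ge_min (ltW r10).
have cy : clampi r1 r2 (enorm (y - x)) = r2.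
  by rewrite /clampi (min_idPr _) ?(le_trans r2e)// (max_idPr _)// ltW.
have r21 : 0 < r2 - r1 by rewrite subr_gt0.
case: dxy; rewrite ltNge => /negP; apply.
  have := dr_annulus Wcont x y c0 (ltW r12) cF; rewrite cx cy distrC.
  by rewrite (gtr0_norm r21).
have := dr_annulus Wcont y x c0 (ltW r12) cF; rewrite cx cy.
by rewrite (gtr0_norm r21).
Qed.

Lemma dr_eq0 x y : d x y = 0 -> x = y.
Proof.
move=> dxy; apply/eqP; rewrite -subr_eq0; apply/eqP/enorm_eq0.
apply/le_anti; rewrite enorm_ge0 andbT; apply/ler_addgt0Pr => e e0; rewrite add0r; apply: ltW.
have [de de0 H] := dr_small x e0; rewrite enormB; apply: H; left.
by rewrite dxy.
Qed.

Lemma dr_gt0 x y : x != y -> 0 < d x y.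
Proof.
by move=> xy; rewrite lt_neqAle dr_ge0 ?andbT//; apply: contra xy => /eqP/esym/dr_eq0 ->.
Qed.

Lemma segment_ball x y z (s rad : R) : 0 <= s <= 1 -> enorm (x - z) < rad -> enorm (y - z) < rad ->
  enorm (x + s *: (y - x) - z) < rad.
Proof.
move=> /andP[s0 s1] xr yr.
have -> : x + s *: (y - x) - z = (1 - s) *: (x - z) + s *: (y - z).
  by apply/rowP => i; rewrite !mxE; ring.
apply: (le_lt_trans (ler_enormD _ _)); rewrite !enormZ !ger0_norm ?subr_ge0//.
have [->|sn] := eqVneq s 0; first by rewrite mul0r addr0 subr0 mul1r.
have sp : 0 < s by rewrite lt_neqAle eq_sym sn.
apply: (@le_lt_trans _ _ ((1 - s) * rad + s * enorm (y - z))).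
  by rewrite lerD2r ler_wpM2l ?subr_ge0// ltW.
apply: (@lt_le_trans _ _ ((1 - s) * rad + s * rad)); first by rewrite ltrD2l ltr_pM2l.
by rewrite -mulrDl subrK mul1r.
Qed.

Lemma dr_le_ball x y z (rad M : R) : enorm (x - z) < rad -> enorm (y - z) < rad ->
  (forall u, enorm (u - z) < rad -> F W u <= M) -> d x y <= M * enorm (y - x).
Proof.
by move=> xr yr FM; apply: dr_segment => // s s01; apply: FM; exact: segment_ball.
Qed.

Lemma dr_near x (e : R) : 0 < e -> exists2 r, 0 < r & forall y, enorm (y - x) < r -> d x y < e /\ d y x < e.
Proof.
move=> e0; have [M M0 FM] := F_compact_max (@compact_enorm_ball R N x 1).
have M1 : 0 < M + 1 by rewrite ltr_wpDl.
exists (Num.min 1 (e / (M + 1))); first by rewrite lt_min ltr01 divr_gt0.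
move=> y; rewrite lt_min => /andP[y1 ye].
have x1 : enorm (x - x) < 1 by rewrite subrr enorm0.
have FM' u : enorm (u - x) < 1 -> F W u <= M by move=> u1; apply: FM; exact: ltW.
have lte : M * enorm (y - x) < e.
  apply: (@le_lt_trans _ _ ((M + 1) * enorm (y - x))).
    by rewrite ler_wpM2r ?enorm_ge0// lerDl.
  by rewrite mulrC -ltr_pdivlMr.
split; apply: le_lt_trans lte; first exact: dr_le_ball FM'.
rewrite enormB; exact: dr_le_ball FM'.
Qed.

Lemma dr_continuousr x : continuous (d x).
Proof.
move=> y A /nbhs_ballP[e /= e0 eA]; have [r r0 H] := dr_near y e0.
apply/nbhs_enormP; exists r => // z /H[yz zy]; apply: eA; rewrite /ball/=.
have := dr_triangle Wcont y x z; have := dr_triangle Wcont z x y.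
by move: yz zy; rewrite ltr_norml; move: (d x y) (d x z) (d y z) (d z y) => *; apply/andP; split; lra.
Qed.

Lemma dr_continuousl y : continuous (fun x => d x y).
Proof.
move=> x A /nbhs_ballP[e /= e0 eA]; have [r r0 H] := dr_near x e0.
apply/nbhs_enormP; exists r => // z /H[yz zy]; apply: eA; rewrite /ball/=.
have := dr_triangle Wcont x z y; have := dr_triangle Wcont z x y.
by move: yz zy; rewrite ltr_norml; move: (d x y) (d x z) (d z x) (d z y) => *; apply/andP; split; lra.
Qed.

(** [F W] is nearly constant close to [x]. The segment from [y] to [z] then
gives the upper bound, and calibration on a ball around [y] the lower one. *)
Lemma metric_derivative x (e : R) : 0 < e -> W x != 0 -> exists2 r, 0 < r & forall y z,
  enorm (y - x) < r -> enorm (z - x) < r ->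
  (F W x - e) * enorm (y - z) <= d y z /\ d y z <= (F W x + e) * enorm (y - z).
Proof.
move=> e0 Wx.
have /nbhs_enormP[r' r'0 Fr] : nbhs x [set y | `|F W x - F W y| < e].
  have := @F_continuous _ _ _ Wcont x; move=> /cvgrPdist_lt/(_ e e0); exact.
have Fr1 y : enorm (y - x) < r' -> F W x - e <= F W y.
  by move=> /Fr/=; rewrite ltr_norml => /andP[h1 h2]; move: h1 h2; move: (F W x) (F W y) => *; lra.
have Fr2 y : enorm (y - x) < r' -> F W y <= F W x + e.
  by move=> /Fr/=; rewrite ltr_norml => /andP[h1 h2]; move: h1 h2; move: (F W x) (F W y) => *; lra.
exists (r' / 3); first by rewrite divr_gt0.
have r3 : r' / 3 < r' by move: r'0; lra.
move=> y z yr zr; split; last first.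
  by rewrite enormB; apply: dr_le_ball Fr2; exact: lt_trans r3.
have [c0|c0] := leP (F W x - e) 0.
  by apply: (@le_trans _ _ 0); [rewrite mulr_le0_ge0// enorm_ge0|exact: dr_ge0].
have r2 : 0 <= 2 * (r' / 3) by move: r'0; lra.
have cF u : 0 <= enorm (u - y) <= 2 * (r' / 3) -> F W x - e <= F W u.
  move=> /andP[_ uy]; apply: Fr1; apply: (le_lt_trans (ler_enorm_trans y _ _)).
  by move: uy yr; move: (enorm (u - y)) (enorm (y - x)) => *; lra.
have yz : enorm (z - y) <= 2 * (r' / 3).
  apply: (le_trans (ler_enorm_trans x _ _)); rewrite (enormB x y).
  by move: zr yr; move: (enorm (z - x)) (enorm (y - x)) => *; lra.
have := dr_annulus Wcont y z c0 r2 cF.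
rewrite subrr enorm0 !clampi_id ?lexx ?enorm_ge0// sub0r normrN.
by rewrite (ger0_norm (enorm_ge0 _)) enormB.
Qed.

(** On a short interval [d] is at most the local maximum of [F W] times the
length of the curve, by comparison with a segment. By the triangle inequality
and [cousin] these bounds add up, with an error of [e] times the total length.
*)
Lemma dr_le_acurve (V G : R -> 'rV[R]_N) a b : a <= b -> {within `[a, b], continuous V} ->
  acurve V G a b -> ((d (V a) (V b))%:E <= \int[mu]_(t in `[a, b]) (F W (V t) * enorm (G t))%:E)%E.
Proof.
move=> ab /within_itvP cV VG.
have iG i : mu.-integrable `[a, b] (fun t => (G t 0 i)%:E) by have [] := VG i.
have iN := integrable_coord_enorm (measurable_itv _) iG.
have mN : measurable_fun `[a, b] (fun t => enorm (G t)).
  by apply/measurable_EFinP; case/integrableP : iN.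
have mFV : measurable_fun `[a, b] (fun t => F W (V t)).
  have cFV : continuous ((F W \o V) \o clampi a b).
    apply: (@continuous_clamp _ _ (F W \o V)) => //; apply/within_itvP => t tab A FA.
    exact: (cV t tab _ (F_continuous Wcont FA)).
  apply: (eq_measurable_fun ((F W \o V) \o clampi a b)).
    by move=> t; rewrite inE/= in_itv/= => tab; rewrite clampi_id.
  by apply: measurable_funTS; exact: continuous_measurable_fun.
pose I e s t := (\int[mu]_(t in `[s, t]) ((F W (V t) + e) * enorm (G t))%:E)%E.
have mI (e : R) : measurable_fun `[a, b] (fun t => (F W (V t) + e) * enorm (G t)).
  by apply: measurable_funM => //; exact: measurable_funD.
have key e : 0 < e -> ((d (V a) (V b))%:E <= I e a b)%E.
  move=> e0; apply: (@cousin _ (fun s t => ((d (V s) (V t))%:E <= I e s t)%E)) => //.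
    move=> s t u as_ st tu ub st' tu'; rewrite /I (@ge0_integral_split _ _ s t u)//.
    - apply: le_trans (leeD st' tu'); rewrite -EFinD lee_fin; exact: dr_triangle.
    - apply: measurable_funS (mI e) => //; apply: subset_itv; rewrite bnd_simp//.
    - by move=> x; rewrite mulr_ge0 ?addr_ge0 ?F_ge0 ?enorm_ge0 ?(ltW e0).
  move=> t tab.
  have e2 : 0 < e / 2 by rewrite divr_gt0.
  have nF : nbhs (V t) [set y | `|F W (V t) - F W y| < e / 2].
    by have := @F_continuous _ _ _ Wcont (V t); move=> /cvgrPdist_lt/(_ _ e2); exact.
  have /nbhs_enormP[r r0 Fr] := nF.
  have [de de0 dV] := cV t tab _ (near_enorm (V t) r0).
  exists de => // s s' as_ ss sb sd sd'.
  have FM u : enorm (u - V t) < r -> F W u <= F W (V t) + e / 2.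
    by move=> /Fr/=; rewrite ltr_norml => /andP[h1 h2]; move: h1 h2; move: (F W (V t)) (F W u) => *; lra.
  have FM' u : enorm (u - V t) < r -> F W (V t) + e / 2 <= F W u + e.
    by move=> /Fr/=; rewrite ltr_norml => /andP[h1 h2]; move: h1 h2; move: (F W (V t)) (F W u) => *; lra.
  have Vs : enorm (V s - V t) < r by apply: dV => //; rewrite as_ (le_trans ss).
  have Vs' : enorm (V s' - V t) < r by apply: dV => //; rewrite sb (le_trans as_).
  have c0 : 0 <= F W (V t) + e / 2 by rewrite addr_ge0 ?F_ge0// ltW.
  have sub : `[s, s']%classic `<=` `[a, b] by apply: subset_itv; rewrite bnd_simp.
  have iN' : mu.-integrable `[s, s'] (fun t => (enorm (G t))%:E) by exact: integrableS iN.
  apply: (@le_trans _ _ ((F W (V t) + e / 2) * enorm (V s' - V s))%:E).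
    by rewrite lee_fin; exact: dr_le_ball FM.
  apply: (@le_trans _ _ ((F W (V t) + e / 2) * \int[mu]_(x in `[s, s']) enorm (G x))%:E).
    by rewrite lee_fin ler_wpM2l//; exact: acurve_enorm VG _ _ _.
  rewrite -RintegralZl// /Rintegral fineK; last first.
    by apply: integrable_fin_num => //; exact: integrableZ_real.
  apply: le_integral_ge0 => x /=; rewrite in_itv/= => /andP[sx xs].
    by rewrite lee_fin mulr_ge0 ?enorm_ge0.
  rewrite lee_fin ler_wpM2r ?enorm_ge0// FM'//; apply: dV.
    by rewrite (le_trans as_ sx) (le_trans xs sb).
  by move: sd sd' sx xs; rewrite !ltr_norml; move=> /andP[? ?] /andP[? ?] ? ?; apply/andP; split; lra.
apply/lee_addgt0Pr => e e0.
pose L := \int[mu]_(t in `[a, b]) enorm (G t).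
have L0 : 0 <= L by apply: Rintegral_ge0 => t _; exact: enorm_ge0.
have e'0 : 0 < e / (L + 1) by rewrite divr_gt0// ltr_wpDl.
apply: (le_trans (key _ e'0)); rewrite /I.
under eq_integral do rewrite mulrDl EFinD.
rewrite ge0_integralD//=.
- apply: leeD => //.
  have -> : (\int[mu]_(x in `[a, b]) (e / (L + 1) * enorm (G x))%:E)%E = (e / (L + 1) * L)%:E.
    rewrite -RintegralZl// /Rintegral fineK//.
    by apply: integrable_fin_num => //; exact: integrableZ_real.
  rewrite lee_fin mulrAC ler_pdivrMr; last by rewrite ltr_wpDl.
  by rewrite ler_wpM2l ?(ltW e0)// lerDl.
- by move=> x _; rewrite lee_fin mulr_ge0 ?F_ge0 ?enorm_ge0.
- by apply/measurable_EFinP; exact: measurable_funM.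
- by move=> x _; rewrite lee_fin mulr_ge0 ?enorm_ge0 ?(ltW e'0).
- by apply/measurable_EFinP; exact: measurable_funM.
Qed.

Lemma liminf_infty_bound : (0 < liminf_infty W)%E ->
  exists c, exists2 r0, 0 < c & forall z, r0 < enorm z -> c <= F W z.
Proof.
rewrite /liminf_infty limf_einfE => /ereal_sup_gt[_ [A [r _ rA] <-] A0].
pose L := ereal_inf [set (W x)%:E | x in A].
have [c c0 cL] : exists2 c : R, 0 < c & (c%:E <= L)%E.
  move: A0; rewrite -/L; case: L => [l|_|]; first by rewrite lte_fin => l0; exists l.
    by exists 1 => //; rewrite leey.
  by [].
exists (Num.sqrt c), r; first by rewrite sqrtr_gt0.
move=> z rz; apply: ler_wsqrtr; rewrite -lee_fin (le_trans cL)//.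
by apply: ereal_inf_lbound; exists z => //; exact: rA.
Qed.

(** Far away [F W] is bounded below, so going to infinity has infinite cost. *)
Lemma dr_ball_bounded x (D : R) : (0 < liminf_infty W)%E ->
  exists rad, forall y, d x y <= D -> enorm y <= rad.
Proof.
move=> /liminf_infty_bound[c [r0 c0 cF]].
pose r1 := Num.max r0 (enorm x) + 1.
have r10 : r0 < r1 by rewrite (@le_lt_trans _ _ (Num.max r0 (enorm x)))// ?le_max ?lexx// ltrDl.
have r1x : enorm x < r1 by rewrite (@le_lt_trans _ _ (Num.max r0 (enorm x)))// ?le_max ?lexx ?orbT// ltrDl.
pose rad := r1 + (`|D| / c + 1).
have r1rad : r1 <= rad by rewrite lerDl addr_ge0// divr_ge0// ltW.
exists rad => y; apply: contraTT; rewrite -!ltNge => yrad.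
have cF' z : r1 <= enorm (z - 0) <= rad -> c <= F W z.
  by rewrite subr0 => /andP[r1z _]; apply: cF; exact: lt_le_trans r1z.
apply: lt_le_trans (dr_annulus Wcont x y c0 r1rad cF').
rewrite !subr0.
have -> : clampi r1 rad (enorm x) = r1.
  by rewrite /clampi (max_idPl _)// ge_min (ltW r1x).
have -> : clampi r1 rad (enorm y) = rad.
  by rewrite /clampi (min_idPr (ltW yrad)) (max_idPr _).
rewrite /rad opprD addrA subrr sub0r normrN ger0_norm; last by rewrite addr_ge0// divr_ge0// ltW.
rewrite mulrDr mulrCA divff ?gt_eqF// !mulr1.
by rewrite (le_lt_trans (ler_norm D))// ltrDl.
Qed.

End MetricTopology.

(** * Minimizing geodesics and the strict triangle inequality *)

Section Geodesic.
Context {R : realType} {N m : nat}.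
Variables (W : 'rV[R]_N -> R) (w : 'I_m -> 'rV[R]_N).
Hypotheses (Wcont : continuous W) (W0 : forall q, 0 <= W q).
Hypothesis wZ : zero_set W = range w.
Hypothesis Winf : (0 < liminf_infty W)%E.
Implicit Types (g c : R -> 'rV[R]_N) (a b t s : R) (p q x y z : 'rV[R]_N).
Notation mu := (@lebesgue_measure R).
Notation d := (dr W).

Let dtri := dr_triangle Wcont.
Let dge0 := dr_ge0 Wcont.
Let dxx := dr_xx Wcont.

(** An almost minimizing curve from [x] to [y] passes through points at distance
[s] from [x], which lie almost between [x] and [y]. All points at distance [s]
form a compact set, so a minimum of [d z y] over it is attained. *)
Lemma betweenness x y s : 0 <= s <= d x y -> exists z, d x z = s /\ d z y = d x y - s.
Proof.
move=> s0.
have near e : 0 < e -> exists2 z, d x z = s & d z y <= d x y - s + e.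
  move=> e0; have [g /LipZP[Zg g0 g1] Eg] := dr_adherent Wcont x y e0.
  have cf : {within `[0, 1], continuous (fun t => d x (g t))}.
    have [/within_itvP cg _] := Zg; apply/within_itvP => t t01 A nA.
    exact: (cg t t01 _ (dr_continuousr Wcont nA)).
  have [|t t01 ft] := @IVT _ (fun t => d x (g t)) 0 1 s ler01 cf.
    by rewrite g0 g1 dxx (min_idPl (dge0 x y)) (max_idPr (dge0 x y)).
  exists (g t) => //; rewrite in_itv/= in t01; have /andP[t0 t1] := t01.
  have E1 := dr_le_energy_on Wcont t0 (Zlip_sub Zg (lexx 0) t1).
  have E2 := dr_le_energy_on Wcont t1 (Zlip_sub Zg t0 (lexx 1)).
  rewrite energyE (energy_on_split Wcont t0 t1 Zg) in Eg.
  have := le_lt_trans (leeD E1 E2) Eg; rewrite -EFinD lte_fin g0 ft g1.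
  by move: (d x y) (d (g t) y) => *; lra.
pose K := [set z | d x z = s].
have cK : compact K.
  apply: bounded_closed_compact.
    have [rad Hrad] := dr_ball_bounded Wcont x s Winf.
    exists rad; split; first exact: num_real.
    move=> M radM z /= xz; apply: ltW; apply: le_lt_trans radM.
    by apply: (le_trans (norm_le_enorm _)); apply: Hrad; rewrite xz.
  apply: (preimage_closed (f := d x) (D := [set s])).
    by move=> z _; exact: (dr_continuousr Wcont).
  exact: closed_eq.
have K0 : K !=set0 by have [z xz _] := near 1 ltr01; exists z.
have cd : {within K, continuous (fun z => d z y)}.
  by apply: continuous_subspaceT; exact: dr_continuousl.
have [z zK zm] := EVT_min_rV K0 cK cd; rewrite inE in zK.
exists z; split; first exact: zK.
apply/le_anti/andP; split.
  apply/ler_addgt0Pr => e e0; have [u xu uy] := near e e0.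
  by apply: le_trans uy; apply: zm; rewrite inE.
by have := dtri z x y; rewrite zK; move: (d x y) (d z y) => *; lra.
Qed.

(** Menger's argument. Order points between [p] and [q] by betweenness, and take
a maximal chain containing [l]. It is compact, and by [betweenness] it has no
gap, so [d p] maps it bijectively onto [0, D]; the inverse of this map is the
curve. *)
Lemma geodesic_through p l q (D : R) : d p q = D -> d p l + d l q = D ->
  exists c, [/\ c 0 = p, c D = q, exists2 s, 0 <= s <= D & c s = l &
    forall s t, 0 <= s -> s <= t -> t <= D -> d (c s) (c t) = t - s].
Proof.
move=> dpq dplq.
(* [x] comes before [y] on some geodesic from [p] to [q] *)
pose le x y := d p x + d x y + d y q = D.
pose base := [set p; l; q].
pose chain (A : set 'rV[R]_N) := forall x y, A x -> A y -> le x y \/ le y x.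
pose P A := chain (A `|` base).
have chain_base : chain base.
  move=> x y [[->|->]|->] [[->|->]|->]; rewrite /le ?dxx ?addr0 ?add0r ?dpq ?dplq; tauto.
have [A [PA Amax]] : exists A, P A /\ (forall B, A `<` B -> ~ P B).
  apply: Zorn_bigcup => F FP Ftot x y [[X FX Xx]|bx] [[Y FY Yy]|by_].
  - have [XY|YX] := Ftot _ _ FX FY.
      by apply: (FP _ FY); left => //; exact: XY.
    by apply: (FP _ FX); left => //; exact: YX.
  - by apply: (FP _ FX); [left|right].
  - by apply: (FP _ FY); [right|left].
  - exact: chain_base.
pose C := A `|` base.
have Cp : C p by right; left; left.
have Cl : C l by right; left; right.
have Cq : C q by right; right.
have Crefl x : C x -> le x x by move=> Cx; have [] := PA x x Cx Cx.
(* maximality: a point comparable with the whole chain belongs to it *)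
have Cadd z : le z z -> (forall y, C y -> le z y \/ le y z) -> C z.
  move=> lz zC; apply: contrapT => nCz.
  apply: (Amax (A `|` [set z])).
    split; first by move=> u Au; left.
    by move=> /(_ z (or_intror erefl)) Az; apply: nCz; left.
  have zCy y : (A `|` [set z] `|` base) y -> C y \/ y = z.
    by move=> [[Ay|->]|by_]; [left; left|right|left; right].
  move=> x y /zCy[Cx|->] /zCy[Cy|->]; first exact: PA.
  - by have [] := zC x Cx; tauto.
  - exact: zC.
  - by left.
have leE x y : le x y -> d p y = d p x + d x y /\ d y q = D - d p y.
  rewrite /le => H; have := dtri x p y; have := dtri y p q; rewrite dpq; move: H.
  by move: (d p x) (d x y) (d y q) (d p y) => *; split; lra.
have leC x y : C x -> C y -> d p x <= d p y -> le x y.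
  move=> Cx Cy xy; have [//|yx] := PA x y Cx Cy.
  have [E _] := leE _ _ yx.
  have yx0 : d y x = 0.
    by apply/le_anti; rewrite dge0 andbT; move: E xy; move: (d p x) (d p y) (d y x) => *; lra.
  by rewrite -(dr_eq0 Wcont W0 wZ yx0); exact: Crefl.
have CD x : C x -> 0 <= d p x <= D.
  move=> Cx; have := Crefl x Cx; rewrite /le dxx; have := dge0 p x; have := dge0 x q.
  by move: (d p x) (d x q) => *; apply/andP; split; lra.
have Cinj x y : C x -> C y -> d p x = d p y -> x = y.
  move=> Cx Cy xy; apply: (dr_eq0 Wcont W0 wZ).
  have [] := leE _ _ (leC x y Cx Cy _); first by rewrite xy.
  by rewrite xy => E _; move: E; move: (d p y) (d x y) => *; lra.
have dcont (f g : 'rV[R]_N -> R) : continuous f -> continuous g -> continuous (fun z => f z + g z).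
  by move=> cf cg z; exact: (cvgD (cf z) (cg z)).
have closedD (f : 'rV[R]_N -> R) : continuous f -> closed [set z | f z = D].
  by move=> cf; apply: (preimage_closed (D := [set D])) => [z _|]; [exact: cf|exact: closed_eq].
have cst_cont (k : R) : continuous (fun _ : 'rV[R]_N => k) by move=> z; exact: cst_continuous.
have Cclosed : closed C.
  move=> z clz; apply: Cadd.
    have : closed [set z | d p z + d z q = D].
      by apply: closedD; apply: (dcont _ _); [exact: dr_continuousr|exact: dr_continuousl].
    move=> /(_ z) H; rewrite /le dxx addr0; apply: H.
    by apply: closure_subset clz => u /Crefl; rewrite /le dxx addr0.
  move=> y Cy; have : closed ([set z | le z y] `|` [set z | le y z]).
    apply: closedU.
      apply: (closedD (fun z => d p z + d z y + d y q)); apply: (dcont _ _); last exact: cst_cont.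
      by apply: (dcont _ _); [exact: dr_continuousr|exact: dr_continuousl].
    apply: (closedD (fun z => d p y + d y z + d z q)); apply: (dcont _ _); last exact: dr_continuousl.
    by apply: (dcont _ _); [exact: cst_cont|exact: dr_continuousr].
  move=> /(_ z) H; apply: H; apply: closure_subset clz => u Cu.
  by have [] := PA u y Cu Cy; [left|right].
have Ccompact : compact C.
  apply: bounded_closed_compact => //.
  have [rad Hrad] := dr_ball_bounded Wcont p D Winf.
  exists rad; split; first exact: num_real.
  move=> M radM z Cz; apply: ltW; apply: le_lt_trans radM.
  apply: (le_trans (norm_le_enorm _)); apply: Hrad.
  by have /andP[] := CD z Cz.
have cr : continuous (d p) by exact: dr_continuousr.
(* a gap of the chain at [t] would lie between two neighbours [xa] and [xb] *)
have Csurj t : 0 <= t <= D -> exists2 x, C x & d p x = t.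
  move=> /andP[t0 tD]; apply: contrapT => nt.
  have cA : compact (C `&` [set x | d p x <= t]).
    apply: compact_closedI => //; apply: (preimage_closed (D := [set r | r <= t])).
      by move=> z _; exact: cr.
    exact: closed_le.
  have cB : compact (C `&` [set x | t <= d p x]).
    apply: compact_closedI => //; apply: (preimage_closed (D := [set r | t <= r])).
      by move=> z _; exact: cr.
    exact: closed_ge.
  have A0 : C `&` [set x | d p x <= t] !=set0 by exists p; split => //=; rewrite dxx.
  have B0 : C `&` [set x | t <= d p x] !=set0 by exists q; split => //=; rewrite dpq.
  have [xa] := EVT_max_rV A0 cA (continuous_subspaceT cr).
  rewrite inE => -[Cxa /= xat] xam.
  have [xb] := EVT_min_rV B0 cB (continuous_subspaceT cr).
  rewrite inE => -[Cxb /= xbt] xbm.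
  have [Eab Ebq] := leE _ _ (leC xa xb Cxa Cxb (le_trans xat xbt)).
  have [|z [z1 z2]] := @betweenness xa xb (t - d p xa).
    by rewrite subr_ge0 xat Eab in xbt *; rewrite lerBlDl.
  have dpz : d p z = t /\ d z q = D - t.
    have := dtri xa p z; have := dtri xb z q; have := dtri z p q; rewrite z1 z2 Ebq dpq Eab.
    by move: (d p xa) (d xa xb) (d p z) (d z q) => *; split; lra.
  have Cz : C z.
    apply: Cadd; first by rewrite /le dxx dpz.1 dpz.2 addr0 addrC subrK.
    move=> y Cy; have [yt|ty] := leP (d p y) t.
      right; have ya : d p y <= d p xa by apply: xam; rewrite inE; split.
      have [Eya _] := leE _ _ (leC y xa Cy Cxa ya).
      have := dtri xa y z; have := dtri y p z; rewrite /le dpz.1 dpz.2 z1.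
      by move: Eya; move: (d p y) (d y xa) (d p xa) (d y z) => *; lra.
    left; have by_ : d p xb <= d p y by apply: xbm; rewrite inE; split => //; exact: ltW.
    have [Eby Eyq] := leE _ _ (leC xb y Cxb Cy by_).
    have := dtri xb z y; have := dtri z p y; rewrite /le dpz.1 Eyq z2.
    by move: Eby Eab; move: (d xa xb) (d p y) (d xb y) (d p xb) (d z y) (d p xa) => *; lra.
  by apply: nt; exists z => //; case: dpz.
pose c t := xget p [set x | C x /\ d p x = t].
have cP t : 0 <= t <= D -> C (c t) /\ d p (c t) = t.
  move=> tD; rewrite /c; case: xgetP => [x _ //|].
  by have [x Cx xt] := Csurj t tD; move=> /(_ x); case.
have D0 : 0 <= D by rewrite -dpq.
have cE t x : 0 <= t <= D -> C x -> d p x = t -> c t = x.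
  by move=> tD Cx xt; have [Cc ct] := cP t tD; apply: Cinj => //; rewrite ct.
exists c; split.
- by apply: cE => //; rewrite ?lexx.
- by apply: cE => //; rewrite ?lexx ?D0.
- by exists (d p l); [exact: CD|apply: cE => //; exact: CD].
move=> s t s0 st tD.
have [Cs Es] := cP s (introT andP (conj s0 (le_trans st tD))).
have [Ct Et] := cP t (introT andP (conj (le_trans s0 st) tD)).
have [] := leE _ _ (leC _ _ Cs Ct _); first by rewrite Es Et.
by rewrite Es Et => E _; move: E; move: (d _ _) => *; lra.
Qed.

Section ArcLength.
Variables (c : R -> 'rV[R]_N) (rho : R -> R) (a b : R).
Hypothesis cd : forall s t, a <= s -> s <= t -> t <= b -> d (c s) (c t) = rho t - rho s.

Lemma arc_continuous : {within `[a, b], continuous rho} -> {within `[a, b], continuous c}.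
Proof.
move=> /within_itvP crho; apply/within_itvP => t tab A /nbhs_enormP[e e0 eA].
have [de de0 H] := dr_small Wcont W0 wZ (c t) e0.
have nrho : nbhs (rho t) [set r | `|r - rho t| < de].
  by apply/nbhs_ballP; exists de => // r; rewrite /ball/= distrC.
have [dl dl0 dA] := crho t tab _ nrho; exists dl => // s sab st.
apply: eA; apply: H; have := dA s sab st; rewrite /= ltr_norml => /andP[h1 h2].
have /andP[at_ tb] := tab; have /andP[as_ sb] := sab.
have [ts|/ltW st'] := leP t s; [left|right]; rewrite cd//.
by move: h1; move: (rho s) (rho t) => *; lra.
Qed.

Lemma arc_dist s t : a <= s <= b -> a <= t <= b ->
  exists2 e, e = d (c s) (c t) \/ e = d (c t) (c s) & e = `|rho s - rho t|.
Proof.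
move=> /andP[as_ sb] /andP[at_ tb]; have [st|/ltW ts] := leP s t.
  exists (d (c s) (c t)); first by left.
  by rewrite distrC -cd// ger0_norm// dge0.
exists (d (c t) (c s)); first by right.
by rewrite -cd// ger0_norm// dge0.
Qed.

Lemma arc_lipschitz t : {within `[a, b], continuous c} -> a <= t <= b -> W (c t) != 0 ->
  exists2 e, 0 < e & exists2 K, 0 < K & forall s s', a <= s <= b -> a <= s' <= b ->
    `|s - t| < e -> `|s' - t| < e -> enorm (c s - c s') <= K * `|rho s - rho s'|.
Proof.
move=> /within_itvP cc tab Wt.
have F0 : 0 < F W (c t) by exact: F_gt0.
have F20 : 0 < F W (c t) / 2 by rewrite divr_gt0.
have [r r0 H] := metric_derivative Wcont F20 Wt.
have [e e0 He] := cc t tab _ (near_enorm (c t) r0).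
exists e => //; exists (F W (c t) / 2)^-1; first by rewrite invr_gt0.
move=> s s' sab sab' se se'; rewrite mulrC ler_pdivlMr// mulrC.
have [_ [->|->] <-] := arc_dist sab sab'.
  by have [+ _] := H (c s) (c s') (He s sab se) (He s' sab' se');
    move: (F W (c t)) (enorm _) (d _ _) => *; lra.
have [+ _] := H (c s') (c s) (He s' sab' se') (He s sab se); rewrite enormB.
by move: (F W (c t)) (enorm _) (d _ _) => *; lra.
Qed.

(** By [metric_derivative] the increments of [rho] are those of the length of
[c] times [F W (c t)], up to a relative error that tends to zero. *)
Lemma arc_derive t : {within `[a, b], continuous c} -> a < t < b -> W (c t) != 0 ->
  derivable c t 1 -> derivable rho t 1 /\ derive1 rho t = F W (c t) * enorm (derive1 c t).
Proof.
move=> cc tab Wt dc; have /andP[at_ tb] := tab.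
have ct := within_itv_interior cc tab.
set v := enorm (derive1 c t).
have qc : enorm (h^-1 *: (c (h + t) - c t)) @[h --> 0^'] --> v.
  by apply: continuous_cvg; [exact: continuous_enorm|exact: derive1_cvg].
have v0 : 0 <= v by exact: enorm_ge0.
have inab : \forall h \near 0^', a < h + t < b.
  have : \forall h \near 0, a < h + t < b.
    near=> h; apply/andP; split.
      by rewrite -ltrBlDr; near: h; apply: lt_nbhsr; rewrite subr_lt0.
    by rewrite -ltrBrDr; near: h; apply: lt_nbhsl; rewrite subr_gt0.
  exact: cvg_within.
have key : h^-1 *: (rho (h + t) - rho t) @[h --> 0^'] --> F W (c t) * v.
  apply/cvgrPdist_le => e e0.
  pose e1 := e / (v + 2).
  have v2 : 0 < v + 2 by rewrite ltr_wpDl.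
  have e10 : 0 < e1 by rewrite divr_gt0.
  have F1 : 0 < 2 * (F W (c t) + 1) by rewrite mulr_gt0// ltr_wpDl// F_ge0.
  have e20 : 0 < e / (2 * (F W (c t) + 1)) by rewrite divr_gt0.
  have e30 : 0 < e / (2 * (v + 1)) by rewrite divr_gt0// mulr_gt0// ltr_wpDl.
  have [r r0 H] := metric_derivative Wcont e30 Wt.
  have nr : \forall h \near 0^', enorm (c (h + t) - c t) < r.
    have : \forall h \near 0, enorm (c (h + t) - c t) < r.
      have := ct _ (near_enorm (c t) r0) => /nbhs_ballP[e' /= e'0 e'A].
      apply/nbhs_ballP; exists e' => // h; rewrite /ball/= sub0r normrN => he.
      by apply: e'A; rewrite /ball/= distrC addrK.
    exact: cvg_within.
  have n1 : \forall h \near 0^', enorm (h^-1 *: (c (h + t) - c t)) < v + 1.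
    by apply: (cvgr_lt v) => //; rewrite ltrDl.
  have n2 : \forall h \near 0^', `|v - enorm (h^-1 *: (c (h + t) - c t))| <= e / (2 * (F W (c t) + 1)).
    by move/cvgrPdist_le : qc; exact.
  near=> h.
  have h0 : h != 0 by near: h; exact: nbhs_dnbhs_neq.
  have hab : a < h + t < b by near: h.
  have hr : enorm (c (h + t) - c t) < r by near: h.
  have h1 : enorm (h^-1 *: (c (h + t) - c t)) < v + 1 by near: h.
  have h2 : `|v - enorm (h^-1 *: (c (h + t) - c t))| <= e / (2 * (F W (c t) + 1)) by near: h.
  have ctr : enorm (c t - c t) < r by rewrite subrr enorm0.
  set u := enorm (h^-1 *: (c (h + t) - c t)) in h1 h2 *.
  have uE : u = `|h|^-1 * enorm (c (h + t) - c t) by rewrite /u enormZ normfV.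
  have hi0 : 0 < `|h|^-1 by rewrite invr_gt0 normr_gt0.
  have [D [HD1 HD2] HDE] : exists2 D, (F W (c t) - e / (2 * (v + 1))) * enorm (c (h + t) - c t) <= D /\
      D <= (F W (c t) + e / (2 * (v + 1))) * enorm (c (h + t) - c t) &
      h^-1 *: (rho (h + t) - rho t) = `|h|^-1 * D.
    have [hp|hn] := ltP 0 h.
      exists (d (c t) (c (h + t))).
        by rewrite -enormB; exact: H.
      rewrite cd ?(ltW at_)//; first by rewrite gtr0_norm.
        by rewrite lerDr ltW.
      by case/andP : hab => _ /ltW.
    exists (d (c (h + t)) (c t)); first exact: H.
    rewrite cd ?(ltW tb)//.
    - by rewrite ler0_norm// invrN mulNr -mulrN opprB.
    - by case/andP : hab => /ltW.
    - by rewrite gerDr.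
  rewrite HDE.
  have E1 : (F W (c t) - e / (2 * (v + 1))) * u <= `|h|^-1 * D.
    by rewrite uE mulrCA ler_pM2l.
  have E2 : `|h|^-1 * D <= (F W (c t) + e / (2 * (v + 1))) * u.
    by rewrite uE [leRHS]mulrCA ler_pM2l.
  have u0 : 0 <= u by exact: enorm_ge0.
  have G1 : e / (2 * (v + 1)) * u <= e / 2.
    apply: (@le_trans _ _ (e / (2 * (v + 1)) * (v + 1))).
      by rewrite ler_wpM2l// ltW.
    by rewrite invfM mulrA mulfVK// gt_eqF// ltr_wpDl.
  have G2 : F W (c t) * `|v - u| <= e / 2.
    apply: (@le_trans _ _ ((F W (c t) + 1) * (e / (2 * (F W (c t) + 1))))).
      apply: ler_pM => //; first exact: F_ge0.
      by rewrite lerDl.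
    have X0 : F W (c t) + 1 != 0 by rewrite gt_eqF// ltr_wpDl// F_ge0.
    by rewrite le_eqVlt; apply/orP; left; apply/eqP; move: X0; move: (F W (c t) + 1) => X X0; field.
  have G3 : `|F W (c t) * v - F W (c t) * u| <= e / 2.
    by rewrite -mulrBr normrM (ger0_norm (F_ge0 _ _)).
  move: E1 E2 G1 G3; move: (e / (2 * (v + 1))) => k; rewrite mulrBl mulrDl !ler_norml.
  move: (F W (c t) * v) (F W (c t) * u) (`|h|^-1 * D) (k * u) => A1 A2 A3 A4.
  by move=> ? ? ? /andP[? ?]; apply/andP; split; lra.
have E : (fun h : R => h^-1 *: (rho (h + t) - rho t)) = (fun h => h^-1 *: (rho (h *: 1 + t) - rho t)).
  by apply/funext => h; rewrite [h *: 1]mulr1.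
have dr : derivable rho t 1 by apply/cvg_ex; exists (F W (c t) * v); rewrite -E.
split => //; exact: (cvg_unique _ (derive1_cvg dr) key).
Unshelve. all: by end_near. Qed.

End ArcLength.


Section UnitSpeed.
Variables (c : R -> 'rV[R]_N) (p q : 'rV[R]_N) (D : R).
Hypothesis D0 : 0 < D.
Hypothesis cd : forall s t, 0 <= s -> s <= t -> t <= 1 -> d (c s) (c t) = D * t - D * s.
Hypotheses (c0 : c 0 = p) (c1 : c 1 = q).

Lemma unit_speed_continuous : {within `[0, 1], continuous c}.
Proof.
apply: (arc_continuous cd); apply: continuous_subspaceT => t.
by apply: cvgM; [exact: cvg_cst|exact: cvg_id].
Qed.

Lemma unit_speed_LipZ : LipZ W p q c.
Proof.
apply/LipZP; split => //; split; first exact: unit_speed_continuous.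
move=> t t01 Wt; have [e e0 [K K0 H]] := arc_lipschitz cd unit_speed_continuous t01 Wt.
exists e => //; exists (K * D) => s s' sab sab' _ _ st st'.
by rewrite -mulrA -[X in X * `|_|](gtr0_norm D0) -normrM mulrBr; exact: H.
Qed.

(** By [arc_derive] the energy density is the constant [D] almost everywhere off
the wells. *)
Lemma unit_speed_energy : energy W c = D%:E.
Proof.
have dpq : d p q = D by rewrite -c0 -c1 cd ?ler01// mulr1 mulr0 subr0.
apply/le_anti/andP; split; last first.
  by rewrite -dpq; apply: dr_le_energy => //; exact: unit_speed_LipZ.
have /LipZP[Zc _ _] := unit_speed_LipZ.
have -> : D%:E = (\int[mu]_(t in `[0%R : R, 1%R]) D%:E)%E.
  by rewrite integral_cst//= lebesgue_measure_itv/= lte_fin ltr01 oppr0 adde0 mule1.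
rewrite energyE.
Transparent energy_on. rewrite /energy_on. Opaque energy_on.
apply: ae_le_integral_ge0 => //.
- by move=> t _; rewrite lee_fin mulr_ge0 ?F_ge0 ?enorm_ge0.
- by move=> t _; rewrite lee_fin ltW.
apply: aeS3 (Zlip_ae_derivable Wcont Zc) (ae_neq 0) (ae_neq 1) => t dt t0 t1.
rewrite /= in_itv/= => /andP[t0' t1'].
have t01 : 0 < t < 1 by rewrite !lt_neqAle eq_sym t0 t1 t0' t1'.
rewrite lee_fin; have [Wt|Wt] := eqVneq (W (c t)) 0.
  by rewrite (F_eq0 Wt); move: (enorm _) => X; rewrite mul0r ltW.
have [_ <-] := arc_derive cd unit_speed_continuous t01 Wt (dt t01 Wt).
have [_] := derive_affine 0 D t.
rewrite (_ : (fun y : R => 0 + D * y) = *%R D); first by move=> ->.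
by apply/funext => y; rewrite add0r.
Qed.

Lemma unit_speed_length : dlength W c = D%:E.
Proof.
have key (s : seq R) (x : R) : 0 <= x -> path <%R x s -> last x s <= 1 ->
    (\sum_(i < size s) dist W (c (nth 0%R (x :: s) i)) (c (nth 0%R (x :: s) i.+1)) =
     (D * last x s - D * x)%:E)%E.
  elim: s x => [|y s IH] x x0 /=; first by rewrite big_ord0 subrr.
  move=> /andP[xy ys] sl.
  have y0 : 0 <= y by rewrite (le_trans x0)// ltW.
  have y1 : y <= 1.
    apply: le_trans sl; elim: s y ys {IH xy y0} => [|z s IH] y //= /andP[yz zs].
    by rewrite (le_trans (ltW yz))// IH.
  by rewrite big_ord_recl/= IH// distE// cd ?(ltW xy)// -EFinD; congr EFin; ring.
have val (s : seq R) : itv_partition 0 1 s ->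
    (\sum_(i < size s) dist W (c (nth 0%R (0%R :: s) i)) (c (nth 0%R (0%R :: s) i.+1)) = D%:E)%E.
  move=> [ps /eqP ls]; rewrite key// ?ls//.
  by rewrite mulr1 mulr0 subr0.
apply/le_anti/andP; split.
  by apply: ge_ereal_sup => _ [s ps <-]; rewrite val.
rewrite -(val [:: 1]); last by apply: itv_partition1; exact: ltr01.
by apply: ereal_sup_ubound; exists [:: 1] => //; apply: itv_partition1; exact: ltr01.
Qed.

Lemma unit_speed_minimizing : minimizing_geodesic W p q c.
Proof.
have dpq : dist W p q = D%:E by rewrite distE// -c0 -c1 cd ?ler01// mulr1 mulr0 subr0.
split; rewrite ?unit_speed_length ?dpq ?unit_speed_energy//; first exact: unit_speed_LipZ.
apply/le_anti/andP; split.
  apply: le_ereal_inf_tmp => _ [h /LipZP[_ h0 h1] <-].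
  rewrite -dpq -h0 -h1; apply: ereal_sup_ubound; exists [:: 1].
    by apply: itv_partition1; exact: ltr01.
  by rewrite big_ord_recl big_ord0 adde0.
by apply: ereal_inf_lbound; exists c; [exact: unit_speed_LipZ|exact: unit_speed_length].
Qed.

End UnitSpeed.

Section Minimizing.
Variables (g : R -> 'rV[R]_N) (p q : 'rV[R]_N).
Hypothesis gmin : minimizing_geodesic W p q g.

(** The three pieces of the curve cost together no more than [d p q], and no
less by the triangle inequality. *)
Lemma minimizing_chain s t : 0 <= s -> s <= t -> t <= 1 ->
  d p (g s) + d (g s) (g t) + d (g t) q = d p q.
Proof.
move=> s0 st t1; have [/LipZP[Zg g0 g1] _ _ gE] := gmin.
have Eg : energy_on W g 0 1 = (d p q)%:E by rewrite -energyE -gE distE.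
have t0 := le_trans s0 st.
have Z0t := Zlip_sub Zg (lexx 0) t1.
have E1 := dr_le_energy_on Wcont s0 (Zlip_sub Zg (lexx 0) (le_trans st t1)).
have E2 := dr_le_energy_on Wcont st (Zlip_sub Zg s0 t1).
have E3 := dr_le_energy_on Wcont t1 (Zlip_sub Zg t0 (lexx 1)).
rewrite (energy_on_split Wcont t0 t1 Zg) (energy_on_split Wcont s0 st Z0t) in Eg.
have := leeD (leeD E1 E2) E3; rewrite Eg -!EFinD lee_fin g0 g1 => H.
apply/le_anti; rewrite H/=; have := dtri (g s) p q; have := dtri (g t) (g s) q.
by move: (d p q) (d p (g s)) (d (g s) (g t)) (d (g t) q) (d (g s) q) => *; lra.
Qed.

Lemma minimizing_arc s t : 0 <= s -> s <= t -> t <= 1 ->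
  d (g s) (g t) = d p (g t) - d p (g s).
Proof.
move=> s0 st t1; have := minimizing_chain s0 st t1; have := dtri (g s) p (g t); have := dtri (g t) p q.
by move: (d p q) (d p (g s)) (d (g s) (g t)) (d (g t) q) (d p (g t)) => *; lra.
Qed.

Lemma minimizing_on t : 0 <= t <= 1 -> d p (g t) + d (g t) q = d p q.
Proof.
by move=> /andP[t0 t1]; have := minimizing_chain t0 (lexx t) t1; rewrite dxx addr0.
Qed.

Lemma minimizing_ends : g 0 = p /\ g 1 = q.
Proof. by have [/LipZP[_ g0 g1] _ _ _] := gmin. Qed.

Lemma minimizing_start t s : 0 <= t <= 1 -> g t = p -> 0 <= s <= t -> g s = p.
Proof.
move=> /andP[t0 t1] gt /andP[s0 st]; have := minimizing_arc s0 st t1; rewrite gt dxx => H.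
apply/esym; apply: (dr_eq0 Wcont W0 wZ); apply/le_anti; rewrite dge0 andbT.
by have := dge0 (g s) p; move: H; move: (d (g s) p) (d p (g s)) => *; lra.
Qed.

Lemma minimizing_end t s : 0 <= t <= 1 -> g t = q -> t <= s <= 1 -> g s = q.
Proof.
move=> /andP[t0 t1] gt /andP[ts s1]; have := minimizing_arc t0 ts s1.
have := minimizing_on (introT andP (conj (le_trans t0 ts) s1)); rewrite gt => E H.
apply: (dr_eq0 Wcont W0 wZ); apply/le_anti; rewrite dge0 andbT.
by have := dge0 q (g s); move: E H; move: (d (g s) q) (d p (g s)) (d p q) (d q (g s)) => *; lra.
Qed.

End Minimizing.

Hypothesis winj : injective w.
Variables (j k : 'I_m).
Hypothesis hjk : w j != w k.

Definition strict_triangle := forall l : 'I_m, l != j -> l != k ->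
  (dist W (w j) (w k) < dist W (w j) (w l) + dist W (w l) (w k))%E.

Lemma strict_triangle_on g t : strict_triangle -> minimizing_geodesic W (w j) (w k) g ->
  0 <= t <= 1 -> W (g t) = 0 -> g t = w j \/ g t = w k.
Proof.
move=> st gmin t01 /(W_eq0P wZ)[l gl].
have [lj|lj] := eqVneq l j; first by left; rewrite gl lj.
have [lk|lk] := eqVneq l k; first by right; rewrite gl lk.
have := st l lj lk; rewrite !distE// -EFinD lte_fin -gl (minimizing_on gmin t01).
by rewrite ltxx.
Qed.

Lemma zero_timesE g t : zero_times W g t <-> 0 <= t <= 1 /\ W (g t) = 0.
Proof. by rewrite /zero_times/= in_itv/=. Qed.

(** At a third zero time the curve would be at one of its ends, hence rest there
during a whole interval, whereas the zero times form a finite list. *)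
Lemma no_intermediate_wells : strict_triangle -> forall g ts,
  minimizing_geodesic W (w j) (w k) g -> enumerates_zero_times W g ts -> size ts = 2%N.
Proof.
move=> str g ts gmin [srt h0 l1 zE].
have mem t : t \in ts <-> 0 <= t <= 1 /\ W (g t) = 0.
  by rewrite -zero_timesE zE.
case: ts srt h0 l1 zE mem => [|t0 [|t1 [|t2 ts]]]//=.
- by move=> _ _ /esym/eqP; rewrite oner_eq0.
- by move=> _ -> /esym/eqP; rewrite oner_eq0.
move=> /andP[t01 /andP[t12 pth]] t00 lst zE mem; exfalso; rewrite t00 in t01 mem.
have all2 : all (fun x : R => t2 < x) ts by apply: order_path_min pth; exact: lt_trans.
have m1 : 0 <= t1 <= 1 /\ W (g t1) = 0 by apply/mem; rewrite !inE eqxx orbT.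
have m2 : 0 <= t2 <= 1 /\ W (g t2) = 0 by apply/mem; rewrite !inE eqxx !orbT.
have nin u : 0 < u -> u < t2 -> u != t1 -> u \notin [:: 0, t1, t2 & ts].
  move=> u0 u2 u1; rewrite !inE !negb_or (gt_eqF u0) u1 (lt_eqF u2)/=.
  by apply/negP => /(allP all2); rewrite ltNge (ltW u2).
have [m1a m1b] := m1; have [m2a m2b] := m2.
case: (strict_triangle_on str gmin m1a m1b) => gt1.
  have h1 : 0 < t1 / 2 by rewrite divr_gt0.
  have h2 : t1 / 2 < t1 by move: t01; lra.
  have := nin _ h1 (lt_trans h2 t12) (negbT (lt_eqF h2)); move=> /negP; apply; apply/mem.
  have /andP[_ t1l] := m1a; split; first by rewrite (ltW h1) (le_trans (ltW h2)).
  rewrite (minimizing_start gmin m1a gt1); last by rewrite (ltW h1) (ltW h2).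
  by apply/(W_eq0P wZ); exists j.
have h1 : t1 < (t1 + t2) / 2 by move: t12; lra.
have h2 : (t1 + t2) / 2 < t2 by move: t12; lra.
have := nin _ (lt_trans t01 h1) h2 (negbT (gt_eqF h1)); move=> /negP; apply; apply/mem.
have /andP[_ t2l] := m2a.
split; first by rewrite (ltW (lt_trans t01 h1)) (le_trans (ltW h2)).
rewrite (minimizing_end gmin m1a gt1); last by rewrite (ltW h1) (le_trans (ltW h2)).
by apply/(W_eq0P wZ); exists k.
Qed.

(** If the inequality fails at [w l], the geodesic through [w l], run at
constant speed, is minimizing. It meets every well at most once, so its zero
times can be enumerated, and there are at least three of them. *)
Lemma strict_triangle_of_two : (forall g ts,
  minimizing_geodesic W (w j) (w k) g -> enumerates_zero_times W g ts -> size ts = 2%N) ->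
  strict_triangle.
Proof.
move=> H l lj lk; rewrite !distE// -EFinD lte_fin ltNge; apply/negP => tri.
pose D := d (w j) (w k).
have D0 : 0 < D by exact: (dr_gt0 Wcont W0 wZ hjk).
have Dn : D != 0 by rewrite gt_eqF.
have triE : d (w j) (w l) + d (w l) (w k) = D by apply/le_anti; rewrite tri dtri.
have [c [c0 cD [s0 s0D cs0] cd]] := geodesic_through erefl triE.
pose g t := c (D * t).
have gd s t : 0 <= s -> s <= t -> t <= 1 -> d (g s) (g t) = D * t - D * s.
  move=> s0' st t1; apply: cd; first by rewrite mulr_ge0// ltW.
    by rewrite ler_pM2l.
  by rewrite ger_pMr.
have g0 : g 0 = w j by rewrite /g mulr0.
have g1 : g 1 = w k by rewrite /g mulr1.
have gmin := unit_speed_minimizing D0 gd g0 g1.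
have tauE t x : 0 <= t <= 1 -> g t = x -> t = d (w j) x / D.
  move=> /andP[t0 t1] <-; rewrite -g0 gd// mulr0 subr0.
  by rewrite [D * t]mulrC mulfK.
pose P t := (0 <= t <= 1) && (W (g t) == 0).
(* on the constant speed geodesic a well can only be met at the time given by its distance from [w j] *)
pose ts := sort <=%O (undup (seq.filter P [seq d (w j) (w i) / D | i <- enum 'I_m])).
have mem t : t \in ts <-> 0 <= t <= 1 /\ W (g t) = 0.
  rewrite /ts mem_sort mem_undup mem_filter /P; split.
    by move=> /andP[/andP[-> /eqP]].
  move=> [t01 Wt]; rewrite t01 Wt eqxx/=.
  have [i gi] := (W_eq0P wZ (g t)).1 Wt.
  by apply/mapP; exists i; [rewrite mem_enum|exact: tauE].
have srt : sorted <%R ts by rewrite sort_lt_sorted undup_uniq.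
have in0 : 0 \in ts.
  by apply/mem; rewrite lexx ler01 g0; split => //; apply/(W_eq0P wZ); exists j.
have in1 : 1 \in ts.
  by apply/mem; rewrite lexx ler01 g1; split => //; apply/(W_eq0P wZ); exists k.
have h0 : head 0 ts = 0.
  case E : ts in0 srt => [//|x s]; rewrite inE /= => /orP[/eqP //|sx] pth.
  have : x \in ts by rewrite E inE eqxx.
  move=> /mem[/andP[x0 _] _].
  have := allP (order_path_min lt_trans pth) _ sx; rewrite ltNge => /negP.
  by [].
have l1 : last 0 ts = 1.
  have [ts' E] : exists ts', ts = rcons ts' (last 0 ts).
    by case: ts in0 {mem srt in1 h0} => [//|x s] _; exists (belast x s); rewrite -lastI.
  have lin : last 0 ts \in ts by rewrite E mem_rcons inE last_rcons eqxx.
  have /mem[/andP[_ l1] _] := lin.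
  have in1b : 1 \in rcons ts' (last 0 ts) by rewrite -E.
  move: in1b; rewrite mem_rcons inE => /orP[/eqP/esym //|in1'].
  have : sorted <%R (rcons ts' (last 0 ts)) by rewrite -E.
  rewrite (sorted_pairwise lt_trans) pairwise_rcons.
  by move=> /andP[/allP /(_ _ in1') h _]; move: (lt_le_trans h l1); rewrite ltxx.
have en : enumerates_zero_times W g ts.
  split => //; apply/seteqP; split => t.
    by move=> /zero_timesE /mem.
  by move=> /mem /zero_timesE.
have sz := H g ts gmin en.
have s01 : 0 <= s0 / D <= 1.
  have /andP[a0 aD] := s0D.
  by rewrite divr_ge0 ?(ltW D0)//= ler_pdivrMr// mul1r.
have gs0 : g (s0 / D) = w l by rewrite /g mulrC divfK.
have inl : s0 / D \in ts.
  by apply/mem; split => //; rewrite gs0; apply/(W_eq0P wZ); exists l.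
have n0 : s0 / D != 0.
  apply/eqP => e; move: gs0; rewrite e g0 => /winj jl; by rewrite jl eqxx in lj.
have n1 : s0 / D != 1.
  apply/eqP => e; move: gs0; rewrite e g1 => /winj kl; by rewrite kl eqxx in lk.
have u3 : uniq [:: 0; s0 / D; 1] by rewrite /= !inE negb_or eq_sym n0 eq_sym oner_eq0 n1.
have sub3 : {subset [:: 0; s0 / D; 1] <= ts}.
  by move=> x; rewrite !inE => /or3P[] /eqP ->.
by have := uniq_leq_size u3 sub3; rewrite sz.
Qed.

End Geodesic.

(** * Primitives, and regularity of the potential off the wells *)

Section BoundedMeasurable.
Context {R : realType}.
Notation mu := (@lebesgue_measure R).
Implicit Types (f g : R -> R) (a b x y K : R).

Definition bm f := measurable_fun setT f /\ exists K, forall x, `|f x| <= K.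

Lemma bm_cst K : bm (fun=> K). Proof. by split => //; exists `|K|. Qed.

Lemma bmD f g : bm f -> bm g -> bm (fun x => f x + g x).
Proof.
move=> [mf [K fK]] [mg [L gL]]; split; first exact: measurable_funD.
by exists (K + L) => x; rewrite (le_trans (ler_normD _ _))// lerD.
Qed.

Lemma bmM f g : bm f -> bm g -> bm (fun x => f x * g x).
Proof.
move=> [mf [K fK]] [mg [L gL]]; split; first exact: measurable_funM.
by exists (K * L) => x; rewrite normrM ler_pM.
Qed.

Lemma bmN f : bm f -> bm (fun x => - f x).
Proof.
move=> bf; have := bmM (bm_cst (-1)) bf.
by rewrite (_ : (fun x => -1 * f x) = (fun x => - f x))//; apply/funext => x; rewrite mulN1r.
Qed.

Lemma bmB f g : bm f -> bm g -> bm (fun x => f x - g x).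
Proof. by move=> bf bg; exact: bmD bf (bmN bg). Qed.

Lemma bm_sum (n : nat) (f : 'I_n -> R -> R) : (forall i, bm (f i)) -> bm (fun x => \sum_(i < n) f i x).
Proof.
move=> bf; split; first by apply: measurable_sum => i; have [] := bf i.
have bK i := svalP (cid (bf i).2).
exists (\sum_(i < n) sval (cid (bf i).2)) => x.
by rewrite (le_trans (ler_norm_sum _ _ _))//; apply: ler_sum => i _; exact: bK.
Qed.

Lemma bm_integrable f a b : bm f -> mu.-integrable `[a, b] (EFin \o f).
Proof. by move=> [mf [K fK]]; exact: bounded_integrable mf fK. Qed.

Lemma bm_lipschitz f K : (forall x y, `|f x - f y| <= K * `|x - y|) ->
  (exists M, forall x, `|f x| <= M) -> bm f.
Proof.
move=> fK fM; split => //; apply: continuous_measurable_fun.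
exact: lipschitz_continuous_real fK.
Qed.

Lemma Rintegral_split f a b c : a <= b -> b <= c -> mu.-integrable `[a, c] (EFin \o f) ->
  \int[mu]_(t in `[a, c]) f t = \int[mu]_(t in `[a, b]) f t + \int[mu]_(t in `[b, c]) f t.
Proof.
move=> ab bc fi; have := @Rintegral_itvB R f (BLeft a) (BRight c) b fi.
rewrite !bnd_simp => /(_ ab bc) H.
rewrite -(@Rintegral_itv_obnd_cbnd _ b (BRight c)) -?H; first by ring.
by apply: integrableS fi => //; apply: subset_itv; rewrite bnd_simp.
Qed.

Section Primitive.
Variables (a b : R).
Hypothesis ab : a < b.
Let leab := ltW ab.

Definition primitive f x := \int[mu]_(t in `[a, clampi a b x]) f t.

Lemma primitive_diff f x y : bm f -> a <= x -> x <= y -> y <= b ->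
  primitive f y - primitive f x = \int[mu]_(t in `[x, y]) f t.
Proof.
move=> bf ax xy yb; rewrite /primitive !clampi_id ?ax ?yb ?(le_trans ax xy) ?(le_trans xy yb)//.
by rewrite (Rintegral_split ax xy (bm_integrable _ _ bf)) addrC addKr.
Qed.

Lemma primitive_a f : primitive f a = 0.
Proof. by rewrite /primitive clampi_id ?lexx// set_itv1 Rintegral_set1. Qed.

Lemma Rintegral_itv_cst K x y : x <= y -> \int[mu]_(t in `[x, y]) K = K * (y - x).
Proof.
move=> xy; rewrite Rintegral_cst//= lebesgue_measure_itv/= lte_fin.
case: ltP => [_ //|yx].
have -> : x = y by apply/le_anti; rewrite xy.
by rewrite subrr.
Qed.

Lemma normr_Rintegral_le f x y K : bm f -> (forall t, `|f t| <= K) -> x <= y ->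
  `|\int[mu]_(t in `[x, y]) f t| <= K * (y - x).
Proof.
move=> bf fK xy; rewrite -Rintegral_itv_cst//.
apply: (le_trans (le_normr_Rintegral _ _)) => //; first exact: bm_integrable.
apply: le_Rintegral => //.
- exact: (integrable_abse (bm_integrable x y bf)).
- exact: (bm_integrable _ _ (bm_cst K)).
Qed.

Lemma primitive_lipschitz f K : bm f -> (forall t, `|f t| <= K) ->
  forall x y, `|primitive f x - primitive f y| <= K * `|x - y|.
Proof.
move=> bf fK.
have K0 : 0 <= K by apply: le_trans (fK 0).
have key x y : x <= y -> `|primitive f y - primitive f x| <= K * (y - x).
  move=> xy; have cxy : clampi a b x <= clampi a b y.
    have := clampi_lip x y leab; rewrite /clampi /Order.max /Order.min.
    by repeat case: ifPn; rewrite -?leNgt; move=> *; lra.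
  have E t : primitive f t = primitive f (clampi a b t).
    by rewrite /primitive (clampi_id (clampi_itv t leab)).
  have /andP[ax _] := clampi_itv x leab; have /andP[_ yb] := clampi_itv y leab.
  rewrite (E x) (E y) primitive_diff// (le_trans (normr_Rintegral_le bf fK cxy))//.
  rewrite ler_wpM2l// -[leLHS]ger0_norm ?subr_ge0//.
  rewrite (le_trans (clampi_lip _ _ leab))// ger0_norm ?subr_ge0//.
move=> x y; have [xy|/ltW yx] := leP x y.
  by rewrite distrC [X in K * X]distrC (ger0_norm (_ : 0 <= y - x)) ?subr_ge0//; exact: key.
by rewrite (ger0_norm (_ : 0 <= x - y)) ?subr_ge0//; exact: key.
Qed.

Lemma primitive_bound f K : bm f -> (forall t, `|f t| <= K) ->
  forall x, `|primitive f x| <= K * (b - a).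
Proof.
move=> bf fK x; have /andP[ax xb] := clampi_itv x leab.
have K0 : 0 <= K by apply: le_trans (fK 0).
rewrite (le_trans (normr_Rintegral_le bf fK ax))// ler_wpM2l// lerD2r//.
Qed.

Lemma bm_primitive f : bm f -> bm (primitive f).
Proof.
move=> bf; have [_ [K fK]] := bf; apply: bm_lipschitz; first exact: primitive_lipschitz fK.
by exists (K * (b - a)) => x; exact: primitive_bound.
Qed.

Lemma primitive_continuous f : bm f -> continuous (primitive f).
Proof.
move=> bf; have [_ [K fK]] := bf; apply: lipschitz_continuous_real.
exact: primitive_lipschitz fK.
Qed.

Lemma primitive_derive f x : bm f -> {for x, continuous f} -> a < x < b ->
  derivable (primitive f) x 1 /\ derive1 (primitive f) x = f x.
Proof.
move=> bf cf /andP[ax xb].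
have [d1 d2] := continuous_FTC1_closed xb (bm_integrable a b bf) ax cf.
have E : \forall y \near x, primitive f y = (fun y => \int[mu]_(t in `[a, y]) f t) y.
  near=> y; rewrite /primitive clampi_id//; apply/andP; split; apply: ltW; near: y.
    exact: lt_nbhsr.
  exact: lt_nbhsl.
have [h1 h2] := derivable_near E d1; split; first exact: h1.
by rewrite h2; exact: d2.
Unshelve. all: by end_near. Qed.

End Primitive.

(** A Lipschitz function is the integral of any bounded function that agrees
with its derivative almost everywhere. *)
Lemma lipschitz_FTC f k a b K : a < b -> 0 <= K -> bm k ->
  (forall x y, a <= x <= b -> a <= y <= b -> `|f x - f y| <= K * `|x - y|) ->
  {ae mu, forall x, a < x < b -> derivable f x 1 /\ derive1 f x = k x} ->
  f b - f a = \int[mu]_(t in `[a, b]) k t.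
Proof.
move=> ab K0 [mk _] fK fk; have [h [mh hK fE fh]] := lipschitz_density ab K0 fK.
rewrite (fE a b)// ?ltW// /Rintegral; congr fine; apply: ae_eq_integral => //.
- by apply/measurable_EFinP; exact: measurable_funTS.
- by apply/measurable_EFinP; exact: measurable_funTS.
apply: aeS2 (aeS2 (fun _ A B => conj A B) fk fh) (aeS2 (fun _ A B => conj A B) (ae_neq a) (ae_neq b)).
move=> t [fkt fht] [ta tb]; rewrite /= in_itv/= => /andP[at_ tb'].
have tab : a < t < b by rewrite !lt_neqAle eq_sym ta tb at_ tb'.
by have [_ <-] := fkt tab; have [_ <-] := fht tab.
Qed.

Definition oriented f x0 x := if x0 <= x then \int[mu]_(t in `[x0, x]) f t
  else - \int[mu]_(t in `[x, x0]) f t.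

Lemma oriented_derive f A B x0 x : (forall t, A < t < B -> {for t, continuous f}) ->
  A < x0 < B -> A < x < B ->
  derivable (oriented f x0) x 1 /\ derive1 (oriented f x0) x = f x.
Proof.
move=> cf /andP[Ax0 x0B] /andP[Ax xB].
pose a := (A + Num.min x x0) / 2; pose b := (B + Num.max x x0) / 2.
have [Aa [ax ax0]] : A < a /\ (a < x /\ a < x0).
  rewrite /a /Order.min; case: ifPn; rewrite -?leNgt => ?; split; [|split| |split]; lra.
have [bB [xb x0b]] : b < B /\ (x < b /\ x0 < b).
  rewrite /b /Order.max; case: ifPn; rewrite -?leNgt => ?; split; [|split| |split]; lra.
have fi : mu.-integrable `[a, b] (EFin \o f).
  apply: continuous_compact_integrable; first exact: segment_compact.
  apply: continuous_in_subspaceT => t; rewrite inE/= in_itv/= => /andP[at_ tb].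
  by apply: cf; rewrite (lt_le_trans Aa at_) (le_lt_trans tb bB).
have cfx : {for x, continuous f} by apply: cf; rewrite Ax.
have [d1 d2] := continuous_FTC1_closed xb fi ax cfx.
have sub u v : a <= u -> v <= b -> mu.-integrable `[u, v] (EFin \o f).
  by move=> au vb; apply: integrableS fi => //; apply: subset_itv; rewrite bnd_simp.
pose Phi y := \int[mu]_(t in `[a, y]) f t.
have E : \forall y \near x, oriented f x0 y = (Phi y - cst (Phi x0) y).
  near=> y.
  have ay : a < y by near: y; exact: lt_nbhsr.
  have yb : y < b by near: y; exact: lt_nbhsl.
  rewrite /oriented /Phi/=; case: leP => x0y.
    by rewrite (Rintegral_split (ltW ax0) x0y (sub _ _ (lexx a) (ltW yb))) addrAC subrr add0r.
  by rewrite (Rintegral_split (ltW ay) (ltW x0y) (sub _ _ (lexx a) (ltW x0b))) opprD addrA subrr sub0r.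
have [e1 e2] := derivable_near E (derivableB d1 (derivable_cst _ _ _)).
split => //; rewrite e2 derive1E; have -> := deriveB d1 (derivable_cst (Phi x0) x 1).
by rewrite derive_cst subr0 -derive1E.
Unshelve. all: by end_near. Qed.

End BoundedMeasurable.

Lemma powR_small (R : realType) (alpha eta : R) : 0 < alpha -> 0 < eta ->
  exists2 de, 0 < de & forall u, 0 <= u <= de -> u `^ alpha <= eta.
Proof.
move=> al0 eta0; exists (eta `^ alpha^-1); first exact: powR_gt0.
move=> u /andP[u0 ud]; have := ge0_ler_powR (ltW al0) _ _ ud.
rewrite -powRrM mulVf ?gt_eqF// powRr1 ?(ltW eta0)//; apply; rewrite nnegrE//.
exact: powR_ge0.
Qed.

Section PotentialRegularity.
Context {R : realType} {N : nat}.
Variables (W : 'rV[R]_N -> R) (alpha : R).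
Hypotheses (Wcont : continuous W) (W0 : forall q, 0 <= W q).
Hypothesis a01 : 0 < alpha < 1.
Hypothesis Wreg : C1alpha_loc alpha (~` zero_set W) W.
Implicit Types (p q x y z v : 'rV[R]_N).

Lemma derive_gradient x v : differentiable W x -> 'D_v W x = dot (gradient W x) v.
Proof.
move=> dW; rewrite deriveE// {1}(row_sum_delta v) linear_sum/= /dot.
by apply: eq_bigr => i _; rewrite linearZ/= mxE deriveE// mulrC.
Qed.

Lemma line_derive x v (s : R) : differentiable W (x + s *: v) ->
  derivable (fun t : R => W (x + t *: v)) s 1 /\
  derive1 (fun t : R => W (x + t *: v)) s = dot (gradient W (x + s *: v)) v.
Proof.
move=> dW; have dv : derivable W (x + s *: v) v by exact: diff_derivable.
have E : (fun h : R => h^-1 *: (((fun t : R => W (x + t *: v)) \o shift s) (h *: 1) - W (x + s *: v))) =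
   (fun h : R => h^-1 *: ((W \o shift (x + s *: v)) (h *: v) - W (x + s *: v))).
  apply/funext => h /=; congr (_ *: (W _ - _)).
  by rewrite [h *: 1]mulr1 scalerDl addrCA addrA.
split; first by rewrite /derivable E.
by rewrite derive1E /derive E -derive_gradient.
Qed.

Lemma ball_regular x : W x != 0 -> exists r C : R, [/\ 0 < r, 0 <= C,
  forall y, enorm (y - x) <= r -> W y != 0,
  forall y, enorm (y - x) <= r -> differentiable W y &
  forall y z, enorm (y - x) <= r -> enorm (z - x) <= r ->
    enorm (gradient W y - gradient W z) <= C * enorm (y - z) `^ alpha].
Proof.
move=> Wx.
have nW0 : nbhs (W x) [set u : R | u != 0].
  by apply: open_nbhs_nbhs; split => //; exact: open_neq.
have /nbhs_enormP[e e0 eW] : nbhs x [set y | W y != 0] by exact: (Wcont nW0).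
have e2 : e / 2 < e by lra.
have WB y : enorm (y - x) <= e / 2 -> W y != 0.
  by move=> yx; apply: eW; exact: le_lt_trans e2.
have [dW hW] := Wreg.
have sub : [set y | enorm (y - x) <= e / 2] `<=` ~` zero_set W.
  by move=> y /WB /eqP.
have [C HC] := hW _ (@compact_enorm_ball R N x (e / 2)) sub.
exists (e / 2), `|C|; split => //.
- by rewrite divr_gt0.
- by move=> y yx; apply: dW; exact: sub.
move=> y z yx zx; apply: (le_trans (HC y z yx zx)).
by rewrite ler_wpM2r ?powR_ge0// ler_norm.
Qed.

Lemma gradient_continuous x : W x != 0 -> {for x, continuous (gradient W)}.
Proof.
move=> /ball_regular[r [C [r0 C0 _ _ hW]]]; have /andP[al0 _] := a01.
move=> A /nbhs_enormP[e e0 eA].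
have eC : 0 < e / (C + 1) by rewrite divr_gt0// ltr_wpDl.
have [de de0 H] := powR_small al0 eC.
have rd : 0 < Num.min r de by rewrite lt_min r0.
apply/nbhs_enormP; exists (Num.min r de) => // y; rewrite lt_min => /andP[yr yde]; apply: eA.
have xr : enorm (x - x) <= r by rewrite subrr enorm0 ltW.
apply: (le_lt_trans (hW _ _ (ltW yr) xr)).
have h1 : enorm (y - x) `^ alpha <= e / (C + 1) by apply: H; rewrite enorm_ge0 ltW.
apply: (@le_lt_trans _ _ (C * (e / (C + 1)))); first by rewrite ler_wpM2l.
by rewrite mulrCA gtr_pMr// ltr_pdivrMr ?ltr_wpDl// mul1r ltrDl.
Qed.

Lemma segment_closed_ball x y z (rad s : R) : 0 <= s <= 1 ->
  enorm (y - x) <= rad -> enorm (z - x) <= rad -> enorm (y + s *: (z - y) - x) <= rad.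
Proof.
move=> s01 yr zr; apply/ler_addgt0Pr => e e0; apply: ltW.
have l1 : enorm (y - x) < rad + e by rewrite (le_lt_trans yr)// ltrDl.
have l2 : enorm (z - x) < rad + e by rewrite (le_lt_trans zr)// ltrDl.
exact: segment_ball.
Qed.

(** The mean value theorem along the segment, followed by the Hoelder bound on
the gradient. *)
Lemma taylor_upper x (r C : R) : 0 <= C ->
  (forall y, enorm (y - x) <= r -> differentiable W y) ->
  (forall y z, enorm (y - x) <= r -> enorm (z - x) <= r ->
    enorm (gradient W y - gradient W z) <= C * enorm (y - z) `^ alpha) ->
  forall y z, enorm (y - x) <= r -> enorm (z - x) <= r ->
    W z <= W y + dot (gradient W y) (z - y) + C * enorm (z - y) `^ alpha * enorm (z - y).
Proof.
move=> C0 dW hW y z yr zr; pose f (s : R) := W (y + s *: (z - y)).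
have seg s : 0 <= s <= 1 -> enorm (y + s *: (z - y) - x) <= r.
  by move=> s01; exact: segment_closed_ball.
have df s : 0 <= s <= 1 -> derivable f s 1 /\ derive1 f s = dot (gradient W (y + s *: (z - y))) (z - y).
  by move=> s01; apply: line_derive; apply: dW; exact: seg.
have isd s : s \in `]0 : R, 1[%R -> is_derive s (1 : R) f (derive1 f s).
  rewrite in_itv/= => /andP[s0 s1]; have [d1 _] := df s (introT andP (conj (ltW s0) (ltW s1))).
  by rewrite derive1E; exact: derivableP.
have cf : {within `[0, 1], continuous f}.
  apply: derivable_within_continuous => s; rewrite in_itv/= => s01.
  by have [] := df s s01.
have [s s01 E] := MVT ltr01 isd cf.
rewrite in_itv/= in s01; have /andP[s0 s1] := s01.
have s01' : 0 <= s <= 1 by rewrite !ltW.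
have [_ E'] := df s s01'.
have f0 : f 0 = W y by rewrite /f scale0r addr0.
have f1 : f 1 = W z by rewrite /f scale1r addrC subrK.
rewrite f0 f1 E' subr0 mulr1 in E.
have -> : W z = W y + dot (gradient W (y + s *: (z - y))) (z - y) by rewrite -E addrC subrK.
rewrite -addrA lerD2l.
set g1 := gradient W (y + s *: (z - y)); set g0 := gradient W y.
have -> : dot g1 (z - y) = dot g0 (z - y) + dot (g1 - g0) (z - y).
  by rewrite dotDl dotNl addrCA subrr addr0.
rewrite lerD2l (le_trans (dot_le _ _))// ler_wpM2r ?enorm_ge0//.
apply: (le_trans (hW _ _ (seg s s01') yr)); rewrite ler_wpM2l//.
have -> : y + s *: (z - y) - y = s *: (z - y) by rewrite addrAC subrr add0r.
have /andP[al0 _] := a01.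
apply: ge0_ler_powR; rewrite ?nnegrE ?enorm_ge0 ?(ltW al0)//.
by rewrite enormZ ger0_norm ?(ltW s0)// ler_piMl ?enorm_ge0// ltW.
Qed.

End PotentialRegularity.

(** * First variation of the action *)

Section BmIntegral.
Context {R : realType}.
Variables (a b : R).
Hypothesis ab : a < b.
Notation mu := (@lebesgue_measure R).
Implicit Types (f g : R -> R).

Definition Iab f := \int[mu]_(t in `[a, b]) f t.

Lemma IabD f g : bm f -> bm g -> Iab (fun t => f t + g t) = Iab f + Iab g.
Proof. by move=> bf bg; rewrite /Iab RintegralD//; exact: bm_integrable. Qed.

Lemma IabZ f k : bm f -> Iab (fun t => k * f t) = k * Iab f.
Proof. by move=> bf; rewrite /Iab RintegralZl//; exact: bm_integrable. Qed.

Lemma Iab_sum (n : nat) (f : 'I_n -> R -> R) : (forall i, bm (f i)) ->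
  Iab (fun t => \sum_(i < n) f i t) = \sum_(i < n) Iab (f i).
Proof. by move=> bf; rewrite /Iab Rintegral_sum// => i; exact: bm_integrable. Qed.

Lemma Iab_cst k : Iab (fun=> k) = k * (b - a).
Proof. by rewrite /Iab Rintegral_itv_cst// ltW. Qed.

Lemma Iab_le f g : bm f -> bm g -> (forall t, a <= t <= b -> f t <= g t) -> Iab f <= Iab g.
Proof.
move=> bf bg fg; have fi := bm_integrable a b bf; have gi := bm_integrable a b bg.
by apply: le_Rintegral => // t; rewrite /= in_itv/=; exact: fg.
Qed.

Lemma Iab_eq f g : (forall t, a <= t <= b -> f t = g t) -> Iab f = Iab g.
Proof. by move=> fg; apply: eq_Rintegral => t; rewrite inE/= in_itv/=; exact: fg. Qed.

Lemma Iab_ae f g : bm f -> bm g -> {ae mu, forall t, a < t < b -> f t = g t} -> Iab f = Iab g.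
Proof.
move=> [mf _] [mg _] fg; rewrite /Iab /Rintegral; congr fine; apply: ae_eq_integral => //.
- by apply/measurable_EFinP; exact: measurable_funTS.
- by apply/measurable_EFinP; exact: measurable_funTS.
apply: aeS3 fg (ae_neq a) (ae_neq b) => t fgt ta tb; rewrite /= in_itv/= => /andP[h1 h2].
by rewrite fgt// !lt_neqAle eq_sym ta tb h1 h2.
Qed.

Lemma Iab_EFin f : bm f -> (\int[mu]_(t in `[a, b]) (f t)%:E)%E = (Iab f)%:E.
Proof.
move=> bf; rewrite /Iab /Rintegral fineK//.
by apply: integrable_fin_num => //; exact: bm_integrable.
Qed.

End BmIntegral.

(** Here [U] is an arc in a ball on which [W] is positive with Hoelder gradient,
run so that its length grows at the rate [sqrt 2 * W U]. Then [U] is Lipschitz,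
and its action is [sqrt 2] times the distance of its ends, so no curve in the
ball with the same ends has less action. *)
Section FirstVariation.
Context {R : realType} {N : nat}.
Variables (W : 'rV[R]_N -> R) (alpha : R).
Hypotheses (Wcont : continuous W) (W0 : forall q, 0 <= W q).
Hypothesis a01 : 0 < alpha < 1.
Variables (x0 : 'rV[R]_N) (r C a b : R) (U : R -> 'rV[R]_N) (sigma : R -> R).
Hypotheses (r0 : 0 < r) (C0 : 0 <= C) (ab : a < b).
Hypothesis ballW : forall y, enorm (y - x0) <= r -> W y != 0.
Hypothesis dW : forall y, enorm (y - x0) <= r -> differentiable W y.
Hypothesis cW : forall y, enorm (y - x0) <= r -> {for y, continuous (gradient W)}.
Hypothesis hW : forall y z, enorm (y - x0) <= r -> enorm (z - x0) <= r ->
    enorm (gradient W y - gradient W z) <= C * enorm (y - z) `^ alpha.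
Hypothesis Ub : forall t, a <= t <= b -> enorm (U t - x0) <= r / 4.
Hypothesis Uc : {within `[a, b], continuous U}.
Hypothesis cd : forall s t, a <= s -> s <= t -> t <= b -> dr W (U s) (U t) = sigma t - sigma s.
Hypothesis csig : {within `[a, b], continuous sigma}.
Hypothesis dsig : forall t, a < t < b ->
  derivable sigma t 1 /\ derive1 sigma t = Num.sqrt 2 * W (U t).
Notation mu := (@lebesgue_measure R).
Notation d := (dr W).
Let leab := ltW ab.
Let I := Iab a b.
Let s2 : R := Num.sqrt 2.

Let s20 : 0 < s2. Proof. by rewrite sqrtr_gt0. Qed.
Let s2s : s2 * s2 = 2. Proof. by rewrite -expr2 sqr_sqrtr. Qed.

Let r4 : r / 4 <= r. Proof. by move: r0; lra. Qed.

Let Ubr t : a <= t <= b -> enorm (U t - x0) <= r.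
Proof. by move=> tab; exact: le_trans (Ub tab) r4. Qed.

Let boundsF : exists f0 M : R, [/\ 0 < f0, 0 <= M,
  (forall y, enorm (y - x0) <= r -> f0 <= F W y) & (forall y, enorm (y - x0) <= r -> W y <= M)].
Proof.
have [f0 f00 f0F] := F_compact_min Wcont W0 (@compact_enorm_ball R N x0 r) ballW.
have [M M0 MF] := F_compact_max Wcont (@compact_enorm_ball R N x0 r).
exists f0, (M ^+ 2); split => //; first exact: sqr_ge0.
by move=> y yr; rewrite -(F_sqr W0) ler_pXn2r ?nnegrE ?F_ge0//; exact: MF.
Qed.

Let sigma_lip : exists2 K, 0 <= K & forall s t, a <= s <= b -> a <= t <= b ->
  `|sigma s - sigma t| <= K * `|s - t|.
Proof.
have [f0 [M [f00 M0 _ WM]]] := boundsF.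
exists (s2 * M); first by rewrite mulr_ge0// ltW.
have key s t : a <= s -> s < t -> t <= b -> `|sigma t - sigma s| <= s2 * M * (t - s).
  move=> as_ st tb.
  have isd u : u \in `]s, t[%R -> is_derive u (1 : R) sigma (derive1 sigma u).
    rewrite in_itv/= => /andP[su ut].
    have [|du _] := @dsig u; first by rewrite (le_lt_trans as_ su) (lt_le_trans ut tb).
    by rewrite derive1E; exact: derivableP.
  have cs : {within `[s, t], continuous sigma}.
    apply: continuous_subspaceW csig => u /=; rewrite !in_itv/= => /andP[su ut].
    by rewrite (le_trans as_ su) (le_trans ut tb).
  have [u] := MVT st isd cs; rewrite in_itv/= => /andP[su ut] ->.
  have uab : a < u < b by rewrite (le_lt_trans as_ su) (lt_le_trans ut tb).
  have [_ ->] := dsig uab; have /andP[ua ub] := uab.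
  have uab' : a <= u <= b by rewrite !ltW.
  rewrite normrM (gtr0_norm (_ : 0 < t - s)) ?subr_gt0// ler_wpM2r ?subr_ge0 ?(ltW st)//.
  rewrite normrM (gtr0_norm s20) (ger0_norm (W0 _)) ler_wpM2l ?(ltW s20)//.
  by apply: WM; exact: Ubr.
move=> s t /andP[as_ sb] /andP[at_ tb]; have [st|ts|->] := ltgtP s t.
- by rewrite distrC [X in _ * X]distrC (gtr0_norm (_ : 0 < t - s)) ?subr_gt0//; exact: key.
- by rewrite (gtr0_norm (_ : 0 < s - t)) ?subr_gt0//; exact: key.
- by rewrite !subrr normr0 mulr0.
Qed.

Let U_lip : exists2 K, 0 <= K & forall s t, a <= s <= b -> a <= t <= b ->
  enorm (U s - U t) <= K * `|s - t|.
Proof.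
have [f0 [M [f00 M0 f0F _]]] := boundsF; have [K K0 sK] := sigma_lip.
have key y z : enorm (y - x0) <= r / 4 -> enorm (z - x0) <= r / 4 -> f0 * enorm (y - z) <= d y z.
  move=> yr zr; have r2 : 0 <= r / 2 by move: r0; lra.
  have yz : enorm (z - y) <= r / 2.
    apply: (le_trans (ler_enorm_trans x0 _ _)); rewrite (enormB x0 y).
    by move: yr zr; move: (enorm (y - x0)) (enorm (z - x0)) => *; lra.
  have fF u : 0 <= enorm (u - y) <= r / 2 -> f0 <= F W u.
    move=> /andP[_ ur]; apply: f0F; apply: (le_trans (ler_enorm_trans y _ _)).
    by move: ur yr; move: (enorm (u - y)) (enorm (y - x0)) => *; lra.
  have := dr_annulus Wcont y z f00 r2 fF.
  rewrite subrr enorm0 !clampi_id ?lexx ?enorm_ge0// sub0r normrN.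
  by rewrite (ger0_norm (enorm_ge0 _)) enormB.
exists (f0^-1 * K); first by rewrite mulr_ge0// invr_ge0 ltW.
move=> s t sab tab; rewrite -mulrA ler_pdivlMl//.
have [_ [->|->] E] := arc_dist Wcont cd sab tab; apply: le_trans (sK s t sab tab).
  by rewrite -E; apply: key; exact: Ub.
by rewrite -E enormB; apply: key; exact: Ub.
Qed.

Let U' t := U (clampi a b t).

Let U'E t : a <= t <= b -> U' t = U t.
Proof. by move=> tab; rewrite /U' clampi_id. Qed.

Let U'b t : enorm (U' t - x0) <= r / 4.
Proof. by apply: Ub; exact: clampi_itv. Qed.

Let U'br t : enorm (U' t - x0) <= r.
Proof. exact: le_trans (U'b t) r4. Qed.

Let U'_lip : exists2 K, 0 <= K & forall s t, enorm (U' s - U' t) <= K * `|s - t|.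
Proof.
have [K K0 UK] := U_lip; exists K => // s t.
rewrite (le_trans (UK _ _ (clampi_itv s leab) (clampi_itv t leab)))// ler_wpM2l//.
exact: clampi_lip.
Qed.

Let U'_coord_bm i : bm (fun t => U' t 0 i).
Proof.
have [K K0 UK] := U'_lip; apply: (@bm_lipschitz _ _ K).
  move=> s t; have := coord_le_enorm (U' s - U' t) i; rewrite !mxE => /le_trans; apply.
  exact: UK.
exists (enorm x0 + r) => t; apply: (le_trans (coord_le_enorm _ _)).
rewrite -[U' t](subrK x0) addrC (le_trans (ler_enormD _ _))// lerD2l.
exact: U'br.
Qed.

Let U'_cont : continuous U'.
Proof. exact: (@continuous_clamp _ _ U a b leab Uc). Qed.

Let WV_bm (V : R -> 'rV[R]_N) : continuous V -> (forall t, enorm (V t - x0) <= r) -> bm (fun t => W (V t)).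
Proof.
move=> cV Vr; have [f0 [M [_ M0 _ WM]]] := boundsF; split.
  apply: continuous_measurable_fun => t.
  by apply: (@continuous_comp _ _ _ V W); [exact: cV|exact: Wcont].
by exists M => t; rewrite (ger0_norm (W0 _)); exact: WM.
Qed.

Let dens : exists G : R -> 'rV[R]_N, [/\ forall i, bm (fun t => G t 0 i),
  forall i x y, a <= x -> x <= y -> y <= b -> U y 0 i - U x 0 i = \int[mu]_(t in `[x, y]) G t 0 i &
  {ae mu, forall x, a < x < b -> derivable U x 1 /\ derive1 U x = G x}].
Proof.
have [K K0 UK] := U_lip; have [G [mG GK GE Gd]] := lipschitz_curve_density ab K0 UK.
by exists G; split => // i; split; [exact: mG|exists K => t; exact: GK].
Qed.

Let G := sval (cid dens).
Let Gbm i : bm (fun t => G t 0 i). Proof. by rewrite /G; case: cid => /= ? []. Qed.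
Let GE i x y : a <= x -> x <= y -> y <= b -> U y 0 i - U x 0 i = \int[mu]_(t in `[x, y]) G t 0 i.
Proof. by rewrite /G; case: cid => /= ? [_ + _]; exact. Qed.
Let Gd : {ae mu, forall x, a < x < b -> derivable U x 1 /\ derive1 U x = G x}.
Proof. by rewrite /G; case: cid => /= ? []. Qed.

Let dot_bm (A B : R -> 'rV[R]_N) : (forall i, bm (fun t => A t 0 i)) -> (forall i, bm (fun t => B t 0 i)) ->
  bm (fun t => dot (A t) (B t)).
Proof. by move=> bA bB; apply: bm_sum => i; exact: bmM. Qed.

Let sq_bm (A : R -> 'rV[R]_N) : (forall i, bm (fun t => A t 0 i)) -> bm (fun t => dot (A t) (A t)).
Proof. by move=> bA; exact: dot_bm. Qed.

(** Kinetic and potential energy agree along [U], by [arc_derive]. *)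
Let energy_U : I (fun t => 2^-1 * dot (G t) (G t) + W (U' t)) = s2 * d (U a) (U b).
Proof.
rewrite cd// ?lexx ?ltW//.
have bW2 : bm (fun t => s2 * W (U' t)).
  by apply: bmM; [exact: bm_cst|exact: WV_bm].
have [K K0 sK] := sigma_lip.
have -> : sigma b - sigma a = I (fun t => s2 * W (U' t)).
  apply: (lipschitz_FTC ab K0 bW2 sK); apply: aeW => t tab; have /andP[at_ tb] := tab.
  by rewrite U'E ?ltW//; exact: dsig.
rewrite -IabZ//; apply: Iab_ae.
- by apply: bmD; [apply: bmM; [exact: bm_cst|exact: sq_bm]|exact: WV_bm].
- by apply: bmM; [exact: bm_cst|].
apply: aeS Gd => t Gt tab; have /andP[at_ tb] := tab.
have tab' : a <= t <= b by rewrite !ltW.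
have [dU UG] := Gt tab; have Wt : W (U t) != 0 by apply: ballW; exact: Ubr.
have [_ E1] := arc_derive Wcont cd Uc tab Wt dU; have [_ E2] := dsig tab.
have F0 : 0 < F W (U t) by exact: F_gt0.
have E : enorm (G t) = s2 * F W (U t).
  apply: (@mulfI _ (F W (U t))); first by rewrite gt_eqF.
  by rewrite -UG -E1 E2 -(F_sqr W0 (U t)) expr2 mulrCA.
rewrite U'E// -sqr_enorm E -(F_sqr W0 (U t)); move: (F W (U t)) => X.
by rewrite [RHS]mulrA exprMn [s2 ^+ 2]expr2 s2s; lra.
Qed.

Let gr i t : R := gradient W (U' t) 0 i.

Let gr_cont i : continuous (gr i).
Proof.
move=> t; apply: cvg_coord; apply: (@continuous_comp _ _ _ U' (gradient W)); first exact: U'_cont.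
exact: cW.
Qed.

Let gr_bm i : bm (gr i).
Proof.
split; first by apply: continuous_measurable_fun; exact: gr_cont.
have /andP[al0 _] := a01.
exists (enorm (gradient W x0) + C * r `^ alpha) => t.
apply: (le_trans (coord_le_enorm _ _)).
rewrite -[gradient W (U' t)](subrK (gradient W x0)) addrC (le_trans (ler_enormD _ _))// lerD2l.
have x0r : enorm (x0 - x0) <= r by rewrite subrr enorm0 ltW.
apply: (le_trans (hW (U'br t) x0r)); rewrite ler_wpM2l//.
by apply: ge0_ler_powR; rewrite ?nnegrE ?enorm_ge0 ?(ltW al0) ?(ltW r0)//; exact: U'br.
Qed.

(** The test field of du Bois-Reymond. The field [xi] is the defect between the
density of [U] and a primitive of the gradient along [U]; the mean [mm] makes
its own primitive [ph] vanish at both ends. The first variation in the direction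
[ph] is the square norm of [xi]. *)
Let Ga i := primitive a b (gr i).
Let Ga_bm i : bm (Ga i). Proof. exact: bm_primitive. Qed.

Let mm i := ((U b 0 i - U a 0 i) - I (Ga i)) / (b - a).
Let pv i t := Ga i t + mm i.
Let pv_bm i : bm (pv i). Proof. by apply: bmD => //; exact: bm_cst. Qed.
Let pv_cont i : continuous (pv i).
Proof. by move=> t; exact: (cvgD (@primitive_continuous _ a b ab _ (gr_bm i) t) (cvg_cst _)). Qed.

Let ph i t := U' t 0 i - U a 0 i - primitive a b (pv i) t.
Let xi i t := G t 0 i - pv i t.
Let phv t : 'rV[R]_N := \row_i ph i t.
Let xiv t : 'rV[R]_N := \row_i xi i t.

Let xi_bm i : bm (xi i). Proof. exact: bmB. Qed.
Let ph_bm i : bm (ph i).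
Proof. by apply: bmB; [apply: bmB; [exact: U'_coord_bm|exact: bm_cst]|exact: bm_primitive]. Qed.

Let ph_diff i x y : a <= x -> x <= y -> y <= b -> ph i y - ph i x = \int[mu]_(t in `[x, y]) xi i t.
Proof.
move=> ax xy yb; rewrite /ph /xi RintegralB//; [|exact: (bm_integrable _ _ (Gbm i))|exact: bm_integrable].
rewrite -GE// -(@primitive_diff _ a b)// !U'E ?ax ?yb ?(le_trans ax xy) ?(le_trans xy yb)//.
by move: (U y 0 i) (U x 0 i) (U a 0 i) (primitive _ _ _ _) (primitive _ _ _ _) => *; ring.
Qed.

Let ph_a i : ph i a = 0.
Proof. by rewrite /ph U'E ?lexx// subrr sub0r primitive_a// oppr0. Qed.

Let ph_b i : ph i b = 0.
Proof.
have ba : b - a != 0 by rewrite subr_eq0 gt_eqF.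
have : primitive a b (pv i) b - primitive a b (pv i) a = I (pv i).
  by rewrite primitive_diff// ltW.
rewrite primitive_a// subr0 /ph => ->; rewrite U'E ?lexx ?leab//.
rewrite /I /pv IabD//; last exact: bm_cst.
rewrite Iab_cst// /mm divfK// /I.
by move: (U b 0 i) (U a 0 i) (Iab a b _) => *; ring.
Qed.

Let phv_bm i : bm (fun t => phv t 0 i).
Proof. by rewrite (_ : (fun t => _) = ph i)//; apply/funext => t; rewrite mxE. Qed.
Let xiv_bm i : bm (fun t => xiv t 0 i).
Proof. by rewrite (_ : (fun t => _) = xi i)//; apply/funext => t; rewrite mxE. Qed.
Let grv_bm i : bm (fun t => gradient W (U' t) 0 i).
Proof. exact: gr_bm. Qed.

Let enorm_bound (A : R -> 'rV[R]_N) : (forall i, bm (fun t => A t 0 i)) ->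
  exists2 B, 0 <= B & forall t, enorm (A t) <= B.
Proof.
move=> bA; pose K i := sval (cid (bA i).2).
have KP i t : `|A t 0 i| <= K i by exact: (svalP (cid (bA i).2)).
exists (\sum_i K i).
  by apply: sumr_ge0 => i _; apply: le_trans (KP i 0).
by move=> t; apply: (le_trans (enorm_le_sum _)); apply: ler_sum => i _; exact: KP.
Qed.

Let phv_cont : continuous phv.
Proof.
move=> t; apply: cvg_coords => i.
rewrite (_ : (fun x => phv x 0 i) = ph i); last by apply/funext => s; rewrite mxE.
rewrite mxE.
have hU : U' s 0 i @[s --> t] --> U' t 0 i by apply: cvg_coord; exact: U'_cont.
have hP : primitive a b (pv i) s @[s --> t] --> primitive a b (pv i) t.
  exact: (primitive_continuous ab (pv_bm i)).
exact: (cvgB (cvgB hU (cvg_cst _)) hP).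
Qed.

Let V_cont (e : R) : continuous (fun t => U' t - e *: phv t).
Proof.
move=> t; have h : (e *: phv s) @[s --> t] --> e *: phv t by apply: cvgZ; [exact: cvg_cst|exact: phv_cont].
exact: (cvgB (@U'_cont t) h).
Qed.

(** The curve [U - e * ph] has the same ends as [U] and stays in the ball;
Young's inequality and [dr_le_acurve] bound its action from below. *)
Let competitor : exists2 e0, 0 < e0 & forall e, 0 < e -> e <= e0 ->
  (forall t, enorm (U' t - e *: phv t - x0) <= r) /\
  I (fun t => 2^-1 * dot (G t) (G t) + W (U' t)) <=
  I (fun t => 2^-1 * dot (G t - e *: xiv t) (G t - e *: xiv t) + W (U' t - e *: phv t)).
Proof.
have [B0 B00 B0P] := enorm_bound phv_bm.
exists (r / 2 / (B0 + 1)); first by rewrite !divr_gt0// ltr_wpDl.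
move=> e e0 ee; pose V t := U' t - e *: phv t; pose GV t := G t - e *: xiv t.
have eB : e * B0 <= r / 2.
  apply: (@le_trans _ _ (e * (B0 + 1))); first by rewrite ler_wpM2l ?(ltW e0)// lerDl.
  by rewrite -ler_pdivlMr// ltr_wpDl.
have Vr t : enorm (V t - x0) <= r.
  rewrite /V addrAC (le_trans (ler_enormD _ _))// enormN enormZ (gtr0_norm e0).
  have h1 := U'b t; have h2 : e * enorm (phv t) <= e * B0 by rewrite ler_wpM2l ?(ltW e0).
  by move: r0 h1 h2 eB; move: (enorm (U' t - x0)) (e * enorm (phv t)) (e * B0) => *; lra.
split; first exact: Vr.
have cV : continuous V.
  exact: V_cont.
have GVbm i : bm (fun t => GV t 0 i).
  rewrite (_ : (fun t => _) = (fun t => G t 0 i - e * xi i t)); last first.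
    by apply/funext => t; rewrite !mxE.
  by apply: bmB => //; apply: bmM => //; exact: bm_cst.
have aV : acurve V GV a b.
  move=> i; split; first exact: (bm_integrable _ _ (GVbm i)).
  move=> x y ax xy yb.
  have -> : \int[mu]_(t in `[x, y]) GV t 0 i = \int[mu]_(t in `[x, y]) (G t 0 i - e * xi i t).
    by apply: eq_Rintegral => t _; rewrite !mxE.
  rewrite RintegralB//; [|exact: (bm_integrable _ _ (Gbm i))|]; last first.
    by apply: integrableZ_real => //; exact: bm_integrable.
  rewrite RintegralZl//; last exact: bm_integrable.
  have xab : a <= x <= b by rewrite ax (le_trans xy yb).
  have yab : a <= y <= b by rewrite yb (le_trans ax xy).
  have VE z : V z 0 i = U' z 0 i - e * ph i z by rewrite /V mxE [X in _ + X]mxE mxE mxE.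
  apply: (etrans _ (congr2 (fun A B => A - e * B) (GE i ax xy yb) (ph_diff i ax xy yb))).
  apply: (etrans (congr2 (fun A B : R => A - B) (VE y) (VE x))).
  rewrite /= (U'E yab) (U'E xab).
  by move: (U y 0 i) (U x 0 i) (ph i y) (ph i x) => *; ring.
have Vend t : (forall i, ph i t = 0) -> a <= t <= b -> V t = U t.
  move=> pt tab; rewrite /V U'E//; have -> : phv t = 0 by apply/rowP => i; rewrite !mxE.
  by rewrite scaler0 subr0.
have Va : V a = U a by apply: Vend; rewrite ?lexx.
have Vb : V b = U b by apply: Vend; rewrite ?lexx ?leab.
have cVw : {within `[a, b], continuous V} by exact: continuous_subspaceT.
have := dr_le_acurve Wcont leab cVw aV; rewrite Va Vb => dV.
have bE : bm (fun t => 2^-1 * dot (GV t) (GV t) + W (V t)).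
  by apply: bmD; [apply: bmM; [exact: bm_cst|exact: sq_bm]|exact: WV_bm].
have bE' : bm (fun t => s2^-1 * (2^-1 * dot (GV t) (GV t) + W (V t))).
  by apply: bmM => //; exact: bm_cst.
rewrite energy_U -ler_pdivlMl// -IabZ// -lee_fin.
apply: (le_trans dV); rewrite -Iab_EFin//; apply: le_integral_ge0 => t _.
  by rewrite lee_fin mulr_ge0 ?F_ge0 ?enorm_ge0.
rewrite lee_fin -sqr_enorm -(F_sqr W0 (V t)) ler_pdivlMl//.
move: (F W (V t)) (enorm (GV t)) => X Y.
have : 0 <= (s2 * X - Y) ^+ 2 by exact: sqr_ge0.
rewrite sqrrB exprMn [s2 ^+ 2]expr2 s2s.
by rewrite -mulr_natr; move: (X ^+ 2) (Y ^+ 2) => X2 Y2; rewrite -mulrA; move: (s2 * (X * Y)) (s2 * X * Y) (mulrA s2 X Y) => p q ->; lra.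
Qed.

Let J := I (fun t => dot (G t) (xiv t) + dot (gradient W (U' t)) (phv t)).

Let bmJ : bm (fun t => dot (G t) (xiv t) + dot (gradient W (U' t)) (phv t)).
Proof. by apply: bmD; exact: dot_bm. Qed.

(** The actions of [U] and of [U - e * ph] differ by [- e * J] up to [o(e)], so
[J] cannot be positive. *)
Let first_variation : J <= 0.
Proof.
have /andP[al0 _] := a01.
have [B0 B00 B0P] := enorm_bound phv_bm; have [B1 B10 B1P] := enorm_bound xiv_bm.
have [e0 e00 He] := competitor.
(* the second order remainder of the action, divided by [e] *)
pose kap e := 2^-1 * e * B1 ^+ 2 + C * (e * B0) `^ alpha * B0.
have main e : 0 < e -> e <= e0 -> J <= kap e * (b - a).
  move=> ep ee; have [He' Hmin] := He e ep ee.
  have bF : bm (fun t => 2^-1 * dot (G t) (G t) + W (U' t)).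
    by apply: bmD; [apply: bmM; [exact: bm_cst|exact: sq_bm]|exact: WV_bm].
  have cV : continuous (fun t => U' t - e *: phv t).
    exact: V_cont.
  have GVbm i : bm (fun t => (G t - e *: xiv t) 0 i).
    rewrite (_ : (fun t => _) = (fun t => G t 0 i - e * xi i t)); last first.
      by apply/funext => t; rewrite !mxE.
    by apply: bmB => //; apply: bmM => //; exact: bm_cst.
  have bV : bm (fun t => 2^-1 * dot (G t - e *: xiv t) (G t - e *: xiv t) + W (U' t - e *: phv t)).
    apply: bmD; [apply: bmM; [exact: bm_cst|exact: (sq_bm GVbm)]|].
    by apply: WV_bm => //; exact: He'.
  have bJe : bm (fun t => - e * (dot (G t) (xiv t) + dot (gradient W (U' t)) (phv t))).
    by apply: bmM => //; exact: bm_cst.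
  move: Hmin; apply: contraTT; rewrite -!ltNge => Jk.
  apply: (@le_lt_trans _ _ (I (fun t => (2^-1 * dot (G t) (G t) + W (U' t)) +
     - e * (dot (G t) (xiv t) + dot (gradient W (U' t)) (phv t)) + e * kap e))); last first.
    rewrite /I IabD//; [|exact: bmD|exact: bm_cst].
    rewrite IabD// IabZ// Iab_cst// -/I -/J -addrA gtrDl.
    have : e * (kap e * (b - a)) < e * J by rewrite ltr_pM2l.
    by rewrite mulrA => h; rewrite mulNr addrC subr_lt0.
  apply: Iab_le => //; first by apply: bmD; [exact: bmD|exact: bm_cst].
  move=> t tab.
  have T := taylor_upper a01 C0 dW hW (U'br t) (He' t).
  have z : U' t - e *: phv t - U' t = - (e *: phv t) by rewrite addrAC subrr add0r.
  rewrite z enormN enormZ (gtr0_norm ep) dotNr dotZr in T.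
  have q1 : dot (G t - e *: xiv t) (G t - e *: xiv t) =
     dot (G t) (G t) - 2 * e * dot (G t) (xiv t) + e ^+ 2 * dot (xiv t) (xiv t).
    rewrite !(dotDl, dotDr, dotNl, dotNr, dotZl, dotZr) (dotC (xiv t) (G t)).
    by move: (dot _ _) (dot _ _) (dot _ _) => *; ring.
  have q2 : dot (xiv t) (xiv t) <= B1 ^+ 2.
    by rewrite -sqr_enorm ler_pXn2r ?nnegrE ?enorm_ge0.
  have q3 : C * (e * enorm (phv t)) `^ alpha * (e * enorm (phv t)) <= C * (e * B0) `^ alpha * (e * B0).
    have h : e * enorm (phv t) <= e * B0 by rewrite ler_wpM2l ?(ltW ep).
    have h0 : 0 <= e * enorm (phv t) by rewrite mulr_ge0 ?enorm_ge0 ?(ltW ep).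
    apply: ler_pM => //; first by rewrite mulr_ge0// powR_ge0.
    rewrite ler_wpM2l//; apply: ge0_ler_powR; rewrite ?nnegrE ?(ltW al0)//.
    exact: le_trans h0 h.
  rewrite q1 /kap; have e2 : 0 <= e ^+ 2 by exact: sqr_ge0.
  have q4 : e ^+ 2 * dot (xiv t) (xiv t) <= e ^+ 2 * B1 ^+ 2 by rewrite ler_wpM2l.
  move: T q3 q4; rewrite [e ^+ 2]expr2.
  move: (dot (G t) (G t)) (dot (G t) (xiv t)) (dot (xiv t) (xiv t)) (dot (gradient W (U' t)) (phv t)) => A1 A2 A3 A4.
  move: (C * (e * enorm (phv t)) `^ alpha * (e * enorm (phv t))) => A5.
  move: (C * (e * B0) `^ alpha) (W (U' t)) (W (U' t - e *: phv t)) (B1 ^+ 2) => A6 A7 A8 A9.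
  move=> T q3 q4.
  have -> : e * (2^-1 * e * A9 + A6 * B0) = 2^-1 * (e * e * A9) + A6 * (e * B0) by ring.
  by move: T q3 q4; move: (e * e * A9) (A6 * (e * B0)) (e * e * A3) => *; lra.
apply/ler_addgt0Pr => eta eta0; rewrite add0r.
have ba0 : 0 < b - a by rewrite subr_gt0.
pose et := eta / (2 * (b - a)).
have et0 : 0 < et by rewrite divr_gt0// mulr_gt0.
have CB : 0 < C * B0 + 1 by rewrite ltr_wpDl// mulr_ge0.
have [de de0 Hde] := powR_small al0 (divr_gt0 et0 CB).
have B12 : 0 < B1 ^+ 2 + 1 by rewrite ltr_wpDl// sqr_ge0.
have B01 : 0 < B0 + 1 by rewrite ltr_wpDl.
pose e := Num.min e0 (Num.min (et / (B1 ^+ 2 + 1)) (de / (B0 + 1))).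
have e_0 : 0 < e by rewrite !lt_min e00 (divr_gt0 et0 B12) (divr_gt0 de0 B01).
have e_1 : e <= e0 by rewrite !ge_min lexx.
have e_3 : e <= et / (B1 ^+ 2 + 1) by rewrite !ge_min lexx !orbT.
have e_4 : e <= de / (B0 + 1) by rewrite !ge_min lexx !orbT.
apply: (le_trans (main e e_0 e_1)).
have k1 : 2^-1 * e * B1 ^+ 2 <= et.
  have h : e * (B1 ^+ 2 + 1) <= et by rewrite -ler_pdivlMr.
  have h2 : 0 <= e * B1 ^+ 2 by rewrite mulr_ge0 ?sqr_ge0 ?(ltW e_0).
  by move: h h2 e_0; rewrite mulrDr mulr1 -mulrA; move: (e * B1 ^+ 2) => *; lra.
have k2 : C * (e * B0) `^ alpha * B0 <= et.
  have h : (e * B0) `^ alpha <= et / (C * B0 + 1).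
    apply: Hde; rewrite mulr_ge0 ?(ltW e_0)//=.
    apply: (@le_trans _ _ (e * (B0 + 1))); first by rewrite ler_wpM2l ?(ltW e_0)// lerDl.
    by rewrite -ler_pdivlMr.
  rewrite mulrAC; apply: (@le_trans _ _ ((C * B0 + 1) * (et / (C * B0 + 1)))); last first.
    by rewrite mulrC divfK// gt_eqF.
  by apply: ler_pM => //; rewrite ?powR_ge0 ?mulr_ge0// lerDl.
rewrite /kap; apply: (@le_trans _ _ ((et + et) * (b - a))).
  by rewrite ler_wpM2r ?(ltW ba0)//; exact: lerD.
by rewrite /et le_eqVlt; apply/orP; left; apply/eqP; field; rewrite gt_eqF.
Qed.

(** The product of [ph] and of the primitive [Ga] of the gradient vanishes at
both ends. *)
Let by_parts : I (fun t => dot (gradient W (U' t)) (phv t)) = - I (fun t => \sum_i Ga i t * xi i t).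
Proof.
have bi i : bm (fun t => gr i t * ph i t) by exact: bmM.
have bj i : bm (fun t => Ga i t * xi i t) by exact: bmM.
have -> : I (fun t => dot (gradient W (U' t)) (phv t)) = I (fun t => \sum_i gr i t * ph i t).
  by apply: Iab_eq => t _; apply: eq_bigr => i _; rewrite [phv t 0 i]mxE.
rewrite /I !Iab_sum//; apply/eqP; rewrite -subr_eq0 opprK -big_split/=; apply/eqP.
apply: big1 => i _; rewrite -IabD//.
have -> : 0 = Ga i b * ph i b - Ga i a * ph i a by rewrite ph_a ph_b !mulr0 subrr.
have [_ [Kg HKg]] := gr_bm i; have [_ [Kx HKx]] := xi_bm i.
have [_ [BG HBG]] := Ga_bm i; have [_ [BP HBP]] := ph_bm i.
have Kg0 : 0 <= Kg by apply: le_trans (HKg 0). have Kx0 : 0 <= Kx by apply: le_trans (HKx 0).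
have BG0 : 0 <= BG by apply: le_trans (HBG 0). have BP0 : 0 <= BP by apply: le_trans (HBP 0).
have phlip s t : a <= s <= b -> a <= t <= b -> `|ph i s - ph i t| <= Kx * `|s - t|.
  have key u v : a <= u -> u <= v -> v <= b -> `|ph i v - ph i u| <= Kx * (v - u).
    move=> au uv vb; rewrite ph_diff//; exact: normr_Rintegral_le.
  move=> /andP[as_ sb] /andP[at_ tb]; have [st|/ltW ts] := leP s t.
    by rewrite distrC [X in _ * X]distrC (ger0_norm (_ : 0 <= t - s)) ?subr_ge0//; exact: key.
  by rewrite (ger0_norm (_ : 0 <= s - t)) ?subr_ge0//; exact: key.
apply/esym; apply: (@lipschitz_FTC _ (fun t => Ga i t * ph i t) _ a b (BG * Kx + Kg * BP)) => //.
- by rewrite addr_ge0// mulr_ge0.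
- by apply: bmD.
- move=> s t sab tab.
  have -> : Ga i s * ph i s - Ga i t * ph i t = Ga i s * (ph i s - ph i t) + (Ga i s - Ga i t) * ph i t.
    by ring.
  rewrite (le_trans (ler_normD _ _))// !normrM mulrDl; apply: lerD.
    by rewrite -mulrA; apply: ler_pM => //; exact: phlip.
  rewrite mulrAC; apply: ler_pM => //; exact: (primitive_lipschitz ab (gr_bm i) HKg).
apply: aeS Gd => t Gt tab; have [dU UG] := Gt tab.
have [dGa GaE] := primitive_derive (gr_bm i) (@gr_cont i t) tab.
have [dpv pvE] := primitive_derive (pv_bm i) (@pv_cont i t) tab.
have [dUi UiE] := derivable_coord i dU.
have phE : \forall s \near t, ph i s = ((fun s => U s 0 i) - cst (U a 0 i) - primitive a b (pv i)) s.
  have /andP[at_ tb] := tab; near=> s; rewrite /ph U'E//; apply/andP; split; apply: ltW; near: s.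
    exact: lt_nbhsr.
  exact: lt_nbhsl.
have d1 : derivable ((fun s => U s 0 i) - cst (U a 0 i)) t 1.
  exact: (derivableB dUi (derivable_cst (U a 0 i) t 1)).
have [dph phD] := derivable_near phE (derivableB d1 dpv).
have phX : derive1 (ph i) t = xi i t.
  rewrite phD derive1E; have -> := deriveB d1 dpv; have -> := deriveB dUi (derivable_cst (U a 0 i) t 1).
  by rewrite derive_cst subr0 -!derive1E UiE pvE UG.
split; first exact: (derivableM dGa dph).
rewrite derive1E; have -> := deriveM dGa dph.
rewrite -!derive1E -/(Ga i) phX /Ga GaE -/(Ga i) /GRing.scale/= addrC mulrC.
by [].
Unshelve. all: by end_near. Qed.

Let xi_null : I (fun t => dot (xiv t) (xiv t)) <= 0.
Proof.
have bj i : bm (fun t => Ga i t * xi i t) by exact: bmM.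
have bk i : bm (fun t => mm i * xi i t) by apply: bmM => //; exact: bm_cst.
have bS : bm (fun t => \sum_i Ga i t * xi i t) by exact: bm_sum.
have bM : bm (fun t => \sum_i mm i * xi i t) by exact: bm_sum.
have bGx : bm (fun t => dot (G t) (xiv t)) by exact: dot_bm.
have m0 : I (fun t => \sum_i mm i * xi i t) = 0.
  rewrite /I Iab_sum//; apply: big1 => i _; rewrite IabZ// /Iab -ph_diff// ?lexx//.
  by rewrite ph_a ph_b subrr mulr0.
have E : I (fun t => dot (xiv t) (xiv t)) = I (fun t => dot (G t) (xiv t)) - I (fun t => \sum_i Ga i t * xi i t).
  have -> : I (fun t => dot (xiv t) (xiv t)) =
     I (fun t => (dot (G t) (xiv t) + -1 * (\sum_i Ga i t * xi i t)) + -1 * \sum_i mm i * xi i t).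
    apply: Iab_eq => t _; rewrite /dot !mulN1r -!sumrN -!big_split/=; apply: eq_bigr => i _.
    by rewrite !mxE /xi /pv; move: (G t 0 i) (Ga i t) (mm i) => *; ring.
  rewrite /I IabD//; last by apply: bmM => //; exact: bm_cst.
    rewrite IabD//; last by apply: bmM => //; exact: bm_cst.
    by rewrite !IabZ// -/I m0 mulr0 addr0 mulN1r.
  by apply: bmD => //; apply: bmM => //; exact: bm_cst.
by rewrite E -by_parts -IabD; [exact: first_variation|exact: dot_bm|exact: dot_bm].
Qed.

Let ph0 i t : a <= t <= b -> ph i t = 0.
Proof.
move=> /andP[at_ tb]; apply/eqP; rewrite -normr_le0; apply/ler_addgt0Pr => eta eta0; rewrite add0r.
have -> : ph i t = \int[mu]_(s in `[a, t]) xi i s by rewrite -ph_diff// ph_a subr0.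
have ba0 : 0 < b - a by rewrite subr_gt0.
pose et := eta / (b - a); have et0 : 0 < et by rewrite divr_gt0.
have bx : bm (fun s => `|xi i s|).
  have [mx [K xK]] := xi_bm i; split; first exact: measurableT_comp.
  by exists K => s; rewrite normr_id.
have bxx : bm (fun s => et^-1 * dot (xiv s) (xiv s)).
  by apply: bmM; [exact: bm_cst|exact: sq_bm].
apply: (@le_trans _ _ (I (fun s => `|xi i s|))).
  apply: (le_trans (le_normr_Rintegral _ _)) => //; first exact: bm_integrable.
  rewrite /I /Iab (Rintegral_split at_ tb (bm_integrable _ _ bx)) lerDl.
  by apply: Rintegral_ge0 => s _.
apply: (@le_trans _ _ (I (fun s => et + et^-1 * dot (xiv s) (xiv s)))).
  apply: Iab_le => //; first by apply: bmD => //; exact: bm_cst.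
  move=> s _; have h : `|xi i s| ^+ 2 <= dot (xiv s) (xiv s).
    rewrite -sqr_enorm ler_pXn2r ?nnegrE ?enorm_ge0//.
    by have := coord_le_enorm (xiv s) i; rewrite mxE.
  have h0 : 0 <= (`|xi i s| - et) ^+ 2 by exact: sqr_ge0.
  have h1 : 2 * et * `|xi i s| <= et ^+ 2 + dot (xiv s) (xiv s).
    by move: h h0; rewrite sqrrB -mulr_natr; move: (`|xi i s|) (dot _ _) => X Y; nra.
  rewrite -(ler_pM2l et0) mulrDr [et * (et^-1 * _)]mulrA mulfV ?gt_eqF// mul1r -expr2.
  apply: le_trans h1; rewrite -mulrA [X in _ <= X]mulrC mulr_natr mulr2n lerDl.
  by rewrite mulr_ge0// ltW.
rewrite /I IabD//; last exact: bm_cst.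
rewrite Iab_cst// IabZ; last exact: sq_bm.
rewrite /et divfK ?gt_eqF// gerDl; apply: mulr_ge0_le0; last exact: xi_null.
by rewrite invr_ge0 ltW.
Qed.

Lemma euler_lagrange_ball t : a < t < b ->
  [/\ derivable U t 1, derivable (derive1 U) t 1 & derive1 (derive1 U) t = gradient W (U t)].
Proof.
move=> tab; have /andP[at_ tb] := tab.
have H u : a < u < b -> derivable U u 1 /\ derive1 U u = \row_i pv i u.
  move=> uab; have /andP[au ub] := uab; apply: derive1_coords => i.
  have [dpv pvE] := primitive_derive (pv_bm i) (@pv_cont i u) uab.
  have E : \forall s \near u, U s 0 i = (cst (U a 0 i) + primitive a b (pv i)) s.
    near=> s; have sab : a <= s <= b.
      by apply/andP; split; apply: ltW; near: s; [exact: lt_nbhsr|exact: lt_nbhsl].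
    have := ph0 i sab; rewrite /ph U'E// => /eqP; rewrite subr_eq0 subr_eq => /eqP ->.
    by rewrite addrC.
  have [d1 d2] := derivable_near E (derivableD (derivable_cst _ _ _) dpv).
  split; first exact: d1.
  rewrite d2 derive1E; have -> := deriveD (derivable_cst (U a 0 i) u 1) dpv.
  by rewrite derive_cst add0r -derive1E pvE mxE.
have [dU _] := H t tab.
have E : \forall s \near t, derive1 U s = \row_i pv i s.
  near=> s; have [|_ //] := H s; apply/andP; split; near: s; [exact: lt_nbhsr|exact: lt_nbhsl].
have [dp pE] : derivable (fun s => \row_i pv i s : 'rV[R]_N) t 1 /\
    derive1 (fun s => \row_i pv i s : 'rV[R]_N) t = gradient W (U t).
  apply: derive1_coords => i.
  have -> : (fun x => (\row_i pv i x : 'rV[R]_N) 0 i) = pv i by apply/funext => s; rewrite mxE.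
  have [dGa GaE] := primitive_derive (gr_bm i) (@gr_cont i t) tab.
  split; first exact: (derivableD dGa (derivable_cst _ _ _)).
  rewrite derive1E; have -> := deriveD dGa (derivable_cst (mm i) t 1).
  by rewrite derive_cst addr0 -derive1E GaE /gr U'E ?ltW.
by have [d1 d2] := derivable_near E dp; split => //; rewrite d2.
Unshelve. all: by end_near. Qed.

End FirstVariation.

Section ArcRegularity.
Context {R : realType} {N : nat}.
Variables (W : 'rV[R]_N -> R) (alpha : R).
Hypotheses (Wcont : continuous W) (W0 : forall q, 0 <= W q).
Hypothesis a01 : 0 < alpha < 1.
Hypothesis Wreg : C1alpha_loc alpha (~` zero_set W) W.

(** A ball around [U x1] free of wells and a short interval on which [U] stays
in it reduce this to [euler_lagrange_ball]. *)
Lemma arc_ode (A B : R) (U : R -> 'rV[R]_N) (sigma : R -> R) x1 : A < x1 < B ->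
  (forall x, A < x < B -> {for x, continuous U}) ->
  (forall s t, A < s -> s <= t -> t < B -> dr W (U s) (U t) = sigma t - sigma s) ->
  (forall x, A < x < B -> derivable sigma x 1 /\ derive1 sigma x = Num.sqrt 2 * W (U x)) ->
  W (U x1) != 0 ->
  [/\ derivable U x1 1, derivable (derive1 U) x1 1,
      derive1 (derive1 U) x1 = gradient W (U x1) &
      enorm (derive1 U x1) = Num.sqrt 2 * F W (U x1)].
Proof.
move=> /andP[Ax xB] cU cd dsig Wx.
have [r [C [r0 C0 bW bd bh]]] := ball_regular Wcont Wreg Wx.
have r40 : 0 < r / 4 by rewrite divr_gt0.
have nU : \forall x \near x1, enorm (U x - U x1) < r / 4.
  exact: (cU x1 (introT andP (conj Ax xB)) _ (near_enorm (U x1) r40)).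
have /nbhs_ballP[eta /= eta0 Heta] := nU.
pose de := Num.min (eta / 2) (Num.min ((x1 - A) / 2) ((B - x1) / 2)).
have de0 : 0 < de by rewrite !lt_min; apply/and3P; split; move: eta0; lra.
have [d1 [d2 d3]] : de <= eta / 2 /\ (de <= (x1 - A) / 2 /\ de <= (B - x1) / 2).
  by rewrite /de; split; [|split]; rewrite !ge_min lexx ?orbT.
pose a := x1 - de; pose b := x1 + de.
have inAB t : a <= t <= b -> A < t < B by rewrite /a /b => /andP[? ?]; apply/andP; split; lra.
have Ub t : a <= t <= b -> enorm (U t - U x1) <= r / 4.
  move=> /andP[at_ tb]; apply: ltW; apply: Heta; rewrite /ball/= ltr_norml.
  by apply/andP; split; move: at_ tb; rewrite /a /b; lra.
have ab : a < b by rewrite /a /b; lra.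
have xab : a < x1 < b by apply/andP; rewrite /a /b; split; lra.
have Uc : {within `[a, b], continuous U}.
  by apply: continuous_in_subspaceT => t; rewrite inE/= in_itv/= => tab; apply: cU; exact: inAB.
have cd' s t : a <= s -> s <= t -> t <= b -> dr W (U s) (U t) = sigma t - sigma s.
  move=> as_ st tb; have /andP[As _] := inAB s (introT andP (conj as_ (le_trans st tb))).
  have /andP[_ tB] := inAB t (introT andP (conj (le_trans as_ st) tb)).
  exact: cd.
have csig : {within `[a, b], continuous sigma}.
  apply: derivable_within_continuous => t; rewrite in_itv/= => tab.
  by have [] := dsig t (inAB t tab).
have dsig' t : a < t < b -> derivable sigma t 1 /\ derive1 sigma t = Num.sqrt 2 * W (U t).
  by move=> /andP[at_ tb]; apply: dsig; apply: inAB; rewrite !ltW.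
have bc y : enorm (y - U x1) <= r -> {for y, continuous (gradient W)}.
  by move=> /bW; exact: (gradient_continuous Wcont a01 Wreg).
have [e1 e2 e3] := euler_lagrange_ball Wcont W0 a01 r0 C0 ab bW bd bc bh Ub Uc cd' csig dsig' xab.
split => //.
have [_ E1] := arc_derive Wcont cd' Uc xab Wx e1; have [_ E2] := dsig' x1 xab.
have F0 : 0 < F W (U x1) by exact: F_gt0.
apply: (@mulfI _ (F W (U x1))); first by rewrite gt_eqF.
by rewrite -E1 E2 -(F_sqr W0 (U x1)) expr2 mulrCA.
Qed.

End ArcRegularity.

(** * Mollifiers and weak derivatives on the line *)

Section LocallyIntegrable.
Context {R : realType}.
Notation mu := (@lebesgue_measure R).
Implicit Types (f g h : R -> R) (a b x y : R).

Definition locint f := measurable_fun setT f /\ forall a b, mu.-integrable `[a, b] (EFin \o f).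

Lemma bm_locint f : bm f -> locint f.
Proof. by move=> bf; split; [case: bf|move=> a b; exact: bm_integrable]. Qed.

Lemma locintM_bm f h : locint f -> bm h -> locint (fun x => f x * h x).
Proof.
move=> [mf fi] [mh [K hK]]; split; first exact: measurable_funM.
move=> a b.
have fK : mu.-integrable `[a, b] (EFin \o (fun x => K * f x)) by exact: integrableZ_real.
apply: le_integrable fK => //.
  by apply/measurable_EFinP; apply: measurable_funTS; exact: measurable_funM.
move=> x _; rewrite lee_fin !normrM [leRHS]mulrC ler_wpM2l//.
exact: le_trans (hK x) (ler_norm K).
Qed.

Lemma locintB f g : locint f -> locint g -> locint (fun x => f x - g x).
Proof.
move=> [mf fi] [mg gi]; split; first exact: measurable_funB.
by move=> a b; exact: (integrableB _ (fi a b) (gi a b)).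
Qed.

Lemma locint_norm f : locint f -> locint (fun x => `|f x|).
Proof.
move=> [mf fi]; split; first exact: measurableT_comp.
by move=> a b; exact: (integrable_abse (fi a b)).
Qed.

Lemma continuous_locint f : continuous f -> locint f.
Proof.
move=> cf; split; first exact: continuous_measurable_fun.
move=> a b; apply: continuous_compact_integrable; first exact: segment_compact.
exact: continuous_subspaceT.
Qed.

Lemma locint_locally_integrable f : locint f -> locally_integrable setT f.
Proof.
move=> [mf fi]; split => //; first exact: openT.
move=> K _ cK; have [M [_ KM]] := compact_bounded cK.
have M1 : M < `|M| + 1 by rewrite ltr_pwDr// ler_norm.
have sub : K `<=` `[- (`|M| + 1), `|M| + 1]%classic.
  by move=> x Kx; rewrite /= in_itv/= -ler_norml; exact: (KM _ M1 x Kx).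
apply: (@le_lt_trans _ _ (\int[mu]_(x in `[(- (`|M| + 1))%R, (`|M| + 1)%R]) `|f x|%:E)%E).
  apply: ge0_subset_integral => //; first exact: compact_measurable.
  by apply/measurable_EFinP; apply: measurable_funTS; exact: measurableT_comp.
by have /integrableP[_] := fi (- (`|M| + 1)) (`|M| + 1).
Qed.

Lemma Rintegral_support f a b : (forall x, ~~ (a <= x <= b) -> f x = 0) ->
  \int[mu]_x f x = \int[mu]_(x in `[a, b]) f x.
Proof.
move=> f0; rewrite [RHS]Rintegral_mkcond; apply: eq_Rintegral => x _.
rewrite patchE; case: ifPn => //; rewrite notin_setE/= in_itv/= => /negP.
exact: f0.
Qed.

Lemma normr_Rintegral_locint f a b : locint f -> `|\int[mu]_(t in `[a, b]) f t| <= \int[mu]_(t in `[a, b]) `|f t|.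
Proof. by move=> [_ fi]; exact: le_normr_Rintegral. Qed.

Lemma ler_Rintegral f g a b : locint f -> locint g -> (forall x, a <= x <= b -> f x <= g x) ->
  \int[mu]_(x in `[a, b]) f x <= \int[mu]_(x in `[a, b]) g x.
Proof.
move=> [_ fi] [_ gi] fg.
by apply: le_Rintegral => // x; rewrite /= in_itv/=; exact: fg.
Qed.

Lemma RintegralB_locint f g a b : locint f -> locint g ->
  \int[mu]_(x in `[a, b]) (f x - g x) = \int[mu]_(x in `[a, b]) f x - \int[mu]_(x in `[a, b]) g x.
Proof. by move=> [_ fi] [_ gi]; rewrite RintegralB. Qed.

Lemma RintegralZ_locint f k a b : locint f ->
  \int[mu]_(x in `[a, b]) (k * f x) = k * \int[mu]_(x in `[a, b]) f x.
Proof. by move=> [_ fi]; rewrite RintegralZl. Qed.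

Lemma C1_FTC f a b : (forall x, derivable f x 1) -> continuous (derive1 f) -> a < b ->
  \int[mu]_(x in `[a, b]) derive1 f x = f b - f a.
Proof.
move=> df cdf ab; have cf : continuous f.
  by move=> x; apply: differentiable_continuous; apply/derivable1_diffP.
have dLR : derivable_oo_LRcontinuous f a b.
  split => //; [exact: cvg_at_right_filter (cf a)|exact: cvg_at_left_filter (cf b)].
by rewrite /Rintegral (continuous_FTC2 ab (continuous_subspaceT cdf) dLR).
Qed.

(** The interval lies in the ball of radius [2 r], whose measure is [4 r]. *)
Lemma lebesgue_pt_mean f x e : locint f -> lebesgue_pt f x -> 0 < e ->
  exists2 r0, 0 < r0 & forall r, 0 < r -> r < r0 ->
    \int[mu]_(z in `[x, x + r]) `|f z - f x| <= e * r.
Proof.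
move=> lf fx e0.
have e4 : 0 < e / 4 by rewrite divr_gt0.
have lfx : locint (fun z => `|f z - f x|).
  by apply: locint_norm; apply: locintB => //; apply: bm_locint; exact: bm_cst.
have : \forall r \near 0^'+, (davg f x r < (e / 4)%:E)%E.
  apply: (fx [set y | (y < (e / 4)%:E)%E]); apply: open_nbhs_nbhs; split; last by rewrite /= lte_fin.
  exact: open_ereal_lt_ereal.
move=> [r1 /= r10 H]; exists (r1 / 2); first by rewrite divr_gt0.
move=> r rp rr; have r1r : 2 * r < r1 by rewrite mulrC -ltr_pdivlMr.
have r2p : 0 < 2 * r by rewrite mulr_gt0.
have rb : ball_ (fun z : R => `|z|) 0 r1 (2 * r) by rewrite /ball_/= sub0r normrN gtr0_norm.
have := H _ rb r2p; rewrite /davg /iavg lebesgue_measure_ball ?(ltW r2p)//.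
have r4 : (2 * r) *+ 2 != 0 by rewrite mulrn_eq0/= gt_eqF.
rewrite inver (negbTE r4) lte_pdivrMl ?lte_fin; last by rewrite mulrn_wgt0.
rewrite -EFinM => dl; rewrite -lee_fin /Rintegral fineK; last first.
  by apply: integrable_fin_num => //; exact: lfx.2.
have -> : e * r = (2 * r) *+ 2 * (e / 4) by rewrite -mulr_natr; field.
apply: le_trans (ltW dl); apply: ge0_subset_integral => //.
- exact: measurable_ball.
- by apply/measurable_EFinP; apply: measurable_funTS; exact: lfx.1.
- move=> z /=; rewrite in_itv/= /ball/= => /andP[xz zx]; rewrite distrC ger0_norm ?subr_ge0//.
  by move: zx rp; lra.
Qed.

End LocallyIntegrable.

Section SmoothStep.
Context {R : realType}.
Notation mu := (@lebesgue_measure R).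
Implicit Types (u x y z e : R).

Definition hump u : R := 6 * (clampi 0 1 u * (1 - clampi 0 1 u)).
(** A C^1 function that is [0] on the left of [0] and [1] on the right of [1].
*)
Definition step u : R := oriented hump 0 u.

Lemma hump_continuous : continuous hump.
Proof.
have cc : continuous (clampi 0 1 : R -> R).
  apply: (@lipschitz_continuous_real _ _ 1) => s t; rewrite mul1r; exact: clampi_lip.
move=> u; apply: cvgM; first exact: cvg_cst.
by apply: cvgM; [exact: cc|apply: cvgB; [exact: cvg_cst|exact: cc]].
Qed.

Lemma hump_itv u : 0 <= hump u <= 6.
Proof.
have /andP[c0 c1] := clampi_itv u (@ler01 R); rewrite /hump; apply/andP; split.
  by rewrite mulr_ge0// mulr_ge0// subr_ge0.
rewrite -[leRHS]mulr1 ler_wpM2l// -[leRHS]mulr1; apply: ler_pM => //; rewrite ?subr_ge0//.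
by rewrite lerBlDr lerDl.
Qed.

Lemma hump_bm : bm hump.
Proof.
split; first exact: continuous_measurable_fun hump_continuous.
by exists 6 => u; have /andP[h0 h6] := hump_itv u; rewrite ger0_norm.
Qed.

Lemma hump_out u : ~~ (0 < u < 1) -> hump u = 0.
Proof.
rewrite negb_and -!leNgt /hump /clampi => /orP[u0|u1].
  have -> : Num.max 0 (Num.min u 1) = 0 by apply/max_idPl; rewrite ge_min u0.
  by rewrite mul0r mulr0.
have -> : Num.max 0 (Num.min u 1) = 1 by rewrite (min_idPr u1); apply/max_idPr.
by rewrite subrr !mulr0.
Qed.

Lemma step_derive u : derivable step u 1 /\ derive1 step u = hump u.
Proof.
apply: (@oriented_derive _ hump (- (`|u| + 1)) (`|u| + 1)).
- by move=> t _; exact: hump_continuous.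
- by rewrite oppr_lt0 ltr_wpDl.
- by rewrite -ltr_norml ltrDl.
Qed.

Lemma hump_integral0 x y : x <= y -> y <= 0 \/ 1 <= x -> \int[mu]_(t in `[x, y]) hump t = 0.
Proof.
move=> xy xy01; rewrite -[RHS](mul0r (y - x)) -(Rintegral_itv_cst 0 xy).
apply: eq_Rintegral => t; rewrite inE/= in_itv/= => /andP[xt ty]; apply: hump_out.
by rewrite negb_and -!leNgt; case: xy01 => h; apply/orP; [left|right]; lra.
Qed.

Lemma hump_integral01 : \int[mu]_(t in `[0, 1]) hump t = 1.
Proof.
pose P : R -> R := (3 : R) *: ((id : R -> R) * id) - (2 : R) *: ((id : R -> R) * id * id).
have dP u : is_derive u 1 P (6 * (u * (1 - u))).
  by apply: is_derive_eq; rewrite !fctE /GRing.scale/=; ring.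
have dP1 u : derive1 P u = 6 * (u * (1 - u)) by rewrite derive1E; apply: derive_val.
have cP : continuous (derive1 P).
  rewrite (_ : derive1 P = fun u => 6 * (u * (1 - u))); last exact/funext.
  move=> u; apply: cvgM; first exact: cvg_cst.
  by apply: cvgM; [exact: cvg_id|apply: cvgB; [exact: cvg_cst|exact: cvg_id]].
have P01 : P 1 - P 0 = 1 by rewrite /P !fctE /GRing.scale/=; ring.
transitivity (\int[mu]_(t in `[0, 1]) derive1 P t).
  by apply: eq_Rintegral => t; rewrite inE/= in_itv/= => t01; rewrite dP1 /hump clampi_id.
have dP' u : derivable P u 1 by exact: ex_derive.
exact: (etrans (C1_FTC dP' cP (@ltr01 R)) P01).
Qed.

Lemma step_le0 u : u <= 0 -> step u = 0.
Proof.
rewrite /step /oriented le_eqVlt => /predU1P[->|u0]; first by rewrite lexx set_itv1 Rintegral_set1.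
by rewrite leNgt u0/= hump_integral0 ?oppr0//; [exact: ltW|left].
Qed.

Lemma step_ge1 u : 1 <= u -> step u = 1.
Proof.
move=> u1; have u0 : 0 <= u by exact: le_trans u1.
rewrite /step /oriented u0 (Rintegral_split ler01 u1 (bm_integrable _ _ hump_bm)).
by rewrite hump_integral01 hump_integral0 ?addr0//; right.
Qed.

Lemma step_itv u : 0 <= step u <= 1.
Proof.
have [u0|/ltW u0] := leP u 0; first by rewrite step_le0// lexx ler01.
have [u1|/ltW u1] := leP 1 u; first by rewrite step_ge1// lexx ler01.
have p x y : 0 <= \int[mu]_(t in `[x, y]) hump t.
  by apply: Rintegral_ge0 => t _; have /andP[] := hump_itv t.
rewrite /step /oriented u0 p/= -hump_integral01 (Rintegral_split u0 u1 (bm_integrable _ _ hump_bm)).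
by rewrite lerDl.
Qed.

(** A bump of integral one on [x, x + e]. *)
Definition mollify x e t : R := e^-1 * hump (e^-1 * (t - x)).
Definition ramp x e t : R := step (e^-1 * (t - x)).

Lemma ramp_derive x e t : derivable (ramp x e) t 1 /\ derive1 (ramp x e) t = mollify x e t.
Proof.
have [ds dsE] := step_derive (e^-1 * (t - x)).
have da : is_derive t 1 (fun t => e^-1 * (t - x)) e^-1.
  have E : (fun t => e^-1 * (t - x)) = e^-1 *: (id - cst x) by [].
  rewrite E; apply: is_derive_eq; rewrite subr0 /GRing.scale/= mulr1.
  by [].
have ds' : is_derive (e^-1 * (t - x)) 1 step (hump (e^-1 * (t - x))).
  by rewrite -dsE derive1E; exact: derivableP.
have H := @is_derive1_comp _ step (fun t => e^-1 * (t - x)) t _ _ ds' da.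
split; first exact: ex_derive.
by rewrite derive1E; have -> := derive_val; rewrite /mollify mulrC.
Qed.

Lemma mollify_continuous x e : continuous (mollify x e).
Proof.
move=> t; apply: cvgM; first exact: cvg_cst.
apply: (@continuous_comp _ _ _ (fun t => e^-1 * (t - x)) hump); last exact: hump_continuous.
by apply: cvgM; [exact: cvg_cst|apply: cvgB; [exact: cvg_id|exact: cvg_cst]].
Qed.

Section PositiveWidth.
Variables (x e : R).
Hypothesis e0 : 0 < e.

Lemma mollify_out t : ~~ (x <= t <= x + e) -> mollify x e t = 0.
Proof.
move=> tx; rewrite /mollify hump_out ?mulr0//; apply: contra tx => /andP[h1 h2].
move: h1 h2; rewrite pmulr_rgt0 ?invr_gt0// mulrC ltr_pdivrMr// => h1 h2.
by apply/andP; split; lra.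
Qed.

Lemma mollify_itv t : 0 <= mollify x e t <= 6 / e.
Proof.
have /andP[h0 h6] := hump_itv (e^-1 * (t - x)); have ei : 0 <= e^-1 by rewrite invr_ge0 ltW.
by rewrite /mollify mulr_ge0//= mulrC ler_wpM2r.
Qed.

Lemma mollify_bm : bm (mollify x e).
Proof.
split; first exact: (continuous_measurable_fun (@mollify_continuous x e)).
by exists (6 / e) => t; have /andP[h0 h6] := mollify_itv t; rewrite ger0_norm.
Qed.

Lemma ramp_le t : t <= x -> ramp x e t = 0.
Proof.
move=> tx; apply: step_le0; rewrite pmulr_rle0 ?invr_gt0// subr_le0//.
Qed.

Lemma ramp_ge t : x + e <= t -> ramp x e t = 1.
Proof. by move=> tx; apply: step_ge1; rewrite mulrC ler_pdivlMr// mul1r; lra. Qed.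

Lemma mollify_integral : \int[mu]_(t in `[x, x + e]) mollify x e t = 1.
Proof.
have E : derive1 (ramp x e) = mollify x e by apply/funext => t; have [] := ramp_derive x e t.
have xe : x < x + e by rewrite ltrDl.
rewrite -E C1_FTC//; last 1 first.
- by rewrite E; exact: mollify_continuous.
- by rewrite ramp_ge// ramp_le// subr0.
by move=> t; have [] := ramp_derive x e t.
Qed.

Lemma mollify_mean f eta : locint f -> 0 <= eta ->
  \int[mu]_(z in `[x, x + e]) `|f z - f x| <= eta * e ->
  `|\int[mu]_z (f z * mollify x e z) - f x| <= 6 * eta.
Proof.
move=> lf eta0 H; rewrite (@Rintegral_support _ _ x (x + e)); last first.
  by move=> z /mollify_out ->; rewrite mulr0.
have lm := bm_locint mollify_bm.
have lfx : locint (fun z => f z - f x) by apply: locintB => //; apply: bm_locint; exact: bm_cst.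
have -> : f x = \int[mu]_(z in `[x, x + e]) (f x * mollify x e z).
  by rewrite RintegralZ_locint// mollify_integral mulr1.
rewrite -RintegralB_locint; [|exact: (locintM_bm lf mollify_bm)|exact: (locintM_bm (bm_locint (bm_cst _)) mollify_bm)].
apply: (@le_trans _ _ (\int[mu]_(z in `[x, x + e]) `|f z * mollify x e z - f x * mollify x e z|)).
  apply: normr_Rintegral_locint; apply: locintB; [exact: (locintM_bm lf mollify_bm)|].
  exact: (locintM_bm (bm_locint (bm_cst _)) mollify_bm).
apply: (@le_trans _ _ (\int[mu]_(z in `[x, x + e]) (6 / e * `|f z - f x|))).
  apply: ler_Rintegral.
  - apply: locint_norm; apply: locintB; [exact: (locintM_bm lf mollify_bm)|].
    exact: (locintM_bm (bm_locint (bm_cst _)) mollify_bm).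
  - have := locintM_bm (locint_norm lfx) (bm_cst (6 / e)).
    by under [X in locint X -> _]eq_fun do rewrite mulrC.
  move=> z _; rewrite -mulrBl normrM mulrC ler_wpM2r//.
  by have /andP[m0 m6] := mollify_itv z; rewrite ger0_norm.
rewrite RintegralZ_locint; last exact: locint_norm.
have e6 : 0 <= 6 / e by rewrite divr_ge0// ltW.
apply: (le_trans (ler_wpM2l e6 H)).
by rewrite mulrAC [_ * (eta * e)]mulrC -mulrA mulrCA -mulrA mulfV ?gt_eqF// mulr1 mulrC.
Qed.

End PositiveWidth.

End SmoothStep.

Section WeakDerivative.
Context {R : realType}.
Notation mu := (@lebesgue_measure R).
Implicit Types (f g : R -> R) (a b x y e : R).

Lemma bm_ramp x e : bm (ramp x e).
Proof.
split.
  apply: continuous_measurable_fun => t; apply: differentiable_continuous.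
  by apply/derivable1_diffP; have [] := ramp_derive x e t.
by exists 1 => t; have /andP[h0 h1] := step_itv (e^-1 * (t - x)); rewrite ger0_norm.
Qed.

Lemma ramp_itv x e t : 0 <= ramp x e t <= 1.
Proof. exact: step_itv. Qed.

(** A C^1 approximation of the indicator function of [x, y]. *)
Definition plateau x y e t : R := ramp x e t - ramp y e t.

Lemma plateau_derive x y e t : derivable (plateau x y e) t 1 /\
  derive1 (plateau x y e) t = mollify x e t - mollify y e t.
Proof.
have [d1 E1] := ramp_derive x e t; have [d2 E2] := ramp_derive y e t.
split; first exact: (derivableB d1 d2).
by rewrite derive1E; have -> := deriveB d1 d2; rewrite -!derive1E E1 E2.
Qed.

Lemma plateau_test x y e : 0 < e -> test_function (plateau x y e).
Proof.
move=> e0; have E : derive1 (plateau x y e) = fun t => mollify x e t - mollify y e t.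
  by apply/funext => t; have [] := plateau_derive x y e t.
split.
- by move=> t; have [] := plateau_derive x y e t.
- by rewrite E => t; apply: cvgB; exact: mollify_continuous.
exists (`|x| + `|y| + e) => t.
have := normr_ge0 x; have := normr_ge0 y; have := ler_norm x; have := ler_norm y.
have := ler_norm (- x); have := ler_norm (- y); rewrite !normrN => y2 x2 y1 x1 y0 x0.
rewrite /plateau ltr_normr => /orP[tM|tM].
  by rewrite !ramp_ge ?subrr//; move: tM y1 x1 y0 x0 e0; lra.
by rewrite !ramp_le ?subrr//; move: tM y2 x2 y0 x0 e0; lra.
Qed.

Lemma locint_small g x b eta : locint g -> x < b -> 0 < eta ->
  exists2 r0, 0 < r0 & forall r, 0 <= r -> r < r0 -> \int[mu]_(z in `[x, x + r]) `|g z| <= eta.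
Proof.
move=> lg xb eta0.
have := parameterized_integral_near_left xb eta0 ((locint_norm lg).2 x b).
move=> [r0 /= r00 H]; exists r0 => // r r_0 rr.
have rb : ball_ (fun z : R => `|z|) x r0 (x + r).
  by rewrite /ball_/= opprD addrA subrr sub0r normrN ger0_norm.
have := H _ rb; rewrite lerDl => /(_ r_0) /ltW; apply: le_trans.
exact: ler_norm.
Qed.

(** Plateaus are test functions whose derivative is the difference of a
mollifier at [x] and one at [y]. As their width tends to zero the tested
integrals converge to [f x - f y], at Lebesgue points, and to the integral of
[g] over [x, y]. *)
Lemma weak_representation f g : locint f -> locint g ->
  (forall phi, test_function phi ->
    \int[mu]_z (f z * derive1 phi z) = - \int[mu]_z (g z * phi z)) ->
  forall x y, x < y -> lebesgue_pt f x -> lebesgue_pt f y ->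
  f y - f x = \int[mu]_(z in `[x, y]) g z.
Proof.
move=> lf lg fg x y xy fx fy; apply/eqP; rewrite -subr_eq0 -normr_le0.
apply/ler_addgt0Pr => eta' eta'0; rewrite add0r.
pose eta := eta' / 14; have eta0 : 0 < eta by rewrite divr_gt0.
have [r1 r10 H1] := lebesgue_pt_mean lf fx eta0.
have [r2 r20 H2] := lebesgue_pt_mean lf fy eta0.
have yy1 : y < y + 1 by rewrite ltrDl.
have [r3 r30 H3] := locint_small lg xy eta0.
have [r4 r40 H4] := locint_small lg yy1 eta0.
pose e := Num.min (Num.min (r1 / 2) (r2 / 2)) (Num.min (Num.min (r3 / 2) (r4 / 2)) (y - x)).
have e0 : 0 < e by rewrite !lt_min !divr_gt0// subr_gt0.
have [e1 [e2 [e3 [e4 e5]]]] : [/\ e <= r1 / 2, e <= r2 / 2, e <= r3 / 2 & (e <= r4 / 2) /\ (e <= y - x)].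
  by rewrite /e; split; rewrite ?ge_min ?lexx ?orbT//; split; rewrite ?ge_min ?lexx ?orbT.
have lt_half (r : R) : 0 < r -> e <= r / 2 -> e < r by lra.
have M1 := mollify_mean e0 lf (ltW eta0) (H1 e e0 (lt_half _ r10 e1)).
have M2 := mollify_mean e0 lf (ltW eta0) (H2 e e0 (lt_half _ r20 e2)).
have I3 := H3 e (ltW e0) (lt_half _ r30 e3); have I4 := H4 e (ltW e0) (lt_half _ r40 e4).
have := fg _ (plateau_test x y e0).
have lmx := locintM_bm lf (mollify_bm x e0); have lmy := locintM_bm lf (mollify_bm y e0).
have lgp : locint (fun z => g z * plateau x y e z).
  by apply: locintM_bm => //; exact: bmB (bm_ramp _ _) (bm_ramp _ _).
have xye : x <= y + e by rewrite (le_trans (ltW xy))// lerDl ltW.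
have -> : \int[mu]_z (f z * derive1 (plateau x y e) z) =
    \int[mu]_z (f z * mollify x e z) - \int[mu]_z (f z * mollify y e z).
  have sx : \int[mu]_z (f z * mollify x e z) = \int[mu]_(z in `[x, y + e]) (f z * mollify x e z).
    apply: Rintegral_support => z zxy; rewrite mollify_out ?mulr0//.
    by apply: contra zxy => /andP[h1 h2]; rewrite h1 (le_trans h2)// lerD2r ltW.
  have sy : \int[mu]_z (f z * mollify y e z) = \int[mu]_(z in `[x, y + e]) (f z * mollify y e z).
    apply: Rintegral_support => z zxy; rewrite mollify_out ?mulr0//.
    by apply: contra zxy => /andP[h1 h2]; rewrite h2 (le_trans _ h1)// ltW.
  rewrite sx sy -RintegralB_locint//.
  have Ez z : f z * derive1 (plateau x y e) z = f z * mollify x e z - f z * mollify y e z.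
    by have [_ ->] := plateau_derive x y e z; rewrite mulrBr.
  rewrite (@Rintegral_support _ _ x (y + e)).
    by apply: eq_Rintegral => z _; exact: Ez.
  move=> z zxy; rewrite Ez !mollify_out// ?mulr0 ?subrr//.
    by apply: contra zxy => /andP[h1 h2]; rewrite h2 (le_trans _ h1)// ltW.
  by apply: contra zxy => /andP[h1 h2]; rewrite h1 (le_trans h2)// lerD2r ltW.
have -> : \int[mu]_z (g z * plateau x y e z) = \int[mu]_(z in `[x, y + e]) (g z * plateau x y e z).
  apply: Rintegral_support => z; rewrite negb_and -!ltNge /plateau => /orP[zx|zy].
    by rewrite !ramp_le ?subrr ?mulr0// ?ltW// (lt_trans zx).
  rewrite !ramp_ge ?subrr ?mulr0//; first exact: ltW.
  by rewrite (le_trans _ (ltW zy))// lerD2r ltW.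
have xxe : x <= x + e by rewrite lerDl ltW.
have xey : x + e <= y by rewrite addrC -lerBrDr.
have yye : y <= y + e by rewrite lerDl ltW.
rewrite (Rintegral_split (ltW xy) yye (lgp.2 _ _)).
have J4 : `|\int[mu]_(z in `[y, y + e]) (g z * plateau x y e z)| <= eta.
  apply: le_trans I4; apply: (le_trans (normr_Rintegral_locint _ _ lgp)).
  apply: ler_Rintegral; [exact: locint_norm|exact: locint_norm|] => z /andP[yz _].
  rewrite normrM ler_piMr// /plateau ramp_ge ?(le_trans xey)//.
  by have /andP[h0 h1] := ramp_itv y e z; rewrite ger0_norm ?subr_ge0// lerBlDr lerDl.
have J3 : `|\int[mu]_(z in `[x, y]) (g z * plateau x y e z) - \int[mu]_(z in `[x, y]) g z| <= eta.
  have ld : locint (fun z => g z * plateau x y e z - g z) by exact: locintB.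
  rewrite -RintegralB_locint// (Rintegral_split xxe xey (ld.2 _ _)).
  have -> : \int[mu]_(z in `[x + e, y]) (g z * plateau x y e z - g z) = 0.
    rewrite -[RHS](mul0r (y - (x + e))) -(Rintegral_itv_cst 0 xey); apply: eq_Rintegral => z.
    rewrite inE/= in_itv/= => /andP[h1 h2].
    by rewrite /plateau ramp_ge// ramp_le// subr0 mulr1 subrr.
  rewrite addr0; apply: le_trans I3; apply: (le_trans (normr_Rintegral_locint _ _ ld)).
  apply: ler_Rintegral; [exact: locint_norm|exact: locint_norm|] => z /andP[xz zx].
  have -> : g z * plateau x y e z - g z = g z * (plateau x y e z - 1) by rewrite [RHS]mulrBr mulr1.
  rewrite normrM ler_piMr// /plateau (@ramp_le _ y e e0 z (le_trans zx xey)) subr0.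
  by have /andP[h0 h1] := ramp_itv x e z; rewrite distrC ger0_norm ?subr_ge0// lerBlDr lerDl.
have eE : eta' = 14 * eta by rewrite /eta mulrC divfK.
move: M1 M2 J3 J4; rewrite eE !ler_norml.
move: (\int[mu]_z (f z * mollify x e z)) (\int[mu]_z (f z * mollify y e z)) (f x) (f y) => A B C D.
move: (\int[mu]_(z in `[x, y]) (g z * plateau x y e z)) (\int[mu]_(z in `[x, y]) g z) => E G.
move: (\int[mu]_(z in `[y, y + e]) (g z * plateau x y e z)) => H.
move=> /andP[? ?] /andP[? ?] /andP[? ?] /andP[? ?] ?.
by apply/andP; split; lra.
Qed.

End WeakDerivative.

(** * The action of weakly differentiable curves *)

Section WeakCurves.
Context {R : realType} {N : nat}.
Notation mu := (@lebesgue_measure R).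
Implicit Types (U V G : R -> 'rV[R]_N) (x y a b : R).

Lemma L2loc_locint U i : L2loc U -> locint (fun x => U x 0 i).
Proof.
move=> [mU U2]; split; first exact: mU.
move=> a b; have m2 : measurable_fun setT (fun x => enorm (U x) ^+ 2).
  by apply: measurable_funX; exact: measurable_coord_enorm.
have i2 : mu.-integrable `[a, b] (EFin \o (fun x => enorm (U x) ^+ 2)).
  apply/integrableP; split; first by apply/measurable_EFinP; exact: measurable_funTS.
  apply: le_lt_trans (U2 a b); apply: le_integral_ge0 => x _ //.
  by rewrite lee_fin ger0_norm// sqr_ge0.
have i1 : mu.-integrable `[a, b] (EFin \o (fun=> 1 : R)).
  exact: bm_integrable (bm_cst 1).
have i12 : mu.-integrable `[a, b] (fun x => ((1 : R)%:E + (enorm (U x) ^+ 2)%:E)%E).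
  exact: (integrableD _ i1 i2).
apply: le_integrable i12 => //; first by apply/measurable_EFinP; exact: (measurable_funTS (mU i)).
move=> x _; rewrite /= lee_fin.
have := coord_le_enorm (U x) i; have := enorm_ge0 (U x); move: (enorm (U x)) => E E0 h.
have e2 : 0 <= E ^+ 2 by exact: sqr_ge0.
rewrite [leRHS]ger0_norm ?addr_ge0//; apply: (le_trans h).
by have := sqr_ge0 (E - 1); rewrite sqrrB mulr1 expr1n -mulr_natr; lra.
Qed.

Definition regular_pt U x := forall i, lebesgue_pt (fun t => U t 0 i) x.

Lemma ae_regular_pt U : L2loc U -> {ae mu, forall x, regular_pt U x}.
Proof.
move=> U2.
have : {ae mu, forall x, forall k : nat, forall i : 'I_N, i = k :> nat -> lebesgue_pt (fun t => U t 0 i) x}.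
  apply: ae_foralln => k; have [kN|Nk] := ltnP k N; last first.
    by apply: aeW => x i ik; move: Nk; rewrite -ik leqNgt ltn_ord.
  have := lebesgue_differentiation (locint_locally_integrable (L2loc_locint (Ordinal kN) U2)).
  by apply: aeS => x hx i ik; have -> : i = Ordinal kN by exact: val_inj.
by apply: aeS => x hx i; exact: (hx i i erefl).
Qed.

Lemma ae_between (P : R -> Prop) a b : a < b -> {ae mu, forall x, P x} -> exists2 x, a < x < b & P x.
Proof.
move=> ab [A [mA A0 PA]]; apply: contrapT => nP.
have sub : `]a, b[%classic `<=` A.
  move=> x; rewrite /= in_itv/= => xab; apply: PA => /= Px; apply: nP; by exists x.
have : (mu `]a, b[%classic <= mu A)%E by apply: le_measure; rewrite ?inE.
rewrite A0 lebesgue_measure_itv/= lte_fin ab -EFinD lee_fin leNgt subr_gt0.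
by rewrite ab.
Qed.

Lemma weak_increment V G x y i : L2loc V -> L2loc G -> is_weak_derivative V G ->
  x < y -> regular_pt V x -> regular_pt V y ->
  V y 0 i - V x 0 i = \int[mu]_(z in `[x, y]) G z 0 i.
Proof.
move=> V2 G2 VG xy Vx Vy.
have H phi (tphi : test_function phi) := VG phi tphi i.
exact: (weak_representation (L2loc_locint i V2) (L2loc_locint i G2) H xy (Vx i) (Vy i)).
Qed.

(** The primitive of the weak derivative is an absolutely continuous curve that
agrees with [V] almost everywhere. *)
Lemma weak_acurve V G x y : L2loc V -> L2loc G -> is_weak_derivative V G ->
  x < y -> regular_pt V x -> regular_pt V y ->
  exists Vt : R -> 'rV[R]_N, [/\ {within `[x, y], continuous Vt}, acurve Vt G x y,
    Vt x = V x, Vt y = V y & {ae mu, forall z, x < z < y -> Vt z = V z}].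
Proof.
move=> V2 G2 VG xy Vx Vy.
have lG i := L2loc_locint i G2.
pose Vt z := \row_i (V x 0 i + \int[mu]_(t in `[x, z]) G t 0 i).
have E z : x < z -> regular_pt V z -> Vt z = V z.
  move=> xz Vz; apply/rowP => i; rewrite mxE -(weak_increment i V2 G2 VG xz Vx Vz).
  by rewrite addrC subrK.
exists Vt; split.
- move=> z; apply: cvg_coords => i.
  rewrite mxE (_ : (fun z => Vt z 0 i) = (fun z => V x 0 i + \int[mu]_(t in `[x, z]) G t 0 i)); last first.
    by apply/funext => t; rewrite mxE.
  apply: cvgD; first exact: cvg_cst.
  exact: (@parameterized_integral_continuous _ x y _ (ltW xy) ((lG i).2 x y)).
- move=> i; split; first exact: (lG i).2.
  move=> u v xu uv vy; rewrite !mxE (Rintegral_split xu uv ((lG i).2 _ _)).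
  by move: (V x 0 i) (\int[mu]_(t in `[x, u]) _) => *; ring.
- by apply/rowP => i; rewrite mxE set_itv1 Rintegral_set1 addr0.
- exact: E.
- by apply: aeS (ae_regular_pt V2) => z Vz /andP[xz _]; exact: E.
Qed.

Lemma continuous_L2loc U : continuous U -> L2loc U.
Proof.
move=> cU; have cUi i : continuous (fun x => U x 0 i) by move=> x; apply: cvg_coord; exact: cU.
split; first by move=> i; apply: continuous_measurable_fun.
move=> a b; have c2 : continuous (fun x => enorm (U x) ^+ 2).
  move=> x; apply: (@continuous_comp _ _ _ (fun x => enorm (U x)) (fun u => u ^+ 2)).
    by apply: (@continuous_comp _ _ _ U (@enorm R N)); [exact: cU|exact: continuous_enorm].
  exact: exprn_continuous.
have /integrableP[_] := (continuous_locint c2).2 a b.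
by under eq_integral do rewrite /= ger0_norm ?sqr_ge0//.
Qed.

Lemma C1_weak_derivative U : (forall x, derivable U x 1) -> continuous (derive1 U) ->
  is_weak_derivative U (derive1 U).
Proof.
move=> dU cdU phi [dphi cphi [M phiM]] i.
have dUi x := derivable_coord i (dU x).
have cUi : continuous (derive1 (fun x => U x 0 i)).
  rewrite (_ : derive1 (fun x => U x 0 i) = fun x => derive1 U x 0 i); last first.
    by apply/funext => x; have [] := dUi x.
  by move=> x; apply: cvg_coord; exact: cdU.
have cont (f : R -> R) : (forall x, derivable f x 1) -> continuous f.
  by move=> df x; apply: differentiable_continuous; apply/derivable1_diffP.
pose h x := U x 0 i * phi x.
have dh x : derivable h x 1 /\ derive1 h x = U x 0 i * derive1 phi x + derive1 U x 0 i * phi x.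
  have [d1 E1] := dUi x; split; first exact: (derivableM d1 (dphi x)).
  rewrite derive1E; have -> := deriveM d1 (dphi x).
  by rewrite -!derive1E E1 /GRing.scale/= [phi x * _]mulrC.
pose b := `|M| + 1; pose a := - b.
have ab : a < b by rewrite /a /b; have := normr_ge0 M; lra.
have Mb : M < b by rewrite /b ltr_pwDr// ler_norm.
have out x : ~~ (a <= x <= b) -> M < `|x|.
  by rewrite /a -ler_norml -ltNge; exact: lt_trans.
have dphi0 x : ~~ (a <= x <= b) -> derive1 phi x = 0.
  move=> xab; have E : \forall y \near x, phi y = cst (0 : R) y.
    have : \forall y \near x, M < `|y|.
      have : `|y| @[y --> x] --> `|x| by exact: norm_continuous.
      by move=> /(_ [set u | M < u]); apply; apply: open_nbhs_nbhs; split; [exact: open_gt|exact: out].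
    by apply: filterS => y /phiM.
  have [_ ->] := derivable_near E (derivable_cst 0 x 1).
  by rewrite derive1E derive_cst.
rewrite (@Rintegral_support _ _ a b); last by move=> x xab; rewrite dphi0// mulr0.
rewrite (@Rintegral_support _ (fun x => derive1 U x 0 i * phi x) a b); last first.
  by move=> x xab; rewrite phiM ?mulr0//; exact: out.
have c1 : continuous (fun x => U x 0 i * derive1 phi x).
  by move=> x; apply: cvgM; [apply: (cont _ (fun x => (dUi x).1))|exact: cphi].
have c2 : continuous (fun x => derive1 U x 0 i * phi x).
  move=> x; apply: (cvgM (_ : derive1 U z 0 i @[z --> x] --> derive1 U x 0 i) (cont _ dphi x)).
  by apply: cvg_coord; exact: cdU.
have dhE : derive1 h = fun x => U x 0 i * derive1 phi x + derive1 U x 0 i * phi x.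
  by apply/funext => x; have [] := dh x.
have cdh : continuous (derive1 h) by rewrite dhE => x; apply: cvgD; [exact: c1|exact: c2].
have := C1_FTC (fun x => (dh x).1) cdh ab; rewrite dhE.
rewrite RintegralD//; [|exact: (continuous_locint c1).2|exact: (continuous_locint c2).2].
have hb : h b = 0.
  rewrite /h phiM ?mulr0//; by rewrite ger0_norm// /b addr_ge0.
have ha : h a = 0.
  by rewrite /h phiM ?mulr0// /a normrN ger0_norm// /b addr_ge0.
by rewrite ha hb subrr => /eqP; rewrite addr_eq0 => /eqP.
Qed.

Lemma C1_H1loc U : (forall x, derivable U x 1) -> continuous (derive1 U) -> H1loc U.
Proof.
move=> dU cdU; have cU : continuous U.
  by move=> x; apply: differentiable_continuous; apply/derivable1_diffP.
split; first exact: continuous_L2loc.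
by exists (derive1 U); split; [exact: continuous_L2loc|exact: C1_weak_derivative].
Qed.

(** At almost every [x] the difference quotients of [U] are means of [G] over
small intervals, which converge to [G x]. *)
Lemma weak_derivative_C1 U G : (forall x, derivable U x 1) -> continuous (derive1 U) ->
  L2loc G -> is_weak_derivative U G -> {ae mu, forall x, G x = derive1 U x}.
Proof.
move=> dU cdU G2 UG.
have cU : continuous U by move=> x; apply: differentiable_continuous; apply/derivable1_diffP.
have U2 := continuous_L2loc cU.
have rU := ae_regular_pt U2.
have rU' := rU; apply: aeS2 rU' (ae_regular_pt G2) => x Ux Gx; apply/rowP => i.
apply/eqP; rewrite -subr_eq0 -normr_le0; apply/ler_addgt0Pr => e' e'0; rewrite add0r.
pose e := e' / 2; have e0 : 0 < e by rewrite divr_gt0.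
have lG := L2loc_locint i G2.
have [r1 r10 H1] := lebesgue_pt_mean lG (Gx i) e0.
have [dUi dUE] := derivable_coord i (dU x).
have : \forall h \near 0^', `|derive1 U x 0 i - h^-1 * (U (h + x) 0 i - U x 0 i)| < e.
  by have := derive1_cvg dUi; rewrite dUE => /cvgrPdist_lt /(_ e e0).
move=> [r2 /= r20 H2].
have xr : x < x + Num.min r1 r2 by rewrite ltrDl lt_min r10.
have [y /andP[xy]] := ae_between xr rU; rewrite -ltrBlDl lt_min => /andP[yr1 yr2] Uy.
pose r := y - x; have rp : 0 < r by rewrite subr_gt0.
have rb : ball_ (fun z : R => `|z|) 0 r2 r by rewrite /ball_/= sub0r normrN gtr0_norm.
have rn0 : r != 0 by rewrite gt_eqF.
have := H2 r rb rn0; have rx : r + x = y by rewrite subrK.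
rewrite rx (weak_increment i U2 G2 UG xy Ux Uy) => D1.
have := H1 r rp yr1; rewrite addrC rx => D2.
have lGx : locint (fun z => G z 0 i - G x 0 i) by apply: locintB => //; apply: bm_locint; exact: bm_cst.
have := le_trans (normr_Rintegral_locint x y lGx) D2.
rewrite RintegralB_locint//; last by apply: bm_locint; exact: bm_cst.
rewrite Rintegral_itv_cst ?(ltW xy)// -/r => D3.
move: rp rn0 D1 D3; clear H1 H2 D2 yr1 yr2 rb; clearbody r; clear rx.
move=> rp rn0; move: (\int[mu]_(z in `[x, y]) _) (derive1 U x 0 i) (G x 0 i) => I A B.
have -> : I - B * r = r * (r^-1 * I - B) by rewrite mulrBr mulrA mulfV// mul1r mulrC.
rewrite normrM (gtr0_norm rp) [e * r]mulrC ler_pM2l//.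
have eE : e' = 2 * e by rewrite /e mulrC divfK.
rewrite eE; move: (r^-1 * I) => J; rewrite ltr_norml !ler_norml => /andP[? ?] /andP[? ?].
by apply/andP; split; lra.
Qed.

End WeakCurves.

Section Energy.
Context {R : realType} {N : nat}.
Variable W : 'rV[R]_N -> R.
Hypotheses (Wcont : continuous W) (W0 : forall q, 0 <= W q).
Notation mu := (@lebesgue_measure R).
Notation d := (dr W).
Implicit Types (U V G : R -> 'rV[R]_N) (p q : 'rV[R]_N) (x y a b : R).

(** Young's inequality [sqrt 2 * F * g <= g^2 / 2 + F^2], integrated along the
continuous representative of [V]. *)
Lemma weak_energy_lower V G x y : L2loc V -> L2loc G -> is_weak_derivative V G ->
  x < y -> regular_pt V x -> regular_pt V y ->
  ((Num.sqrt 2 * d (V x) (V y))%:E <=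
     \int[mu]_(t in `[x, y]) (2^-1 * enorm (G t) ^+ 2 + W (V t))%:E)%E.
Proof.
move=> V2 G2 VG xy Vx Vy; have [Vt [cVt aVt Vtx Vty VtV]] := weak_acurve V2 G2 VG xy Vx Vy.
have := dr_le_acurve Wcont (ltW xy) cVt aVt; rewrite Vtx Vty => dV.
have s20 : 0 <= Num.sqrt 2 :> R by exact: sqrtr_ge0.
have s2s : Num.sqrt 2 ^+ 2 = 2 :> R by rewrite sqr_sqrtr.
have cF : {within `[x, y], continuous (F W \o Vt)}.
  by move=> z; apply: cvg_comp; [exact: cVt|exact: F_continuous].
have mFG : measurable_fun `[x, y] (fun t => (F W (Vt t) * enorm (G t))%:E).
  apply/measurable_EFinP; apply: measurable_funM.
    exact: (subspace_continuous_measurable_fun (measurable_itv _) cF).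
  apply: measurable_funTS; apply: measurable_coord_enorm; exact: G2.1.
have FG0 (v : 'rV[R]_N) t : 0 <= F W v * enorm (G t) by rewrite mulr_ge0 ?F_ge0 ?enorm_ge0.
apply: (@le_trans _ _ ((Num.sqrt 2)%:E * (\int[mu]_(t in `[x, y]) (F W (Vt t) * enorm (G t))%:E))%E).
  by rewrite EFinM; apply: lee_wpmul2l.
rewrite -ge0_integralZl_EFin//; last by move=> t _; rewrite lee_fin.
rewrite (@ae_eq_integral_ge0 _ _ (fun t => ((Num.sqrt 2)%:E * (F W (Vt t) * enorm (G t))%:E)%E)
  (fun t => ((Num.sqrt 2)%:E * (F W (V t) * enorm (G t))%:E)%E))//; last first.
- apply: aeS3 VtV (ae_neq x) (ae_neq y) => t Vtt tx ty; rewrite /= in_itv/= => /andP[xt ty'].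
  by rewrite Vtt// !lt_neqAle xt ty' ty eq_sym tx.
- by move=> t _; rewrite -EFinM lee_fin mulr_ge0.
- by move=> t _; rewrite -EFinM lee_fin mulr_ge0.
apply: le_integral_ge0 => t _; first by rewrite -EFinM lee_fin mulr_ge0.
rewrite -EFinM lee_fin -(F_sqr W0 (V t)); move: (F W (V t)) (enorm (G t)) => A B.
have : 0 <= (Num.sqrt 2 * A - B) ^+ 2 by exact: sqr_ge0.
have -> : (Num.sqrt 2 * A - B) ^+ 2 = Num.sqrt 2 ^+ 2 * A ^+ 2 - 2 * (Num.sqrt 2 * (A * B)) + B ^+ 2 by ring.
rewrite s2s; move: (A ^+ 2) (B ^+ 2) (Num.sqrt 2 * (A * B)) => A2 B2 P.
by lra.
Qed.

Lemma connects_near p q U e : 0 < e -> connects p q U ->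
  (exists M, forall x, x < M -> enorm (U x - p) < e) /\
  (exists M, forall x, M < x -> enorm (U x - q) < e).
Proof.
move=> e0 [Up Uq]; split.
  by have [M [_ H]] := Up _ (near_enorm p e0); exists M.
by have [M [_ H]] := Uq _ (near_enorm q e0); exists M.
Qed.

Lemma weak_derivativeP V : H1loc V -> L2loc (weak_derivative V) /\ is_weak_derivative V (weak_derivative V).
Proof. by move=> [_ V1]; exact: (xgetPex (fun=> 0) V1). Qed.

(** Far to the left and to the right there are Lebesgue points at which [V] is
close to [p] and to [q], and [d] is continuous. *)
Lemma Hfun_lower p q V : H1loc V -> connects p q V -> ((Num.sqrt 2 * d p q)%:E <= Hfun W V)%E.
Proof.
move=> HV Vpq; have [G2 VG] := weak_derivativeP HV; have [V2 _] := HV.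
have s20 : 0 < Num.sqrt 2 :> R by rewrite sqrtr_gt0.
apply/lee_addgt0Pr => e' e'0; pose e := e' / (2 * Num.sqrt 2).
have e0 : 0 < e by rewrite divr_gt0// mulr_gt0.
have [r1 r10 H1] := dr_near Wcont p e0; have [r2 r20 H2] := dr_near Wcont q e0.
have [[M1 P1] _] := connects_near r10 Vpq; have [_ [M2 P2]] := connects_near r20 Vpq.
have rV := ae_regular_pt V2.
have l1 : M1 - 1 < M1 by rewrite ltrBlDr ltrDl.
have [x /andP[_ xM1] Vx] := ae_between l1 rV.
have l2 : Num.max x M2 < Num.max x M2 + 1 by rewrite ltrDl.
have [y] := ae_between l2 rV; rewrite gt_max => /andP[/andP[xy M2y] _] Vy.
have dE : d p q <= d (V x) (V y) + 2 * e.
  have := dr_triangle Wcont (V x) p q; have := dr_triangle Wcont (V y) (V x) q.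
  have [a1 _] := H1 _ (P1 x xM1); have [_ a2] := H2 _ (P2 y M2y).
  by move: a1 a2; lra.
apply: (@le_trans _ _ ((Num.sqrt 2 * d (V x) (V y))%:E + e'%:E)%E).
  rewrite -EFinD lee_fin; apply: (le_trans (ler_wpM2l (ltW s20) dE)).
  rewrite mulrDr lerD2l /e mulrCA [leLHS]mulrA.
  by rewrite mulrC divfK// mulf_neq0// gt_eqF.
apply: leeD => //; apply: (le_trans (weak_energy_lower V2 G2 VG xy Vx Vy)).
rewrite /Hfun integral_mkcond; apply: le_integral_ge0 => t _; rewrite patchE; case: ifPn => // _;
  by rewrite lee_fin addr_ge0// mulr_ge0// sqr_ge0.
Qed.

(** If [|U'| = sqrt 2 * F U], the density of the action is [2 W U], that is
[sqrt 2] times the derivative of [sigma], and [sigma] increases by at most [d p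
q]. *)
Lemma Hfun_upper p q U (sigma : R -> R) : continuous U -> (forall x, derivable U x 1) ->
  continuous (derive1 U) ->
  (forall s t, s <= t -> d (U s) (U t) = sigma t - sigma s) ->
  (forall x, derivable sigma x 1 /\ derive1 sigma x = Num.sqrt 2 * W (U x)) ->
  (forall x, enorm (derive1 U x) = Num.sqrt 2 * F W (U x)) ->
  connects p q U -> (Hfun W U <= (Num.sqrt 2 * d p q)%:E)%E.
Proof.
move=> cU dU cdU cd dsig speed Upq.
have s20 : 0 < Num.sqrt 2 :> R by rewrite sqrtr_gt0.
have s2s : Num.sqrt 2 * Num.sqrt 2 = 2 :> R by rewrite -expr2 sqr_sqrtr.
have UH := C1_H1loc dU cdU.
have [G2 UG] := weak_derivativeP UH.
have cW : continuous (fun x => W (U x)).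
  by move=> x; apply: (@continuous_comp _ _ _ U W); [exact: cU|exact: Wcont].
have sE : derive1 sigma = fun x => Num.sqrt 2 * W (U x) by apply/funext => x; have [] := dsig x.
have csig : continuous (derive1 sigma).
  by rewrite sE => x; apply: cvgM; [exact: cvg_cst|exact: cW].
have -> : Hfun W U = (\int[mu]_x (2 * W (U x))%:E)%E.
  apply: ae_eq_integral_ge0 => //.
  - by move=> x _; rewrite lee_fin addr_ge0// mulr_ge0// sqr_ge0.
  - by move=> x _; rewrite lee_fin mulr_ge0.
  apply: aeS (weak_derivative_C1 dU cdU G2 UG) => x -> _; congr EFin.
  rewrite speed exprMn [Num.sqrt 2 ^+ 2]expr2 s2s F_sqr// mulrA mulVf// mul1r.
  by rewrite mulr_natl mulr2n.
have mono s t s' t' : s' <= s -> s <= t -> t <= t' -> d (U s) (U t) <= d (U s') (U t').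
  move=> ss st tt; rewrite (cd s t st) (cd s' t' (le_trans ss (le_trans st tt))).
  have := dr_ge0 Wcont (U s') (U s); have := dr_ge0 Wcont (U t) (U t').
  by rewrite (cd _ _ ss) (cd _ _ tt); lra.
have bound s t : s <= t -> d (U s) (U t) <= d p q.
  move=> st; apply/ler_addgt0Pr => e' e'0; pose e := e' / 2.
  have e0 : 0 < e by rewrite divr_gt0.
  have [r1 r10 H1] := dr_near Wcont p e0; have [r2 r20 H2] := dr_near Wcont q e0.
  have [[M1 P1] _] := connects_near r10 Upq; have [_ [M2 P2]] := connects_near r20 Upq.
  pose x := Num.min s (M1 - 1); pose y := Num.max t (M2 + 1).
  have xM : x < M1 by rewrite /x gt_min; apply/orP; right; lra.
  have My : M2 < y by rewrite /y lt_max; apply/orP; right; lra.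
  have xs : x <= s by rewrite ge_min lexx.
  have ty : t <= y by rewrite le_max lexx.
  apply: (le_trans (mono _ _ _ _ xs st ty)).
  have := dr_triangle Wcont p (U x) (U y); have := dr_triangle Wcont q p (U y).
  have [_ a1] := H1 _ (P1 x xM); have [a2 _] := H2 _ (P2 y My).
  have -> : e' = 2 * e by rewrite /e mulrC divfK.
  by move: a1 a2; lra.
pose D (n : nat) : set R := `[- n%:R, n%:R]%classic.
have UD : \bigcup_n D n = setT.
  apply/seteqP; split => // x _; have [n xn] : exists n : nat, `|x| <= n%:R.
    by exists (Num.bound `|x|); apply: ltW; exact: archi_boundP.
  by exists n => //; rewrite /D/= in_itv/= -ler_norml.
have cvg : (\int[mu]_(x in D i) (2 * W (U x))%:E @[i --> \oo] --> \int[mu]_x (2 * W (U x))%:E)%E.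
  rewrite -UD; apply: ge0_nondecreasing_set_cvg_integral.
  - move=> i j ij; rewrite subsetEset; apply: subset_itv; rewrite bnd_simp ?lerN2 ler_nat//.
  - by move=> i; exact: measurable_itv.
  - move=> i; apply/measurable_EFinP; apply: measurable_funTS; apply: continuous_measurable_fun.
    by move=> x; apply: cvgM; [exact: cvg_cst|exact: cW].
  - by move=> i x _; rewrite lee_fin mulr_ge0.
rewrite -(cvg_lim _ cvg)//; apply: lime_le; first by apply/cvg_ex; eexists; exact: cvg.
near=> n.
have n0 : (- n%:R : R) < n%:R.
  by rewrite -subr_gt0 opprK addr_gt0// ltr0n; near: n; exists 1%N.
have FT := C1_FTC (fun x => (dsig x).1) csig n0.
have l2 : locint (fun x => 2 * W (U x)).
  by apply: continuous_locint => x; apply: cvgM; [exact: cvg_cst|exact: cW].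
have -> : (\int[mu]_(x in D n) (2 * W (U x))%:E = (\int[mu]_(x in D n) (2 * W (U x)))%:E)%E.
  by rewrite /Rintegral fineK//; apply: integrable_fin_num; [exact: measurable_itv|exact: (l2.2 (- n%:R) n%:R)].
rewrite lee_fin.
have -> : \int[mu]_(x in D n) (2 * W (U x)) = Num.sqrt 2 * \int[mu]_(x in D n) derive1 sigma x.
  rewrite -RintegralZ_locint; last exact: continuous_locint.
  by apply: eq_Rintegral => x _; rewrite sE mulrA s2s.
by rewrite ler_pM2l// FT -cd ?(ltW n0)//; exact: bound (ltW n0).
Unshelve. all: by end_near. Qed.

End Energy.

(** * The equipartition time runs over the whole line *)

Section Gronwall.
Context {R : realType} {N : nat}.

(** The function [f u * expR (k * u)] is nondecreasing. *)
Lemma exp_gronwall (f : R -> R) (k x y : R) : x <= y ->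
  (forall u, x <= u <= y -> derivable f u 1) ->
  (forall u, x <= u <= y -> 0 <= derive1 f u + k * f u) ->
  f x <= f y * expR (k * (y - x)).
Proof.
rewrite le_eqVlt => /predU1P[->|xy] df f'; first by rewrite subrr mulr0 expR0 mulr1.
pose psi u := f u * expR (k * u).
have dpsi u : x <= u <= y -> is_derive u (1 : R) psi ((derive1 f u + k * f u) * expR (k * u)).
  move=> uxy; have d1 : is_derive u 1 f (derive1 f u) by rewrite derive1E; exact/derivableP/df.
  have d0 : is_derive u 1 (fun u => k * u) k.
    have -> : (fun u => k * u) = k *: id by [].
    by apply: is_derive_eq; rewrite /GRing.scale/= mulr1.
  have d2 : is_derive u 1 (fun u => expR (k * u)) (expR (k * u) * k).
    exact: (@is_derive1_comp _ (@expR R) (fun u => k * u) u _ _ (is_derive_expR _) d0).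
  have -> : psi = f * (fun u => expR (k * u)) by [].
  by apply: is_derive_eq; rewrite /GRing.scale/=; ring.
have isd u : u \in `]x, y[%R -> is_derive u (1 : R) psi ((derive1 f u + k * f u) * expR (k * u)).
  by rewrite in_itv/= => /andP[xu uy]; apply: dpsi; rewrite !ltW.
have cpsi : {within `[x, y], continuous psi}.
  by apply: derivable_within_continuous => u; rewrite in_itv/= => /dpsi du; exact: ex_derive.
have [u] := MVT xy isd cpsi; rewrite in_itv/= => /andP[xu uy] E.
have : psi x <= psi y.
  rewrite -subr_ge0 E; apply: mulr_ge0; last by rewrite subr_ge0 ltW.
  by apply: mulr_ge0; [apply: f'; rewrite !ltW|exact: expR_ge0].
rewrite /psi -ler_pdivlMr ?expR_gt0// -expRN -mulrA -expRD => /le_trans; apply.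
by rewrite mulrBr.
Qed.

Lemma derive_sqr_enorm (U : R -> 'rV[R]_N) (z : 'rV[R]_N) u : derivable U u 1 ->
  derivable (fun s => enorm (U s - z) ^+ 2) u 1 /\
  derive1 (fun s => enorm (U s - z) ^+ 2) u = 2 * dot (U u - z) (derive1 U u).
Proof.
move=> dU.
have di i : is_derive u 1 (fun s => (U s 0 i - z 0 i) * (U s 0 i - z 0 i))
    (2 * ((U u 0 i - z 0 i) * derive1 U u 0 i)).
  have [d1 E1] := derivable_coord i dU.
  have d0 : is_derive u 1 (fun s => U s 0 i) (derive1 U u 0 i) by rewrite -E1 derive1E; exact/derivableP.
  pose g := (fun s => U s 0 i) - cst (z 0 i).
  have dg : is_derive u 1 g (derive1 U u 0 i).
    by apply: is_derive_eq; rewrite subr0.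
  have -> : (fun s => (U s 0 i - z 0 i) * (U s 0 i - z 0 i)) = g * g by [].
  by apply: is_derive_eq; rewrite /g !fctE /GRing.scale/=; ring.
have E : (fun s => enorm (U s - z) ^+ 2) = \sum_i (fun s => (U s 0 i - z 0 i) * (U s 0 i - z 0 i)).
  apply/funext => s; rewrite sqr_enorm fct_sumE; apply: eq_bigr => i _.
  by rewrite !mxE.
have D : is_derive u 1 (fun s => enorm (U s - z) ^+ 2) (\sum_i (2 * ((U u 0 i - z 0 i) * derive1 U u 0 i))).
  by rewrite E; exact: is_derive_sum.
split; first exact: ex_derive.
rewrite derive1E; have -> := derive_val; rewrite -mulr_sumr; congr (_ * _).
by apply: eq_bigr => i _; rewrite !mxE.
Qed.

Lemma enorm_gronwall (U : R -> 'rV[R]_N) (z : 'rV[R]_N) (K x y : R) : x <= y -> 0 <= K ->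
  (forall u, x <= u <= y -> derivable U u 1 /\ enorm (derive1 U u) <= K * enorm (U u - z)) ->
  enorm (U x - z) ^+ 2 <= enorm (U y - z) ^+ 2 * expR (2 * K * (y - x)) /\
  enorm (U y - z) ^+ 2 <= enorm (U x - z) ^+ 2 * expR (2 * K * (y - x)).
Proof.
move=> xy K0 H.
pose f s := enorm (U s - z) ^+ 2.
have Hf u : x <= u <= y -> derivable f u 1 /\ `|derive1 f u| <= 2 * K * f u.
  move=> /H [dU UK]; have [d1 E1] := derive_sqr_enorm z dU; split; first exact: d1.
  rewrite /f E1 normrM (ger0_norm (_ : 0 <= 2 :> R))// -mulrA ler_wpM2l// ler_norml lerNl -dotNl.
  have b (v : 'rV[R]_N) : enorm v = enorm (U u - z) -> dot v (derive1 U u) <= K * enorm (U u - z) ^+ 2.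
    move=> vE; apply: (le_trans (dot_le _ _)); rewrite vE expr2 mulrCA ler_wpM2l ?enorm_ge0//.
  by rewrite !b ?enormN.
split.
  apply: (@exp_gronwall f) => // u /Hf[// _]; rewrite ler_norml => /andP[h _].
  by rewrite -lerBlDr sub0r.
have := @exp_gronwall (fun s => - f s) (- (2 * K)) x y xy.
have dN u : x <= u <= y -> derivable (fun s => - f s) u 1 /\ derive1 (fun s => - f s) u = - derive1 f u.
  move=> /Hf [df _]; split; first exact: (derivableN df).
  by rewrite derive1E; have -> := deriveN df; rewrite -derive1E.
move=> /(_ (fun u h => (dN u h).1)) G.
have {}G : - f x <= - f y * expR (- (2 * K) * (y - x)).
  apply: G => u uxy; have [_ ->] := dN u uxy; have [_] := Hf u uxy.
  by rewrite ler_norml mulrNN => /andP[_ h]; rewrite addrC subr_ge0.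
by rewrite mulNr lerN2 mulNr expRN ler_pdivrMr ?expR_gt0// in G.
Qed.

End Gronwall.

Section LineArc.
Context {R : realType} {N : nat}.
Variables (W : 'rV[R]_N -> R) (alpha : R).
Hypotheses (Wcont : continuous W) (W0 : forall q, 0 <= W q).
Hypothesis a01 : 0 < alpha < 1.
Hypothesis Wreg : C1alpha_loc alpha (~` zero_set W) W.
Notation d := (dr W).

(** The arc attains the lower bound [sqrt 2 * d p q] for the action of all
competitors. *)
Lemma line_heteroclinic (p q : 'rV[R]_N) (U : R -> 'rV[R]_N) (sigma : R -> R) : continuous U ->
  (forall s t, s <= t -> d (U s) (U t) = sigma t - sigma s) ->
  (forall x, derivable sigma x 1 /\ derive1 sigma x = Num.sqrt 2 * W (U x)) ->
  (forall x, W (U x) != 0) -> connects p q U -> minimizing_heteroclinic W p q U.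
Proof.
move=> cU cd dsig Wn0 Upq.
have ode x : [/\ derivable U x 1, derivable (derive1 U) x 1,
    derive1 (derive1 U) x = gradient W (U x) & enorm (derive1 U x) = Num.sqrt 2 * F W (U x)].
  have xx : x - 1 < x < x + 1 by rewrite ltrBlDr !ltrDl ltr01.
  apply: (arc_ode Wcont W0 a01 Wreg xx (sigma := sigma)) => [y _|s t _ st _|y _|].
  - exact: cU.
  - exact: cd.
  - exact: dsig.
  - exact: Wn0.
have dU x : derivable U x 1 by have [] := ode x.
have cdU : continuous (derive1 U).
  by move=> x; apply: differentiable_continuous; apply/derivable1_diffP; have [] := ode x.
have speed x : enorm (derive1 U x) = Num.sqrt 2 * F W (U x) by have [] := ode x.
split => //.
- by move=> x; have [d1 d2 E _] := ode x; split => //; rewrite E subrr.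
- exact: C1_H1loc dU cdU.
move=> V HV Vpq; apply: (le_trans (Hfun_upper Wcont W0 cU dU cdU cd dsig speed Upq)).
exact: Hfun_lower.
Qed.

End LineArc.

Section Equipartition.
Context {R : realType} {N : nat}.
Variables (W : 'rV[R]_N -> R) (alpha : R).
Hypotheses (Wcont : continuous W) (W0 : forall q, 0 <= W q).
Hypothesis a01 : 0 < alpha < 1.
Hypothesis Wreg : C1alpha_loc alpha (~` zero_set W) W.
Notation d := (dr W).
Notation mu := (@lebesgue_measure R).

Definition quadratic_at (z : 'rV[R]_N) := exists C delta : R, [/\ 0 < C, 0 < delta &
  forall y, enorm (y - z) < delta -> W y <= C * enorm (y - z) ^+ 2].

Variables (p q : 'rV[R]_N) (c : R -> 'rV[R]_N) (rho f : R -> R).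
Hypotheses (qp : quadratic_at p) (qq : quadratic_at q) (Wp : W p = 0) (Wq : W q = 0).
Hypothesis cc : {within `[0, 1], continuous c}.
Hypotheses (c0 : c 0 = p) (c1 : c 1 = q).
Hypothesis cW : forall s, 0 < s < 1 -> W (c s) != 0.
Hypothesis cd : forall s t, 0 <= s -> s <= t -> t <= 1 -> d (c s) (c t) = rho t - rho s.
Hypothesis fc : forall s, 0 < s < 1 -> {for s, continuous f}.
Hypothesis f0 : forall s, 0 < s < 1 -> 0 < f s.
Hypothesis drho : forall s, 0 < s < 1 ->
  derivable rho s 1 /\ derive1 rho s = Num.sqrt 2 * W (c s) * f s.

Let X := oriented f 2^-1.

Let half01 : 0 < (2^-1 : R) < 1.
Proof. by apply/andP; split; lra. Qed.

Let dX s : 0 < s < 1 -> derivable X s 1 /\ derive1 X s = f s.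
Proof. by move=> s01; exact: (oriented_derive fc half01 s01). Qed.

Let Xcont s : 0 < s < 1 -> {for s, continuous X}.
Proof. by move=> /dX[ds _]; apply: differentiable_continuous; exact/derivable1_diffP. Qed.

Let Xwithin s t : 0 < s -> t < 1 -> {within `[s, t], continuous X}.
Proof.
move=> s0 t1; apply: derivable_within_continuous => u; rewrite in_itv/= => /andP[su ut].
by have [] := @dX u; rewrite ?(lt_le_trans s0 su) ?(le_lt_trans ut t1).
Qed.

Let Xlt s t : 0 < s -> s < t -> t < 1 -> X s < X t.
Proof.
move=> s0 st t1.
have isd u : u \in `]s, t[%R -> is_derive u (1 : R) X (f u).
  rewrite in_itv/= => /andP[su ut].
  have [|du <-] := @dX u; first by rewrite (lt_trans s0 su) (lt_trans ut t1).
  by rewrite derive1E; exact: derivableP.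
have [u] := MVT st isd (Xwithin s0 t1); rewrite in_itv/= => /andP[su ut] E.
rewrite -subr_gt0 E mulr_gt0 ?subr_gt0//; apply: f0.
by rewrite (lt_trans s0 su) (lt_trans ut t1).
Qed.

Let Xinj s t : 0 < s < 1 -> 0 < t < 1 -> X s = X t -> s = t.
Proof.
move=> /andP[s0 s1] /andP[t0 t1] E; have [st|ts|//] := ltgtP s t.
  by have := Xlt s0 st t1; rewrite E ltxx.
by have := Xlt t0 ts s1; rewrite E ltxx.
Qed.

Let Xonto s t x : 0 < s -> s <= t -> t < 1 -> X s <= x <= X t -> exists2 u, s <= u <= t & X u = x.
Proof.
move=> s0 st t1 /andP[sx xt].
have [|u ust E] := IVT st (Xwithin s0 t1) (_ : Num.min (X s) (X t) <= x <= Num.max (X s) (X t)).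
  by rewrite ge_min sx le_max xt orbT.
by exists u.
Qed.

Let tau x := if pselect (exists t, 0 < t < 1 /\ X t = x) is left e then sval (cid e) else 2^-1.

Let tau01 x : 0 < tau x < 1.
Proof. by rewrite /tau; case: pselect => // e; have [] := svalP (cid e). Qed.

Let tauX t : 0 < t < 1 -> tau (X t) = t.
Proof.
move=> t01; rewrite /tau; case: pselect => [e|[]]; last by exists t.
by have [u01 E] := svalP (cid e); exact: Xinj.
Qed.

Let tau_derive t : 0 < t < 1 -> is_derive (X t) 1 tau (f t)^-1.
Proof.
move=> /andP[t0 t1]; have t01 : 0 < t < 1 by rewrite t0.
have n01 : \forall u \near t, 0 < u < 1.
  near=> u; apply/andP; split; near: u; [exact: lt_nbhsr|exact: lt_nbhsl].
apply: is_derive_inverse.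
- by apply: filterS n01 => u /tauX.
- by apply: filterS n01 => u /Xcont.
- by have [dt <-] := dX t01; rewrite derive1E; exact: derivableP.
by rewrite gt_eqF// f0.
Unshelve. all: by end_near. Qed.

Let U x := c (tau x).
Let sigma x := rho (tau x).

Let UX t : 0 < t < 1 -> U (X t) = c t.
Proof. by move=> t01; rewrite /U tauX. Qed.

Let Ucont t : 0 < t < 1 -> {for X t, continuous U}.
Proof.
move=> t01; have td := tau_derive t01.
have ct : {for X t, continuous tau}.
  by apply: differentiable_continuous; apply/derivable1_diffP; exact: ex_derive.
apply: (@continuous_comp _ _ _ tau c) => //.
by rewrite tauX//; exact: within_itv_interior cc t01.
Qed.

Let dsigma t : 0 < t < 1 -> derivable sigma (X t) 1 /\ derive1 sigma (X t) = Num.sqrt 2 * W (U (X t)).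
Proof.
move=> t01; have td := tau_derive t01; have [dr dE] := drho t01.
have rd : is_derive (tau (X t)) 1 rho (Num.sqrt 2 * W (c t) * f t).
  by rewrite tauX// -dE derive1E; exact: derivableP.
have D := is_derive1_comp rd td; split; first exact: ex_derive.
rewrite derive1E UX//; transitivity (Num.sqrt 2 * W (c t) * f t / f t).
  exact: derive_val.
by rewrite mulfK// gt_eqF// f0.
Qed.

Let UdE s t x y : 0 < s -> s <= t -> t < 1 -> X s <= x -> x <= y -> y <= X t ->
  d (U x) (U y) = sigma y - sigma x.
Proof.
move=> s0 st t1 sx xy yt.
have [u /andP[su ut] uE] : exists2 u, s <= u <= t & X u = x.
  by apply: Xonto => //; rewrite sx (le_trans xy).
have [v /andP[sv vt] vE] : exists2 v, s <= v <= t & X v = y.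
  by apply: Xonto => //; rewrite yt (le_trans sx).
have u01 : 0 < u < 1 by rewrite (lt_le_trans s0 su) (le_lt_trans ut t1).
have v01 : 0 < v < 1 by rewrite (lt_le_trans s0 sv) (le_lt_trans vt t1).
rewrite /U /sigma -uE -vE !tauX//; have /andP[u0 u1] := u01; have /andP[v0 v1] := v01.
apply: cd; [exact: ltW| |exact: ltW].
rewrite leNgt; apply/negP => vu.
by have := Xlt v0 vu u1; rewrite uE vE ltNge xy.
Qed.

Let Uode t : 0 < t < 1 -> derivable U (X t) 1 /\ enorm (derive1 U (X t)) = Num.sqrt 2 * F W (c t).
Proof.
move=> t01; have /andP[t0 t1] := t01.
pose a := t / 2; pose b := (1 + t) / 2.
have [a0 [at_ [tb b1]]] : [/\ 0 < a, a < t, t < b & b < 1] by rewrite /a /b; split; lra.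
have XX : X a < X t < X b by rewrite !Xlt// ?(lt_trans a0) ?(lt_trans tb).
have ab : a <= b by rewrite ltW// (lt_trans at_).
have inX x : X a < x < X b -> exists2 u, 0 < u < 1 & X u = x.
  move=> /andP[ax xb]; have [|u /andP[au ub] <-] := Xonto a0 ab b1 (_ : X a <= x <= X b).
    by rewrite !ltW.
  by exists u => //; rewrite (lt_le_trans a0 au) (le_lt_trans ub b1).
have [d1 _ _ sp] : [/\ derivable U (X t) 1, derivable (derive1 U) (X t) 1,
    derive1 (derive1 U) (X t) = gradient W (U (X t)) & enorm (derive1 U (X t)) = Num.sqrt 2 * F W (U (X t))].
  apply: (arc_ode Wcont W0 a01 Wreg XX (sigma := sigma)).
  - by move=> x /inX[u u01 <-]; exact: Ucont.
  - move=> x y ax xy yb; apply: (UdE a0 ab b1) => //; exact: ltW.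
  - by move=> x /inX[u u01 <-]; exact: dsigma.
  - by rewrite UX//; exact: cW.
by split => //; rewrite sp UX.
Qed.

Let speed_bound z : quadratic_at z -> exists K delta : R, [/\ 0 <= K, 0 < delta &
  forall t, 0 < t < 1 -> enorm (c t - z) < delta ->
    derivable U (X t) 1 /\ enorm (derive1 U (X t)) <= K * enorm (U (X t) - z)].
Proof.
move=> [C [de [C0 de0 CW]]]; exists (Num.sqrt 2 * Num.sqrt C), de; split => //.
move=> t t01 tz; have [d1 ->] := Uode t01; split => //.
rewrite UX// -mulrA ler_wpM2l ?sqrtr_ge0//.
have Cn := ltW C0; rewrite -(@ler_pXn2r _ 2)// ?nnegrE ?F_ge0 ?mulr_ge0 ?sqrtr_ge0 ?enorm_ge0//.
by rewrite F_sqr// exprMn sqr_sqrtr//; exact: CW.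
Qed.

Let gron z K s t : 0 <= K -> 0 < s -> s <= t -> t < 1 ->
  (forall u, s <= u <= t -> derivable U (X u) 1 /\ enorm (derive1 U (X u)) <= K * enorm (U (X u) - z)) ->
  enorm (c s - z) ^+ 2 <= enorm (c t - z) ^+ 2 * expR (2 * K * (X t - X s)) /\
  enorm (c t - z) ^+ 2 <= enorm (c s - z) ^+ 2 * expR (2 * K * (X t - X s)).
Proof.
move=> K0 s0 st t1 H.
have XX : X s <= X t.
  by move: st; rewrite le_eqVlt => /predU1P[->//|st]; rewrite ltW// Xlt.
rewrite -!UX ?s0 ?t1 ?(lt_le_trans s0 st) ?(le_lt_trans st t1)//.
apply: enorm_gronwall => // u uX; have [v vst <-] := Xonto s0 st t1 uX.
exact: H.
Qed.

Let c_near z t e : 0 <= t <= 1 -> c t = z -> 0 < e ->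
  exists2 de, 0 < de & forall s, 0 <= s <= 1 -> `|s - t| < de -> enorm (c s - z) < e.
Proof.
move=> t01 ctz e0; have /within_itvP H := cc.
by apply: (H t t01 [set y | enorm (y - z) < e]); rewrite ctz; exact: near_enorm.
Qed.

Let Xunbounded_right M : exists2 t, 0 < t < 1 & M < X t.
Proof.
apply: contrapT => nM.
have XM t : 0 < t < 1 -> X t <= M.
  by move=> t01; rewrite leNgt; apply/negP => Mt; apply: nM; exists t.
have [K [de [K0 de0 HK]]] := speed_bound qq.
have o01 : 0 <= (1 : R) <= 1 by rewrite ler01 lexx.
have [e e0 He] := c_near o01 c1 de0.
pose t0 := Num.max 2^-1 (1 - e / 2).
have [t00 [t01 [t0e t0h]]] : [/\ 0 < t0, t0 < 1, 1 - e / 2 <= t0 & 2^-1 <= t0].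
  by rewrite /t0; split; rewrite ?lt_max ?gt_max ?le_max ?lexx ?orbT//; [apply/orP; left; lra|apply/andP; split; lra].
have near1 u : t0 <= u -> u < 1 -> enorm (c u - q) < de.
  move=> tu u1; apply: He; first by rewrite (le_trans (ltW t00) tu) ltW.
  by rewrite ltr_norml; apply/andP; split; lra.
have N0 : 0 < enorm (c t0 - q) ^+ 2.
  rewrite exprn_gt0// lt_neqAle enorm_ge0 andbT eq_sym; apply/eqP => /enorm_eq0/eqP.
  by rewrite subr_eq0 => /eqP E; have := @cW t0; rewrite t00 t01 E Wq eqxx => /(_ isT).
(* by Gronwall the distance to the well stays bounded below if [X] is bounded *)
set E := expR (2 * K * (M - X t0)).
have E0 : 0 < E by exact: expR_gt0.
have eta0 : 0 < Num.sqrt (enorm (c t0 - q) ^+ 2 / E) by rewrite sqrtr_gt0 divr_gt0.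
have [e2 e20 He2] := c_near o01 c1 eta0.
pose t := Num.max t0 (1 - e2 / 2).
have [tt0 [t1 te]] : [/\ t0 <= t, t < 1 & 1 - e2 / 2 <= t].
  by rewrite /t; split; [rewrite le_max lexx|rewrite gt_max t01/=; lra|rewrite le_max lexx orbT].
have tpos : 0 < t by exact: lt_le_trans tt0.
have [G _] : enorm (c t0 - q) ^+ 2 <= enorm (c t - q) ^+ 2 * expR (2 * K * (X t - X t0)) /\ 
    enorm (c t - q) ^+ 2 <= enorm (c t0 - q) ^+ 2 * expR (2 * K * (X t - X t0)).
  apply: gron => // u /andP[tu ut]; have u1 := le_lt_trans ut t1.
  by apply: HK; [rewrite (lt_le_trans t00 tu)|exact: near1].
have ct : enorm (c t - q) ^+ 2 < enorm (c t0 - q) ^+ 2 / E.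
  rewrite -[ltRHS]sqr_sqrtr ?divr_ge0 ?sqr_ge0 ?(ltW E0)//.
  rewrite ltr_pXn2r ?nnegrE ?enorm_ge0 ?sqrtr_ge0//; apply: He2; first by rewrite !ltW.
  by rewrite ltr_norml; apply/andP; split; lra.
have : enorm (c t0 - q) ^+ 2 < enorm (c t0 - q) ^+ 2.
  apply: (le_lt_trans G); apply: (@le_lt_trans _ _ (enorm (c t - q) ^+ 2 * E)).
    rewrite ler_wpM2l ?sqr_ge0// ler_expR ler_wpM2l ?mulr_ge0// lerD2r.
    by apply: XM; rewrite tpos.
  by rewrite -ltr_pdivlMr.
by rewrite ltxx.
Qed.

Let Xunbounded_left M : exists2 t, 0 < t < 1 & X t < M.
Proof.
apply: contrapT => nM.
have XM t : 0 < t < 1 -> M <= X t.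
  by move=> t01; rewrite leNgt; apply/negP => Mt; apply: nM; exists t.
have [K [de [K0 de0 HK]]] := speed_bound qp.
have o01 : 0 <= (0 : R) <= 1 by rewrite ler01 lexx.
have [e e0 He] := c_near o01 c0 de0.
pose t0 := Num.min 2^-1 (e / 2).
have [t00 [t01 [t0e t0h]]] : [/\ 0 < t0, t0 < 1, t0 <= e / 2 & t0 <= 2^-1].
  by rewrite /t0; split; rewrite ?lt_min ?gt_min ?ge_min ?lexx ?orbT//; [apply/andP; split; lra|apply/orP; left; lra].
have near0 u : 0 < u -> u <= t0 -> enorm (c u - p) < de.
  move=> u0 ut; apply: He; first by rewrite ltW//= (le_trans ut (ltW t01)).
  by rewrite subr0 gtr0_norm//; lra.
have N0 : 0 < enorm (c t0 - p) ^+ 2.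
  rewrite exprn_gt0// lt_neqAle enorm_ge0 andbT eq_sym; apply/eqP => /enorm_eq0/eqP.
  by rewrite subr_eq0 => /eqP E; have := @cW t0; rewrite t00 t01 E Wp eqxx => /(_ isT).
set E := expR (2 * K * (X t0 - M)).
have E0 : 0 < E by exact: expR_gt0.
have eta0 : 0 < Num.sqrt (enorm (c t0 - p) ^+ 2 / E) by rewrite sqrtr_gt0 divr_gt0.
have [e2 e20 He2] := c_near o01 c0 eta0.
pose t := Num.min t0 (e2 / 2).
have [tt0 [t_0 te]] : [/\ t <= t0, 0 < t & t <= e2 / 2].
  by rewrite /t; split; [rewrite ge_min lexx|rewrite lt_min t00/=; lra|rewrite ge_min lexx orbT].
have tlt : t < 1 by exact: le_lt_trans tt0 t01.
have [_ G] : enorm (c t - p) ^+ 2 <= enorm (c t0 - p) ^+ 2 * expR (2 * K * (X t0 - X t)) /\ 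
    enorm (c t0 - p) ^+ 2 <= enorm (c t - p) ^+ 2 * expR (2 * K * (X t0 - X t)).
  apply: gron => // u /andP[tu ut]; have u0 := lt_le_trans t_0 tu.
  by apply: HK; [rewrite u0 (le_lt_trans ut t01)|exact: near0].
have ct : enorm (c t - p) ^+ 2 < enorm (c t0 - p) ^+ 2 / E.
  rewrite -[ltRHS]sqr_sqrtr ?divr_ge0 ?sqr_ge0 ?(ltW E0)//.
  rewrite ltr_pXn2r ?nnegrE ?enorm_ge0 ?sqrtr_ge0//; apply: He2; first by rewrite !ltW.
  by rewrite subr0 gtr0_norm//; lra.
have : enorm (c t0 - p) ^+ 2 < enorm (c t0 - p) ^+ 2.
  apply: (le_lt_trans G); apply: (@le_lt_trans _ _ (enorm (c t - p) ^+ 2 * E)).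
    rewrite ler_wpM2l ?sqr_ge0// ler_expR ler_wpM2l ?mulr_ge0// lerD2l lerN2.
    by apply: XM; rewrite t_0.
  by rewrite -ltr_pdivlMr.
by rewrite ltxx.
Qed.

Let Xtau x : X (tau x) = x.
Proof.
have [t /andP[t0 t1] xt] := Xunbounded_right x; have [s /andP[s0 s1] sx] := Xunbounded_left x.
have st : s <= t.
  by rewrite leNgt; apply/negP => ts; have := Xlt t0 ts s1; rewrite ltNge ltW// (lt_trans sx).
have [|u /andP[su ut] <-] := Xonto s0 st t1 (_ : X s <= x <= X t); first by rewrite !ltW.
by rewrite tauX// (lt_le_trans s0 su) (le_lt_trans ut t1).
Qed.

Lemma equipartition_heteroclinic : exists tau : R -> R,
  [/\ forall x, 0 < tau x < 1, cancel tau (oriented f 2^-1),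
      forall t, 0 < t < 1 -> tau (oriented f 2^-1 t) = t
    & minimizing_heteroclinic W p q (c \o tau)].
Proof.
exists tau; split => //.
have tauX_gt t x : 0 < t < 1 -> X t < x -> t < tau x.
  move=> /andP[t0 t1] tx; rewrite ltNge; apply/negP; rewrite le_eqVlt => /predU1P[E|h].
    by move: tx; rewrite -E Xtau ltxx.
  have /andP[u0 _] := tau01 x.
  by have := Xlt u0 h t1; rewrite Xtau ltNge ltW.
have tauX_lt t x : 0 < t < 1 -> x < X t -> tau x < t.
  move=> /andP[t0 t1] tx; rewrite ltNge; apply/negP; rewrite le_eqVlt => /predU1P[E|h].
    by move: tx; rewrite E Xtau ltxx.
  have /andP[_ u1] := tau01 x.
  by have := Xlt t0 h u1; rewrite Xtau ltNge ltW.
apply: (line_heteroclinic Wcont W0 a01 Wreg (sigma := sigma)).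
- by move=> x; rewrite -(Xtau x); exact: Ucont (tau01 x).
- move=> x y; rewrite le_eqVlt => /predU1P[->|xy]; first by rewrite dr_xx// subrr.
  have /andP[a0 a1] := tau01 x; have /andP[b0 b1] := tau01 y.
  have ab : tau x <= tau y by rewrite ltW// tauX_gt// Xtau.
  apply: (UdE a0 ab b1); by rewrite ?Xtau// ltW.
- by move=> x; rewrite -(Xtau x); exact: dsigma (tau01 x).
- by move=> x; exact: cW (tau01 x).
have /within_itvP H := cc; split => A.
  have z01 : 0 <= (0 : R) <= 1 by rewrite ler01 lexx.
  rewrite -c0 => /(H 0 z01)[e e0 He].
  pose t := Num.min 2^-1 (e / 2).
  have [t0 [t1 te]] : [/\ 0 < t, t < 1 & t <= e / 2].
    by rewrite /t; split; rewrite ?lt_min ?gt_min ?ge_min ?lexx ?orbT//; [apply/andP; split; lra|apply/orP; left; lra].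
  exists (X t); split; first exact: num_real.
  move=> x xt; have /andP[u0 u1] := tau01 x; apply: He; first by rewrite !ltW.
  rewrite subr0 gtr0_norm//; have : tau x < t by apply: tauX_lt => //; rewrite t0.
  by lra.
have z01 : 0 <= (1 : R) <= 1 by rewrite ler01 lexx.
rewrite -c1 => /(H 1 z01)[e e0 He].
pose t := Num.max 2^-1 (1 - e / 2).
have [t0 [t1 te]] : [/\ 0 < t, t < 1 & 1 - e / 2 <= t].
  by rewrite /t; split; rewrite ?lt_max ?gt_max ?le_max ?lexx ?orbT//; [apply/orP; left; lra|apply/andP; split; lra].
exists (X t); split; first exact: num_real.
move=> x xt; have /andP[u0 u1] := tau01 x; apply: He; first by rewrite !ltW.
have : t < tau x by apply: tauX_gt => //; rewrite t0.
by move=> h; rewrite ltr_norml; apply/andP; split; lra.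
Qed.

End Equipartition.

(** * Regularity of geodesics of constant speed *)

Section HolderFunctions.
Context {R : realType}.
Variables (alpha a b : R).
Hypotheses (a01 : 0 < alpha < 1) (a0 : 0 < a) (ab : a <= b) (b1 : b < 1).
Implicit Types (f g : R -> R).

Definition holder_itv f := exists2 C, 0 <= C & forall x y, a <= x <= b -> a <= y <= b ->
  `|f x - f y| <= C * `|x - y| `^ alpha.

(** Distances in [a, b] are at most one; this is why Lipschitz functions are
Hoelder and products of Hoelder functions are Hoelder below. *)
Lemma dist_le_powR x y : a <= x <= b -> a <= y <= b -> `|x - y| <= `|x - y| `^ alpha <= 1.
Proof.
move=> /andP[ax xb] /andP[ay yb]; have /andP[al0 al1] := a01.
have d1 : `|x - y| <= 1.
  by rewrite ler_norml; apply/andP; split; move: a0 b1; lra.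
have [->|xy] := eqVneq x y; first by rewrite subrr normr0 powR_ge0 powR0 ?gt_eqF// ler01.
have d0 : 0 < `|x - y| by rewrite normr_gt0 subr_eq0.
apply/andP; split.
  rewrite -[leLHS]powRr1 ?(ltW d0)//; apply: (@ger_powR _ `|x - y|); last exact: ltW.
  by rewrite d0.
have := ge0_ler_powR (ltW al0) _ _ d1; rewrite powR1; apply; rewrite nnegrE//.
Qed.

Lemma holder_cst k : holder_itv (fun=> k).
Proof. by exists 0 => // x y _ _; rewrite subrr normr0 mul0r. Qed.

Lemma holderD f g : holder_itv f -> holder_itv g -> holder_itv (fun x => f x + g x).
Proof.
move=> [C C0 fC] [K K0 gK]; exists (C + K); first exact: addr_ge0.
move=> x y xab yab; rewrite opprD addrACA (le_trans (ler_normD _ _))// mulrDl lerD//.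
  exact: fC.
exact: gK.
Qed.

Lemma holder_sum (n : nat) (f : 'I_n -> R -> R) : (forall i, holder_itv (f i)) ->
  holder_itv (fun x => \sum_(i < n) f i x).
Proof.
elim: n f => [|n IH] f hf.
  by under eq_fun do rewrite big_ord0; exact: holder_cst.
under eq_fun do rewrite big_ord_recl.
by apply: holderD => //; apply: (IH (fun i => f (lift ord0 i))).
Qed.

Lemma holder_bounded f : holder_itv f -> exists2 M, 0 <= M & forall x, a <= x <= b -> `|f x| <= M.
Proof.
move=> [C C0 fC]; exists (`|f a| + C); first by rewrite addr_ge0.
move=> x xab; have aab : a <= a <= b by rewrite lexx.
rewrite -[f x](subrK (f a)) addrC (le_trans (ler_normD _ _))// lerD2l.
apply: (le_trans (fC x a xab aab)); rewrite ler_piMr//.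
by have /andP[] := dist_le_powR xab aab.
Qed.

Lemma holderM f g : holder_itv f -> holder_itv g -> holder_itv (fun x => f x * g x).
Proof.
move=> hf hg; have [Mf Mf0 fM] := holder_bounded hf; have [Mg Mg0 gM] := holder_bounded hg.
have [C C0 fC] := hf; have [K K0 gK] := hg.
exists (Mf * K + C * Mg); first by rewrite addr_ge0// mulr_ge0.
move=> x y xab yab.
have -> : f x * g x - f y * g y = f x * (g x - g y) + (f x - f y) * g y by ring.
rewrite (le_trans (ler_normD _ _))// !normrM mulrDl lerD//.
  by rewrite -mulrA ler_pM//; [exact: fM|exact: gK].
by rewrite mulrAC ler_pM//; [exact: fC|exact: gM].
Qed.

Lemma lipschitz_holder f K : 0 <= K -> (forall x y, a <= x <= b -> a <= y <= b ->
  `|f x - f y| <= K * `|x - y|) -> holder_itv f.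
Proof.
move=> K0 fK; exists K => // x y xab yab; apply: (le_trans (fK x y xab yab)).
by rewrite ler_wpM2l//; have /andP[] := dist_le_powR xab yab.
Qed.

Lemma C1_lipschitz f f' : (forall t, 0 < t < 1 -> derivable f t 1 /\ derive1 f t = f' t) ->
  (forall t, 0 < t < 1 -> {for t, continuous f'}) ->
  exists2 K, 0 <= K & forall x y, a <= x <= b -> a <= y <= b -> `|f x - f y| <= K * `|x - y|.
Proof.
move=> df cf'.
have in01 t : a <= t <= b -> 0 < t < 1.
  by move=> /andP[at_ tb]; rewrite (lt_le_trans a0 at_) (le_lt_trans tb b1).
have cn : {within `[a, b], continuous (fun t => `|f' t|)}.
  apply: continuous_in_subspaceT => t; rewrite inE/= in_itv/= => /in01 t01.
  by apply: (@continuous_comp _ _ _ f' (fun u => `|u|)); [exact: cf'|exact: norm_continuous].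
have [c _ cM] := EVT_max ab cn; exists `|f' c| => //.
have key x y : a <= x -> x < y -> y <= b -> `|f y - f x| <= `|f' c| * `|y - x|.
  move=> ax xy yb.
  have inab u : x <= u <= y -> a <= u <= b by move=> /andP[xu uy]; rewrite (le_trans ax xu) (le_trans uy yb).
  have isd u : u \in `]x, y[%R -> is_derive u (1 : R) f (f' u).
    rewrite in_itv/= => /andP[xu uy]; have [|du <-] := df u.
      by apply/in01/inab; rewrite !ltW.
    by rewrite derive1E; exact: derivableP.
  have cf : {within `[x, y], continuous f}.
    by apply: derivable_within_continuous => u; rewrite in_itv/= => /inab/in01/df[].
  have [u] := MVT xy isd cf; rewrite in_itv/= => /andP[xu uy] ->.
  by rewrite normrM ler_wpM2r//; apply: cM; rewrite in_itv/=; apply: inab; rewrite !ltW.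
move=> x y /andP[ax xb] /andP[ay yb]; have [xy|yx|->] := ltgtP x y.
- by rewrite distrC [X in _ * X]distrC; exact: key.
- exact: key.
- by rewrite !subrr normr0 mulr0.
Qed.

Lemma C1_holder f f' : (forall t, 0 < t < 1 -> derivable f t 1 /\ derive1 f t = f' t) ->
  (forall t, 0 < t < 1 -> {for t, continuous f'}) -> holder_itv f.
Proof. by move=> df cf; have [K K0 fK] := C1_lipschitz df cf; exact: lipschitz_holder fK. Qed.

End HolderFunctions.

Lemma compact_sub_itv (R : realType) (K : set R) : compact K -> K `<=` `]0, 1[ ->
  exists a b : R, [/\ 0 < a, a <= b, b < 1 & forall t, K t -> a <= t <= b].
Proof.
move=> cK K01; have [K0|nK] := pselect (K !=set0); last first.
  exists 2^-1, 2^-1; split => //; [lra|].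
  by move=> t Kt; case: nK; exists t.
have cid_ : {within K, continuous (fun t : R => t)} by apply: continuous_subspaceT => t; exact: cvg_id.
have cN : {within K, continuous (fun t : R => - t)}.
  by apply: continuous_subspaceT => t; exact: (cvgN cvg_id).
have [b bK bmax] := compact_EVT_max K0 cK cid_; have [a aK amin] := compact_EVT_max K0 cK cN.
rewrite !inE in aK bK.
have : `]0, 1[ a by exact: K01.
have : `]0, 1[ b by exact: K01.
rewrite /= !in_itv/= => /andP[_ b1] /andP[a0 _].
exists a, b; split => //; last first.
  move=> t Kt; have tK : t \in K by rewrite inE.
  by have := amin t tK; rewrite lerN2 => ->; exact: bmax.
by apply: bmax; rewrite inE.
Qed.

Section ChainRule.
Context {R : realType} {N : nat}.
Variables (W : 'rV[R]_N -> R).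

Lemma derive1_comp_gradient (c : R -> 'rV[R]_N) t : derivable c t 1 -> differentiable W (c t) ->
  derivable (fun s => W (c s)) t 1 /\
  derive1 (fun s => W (c s)) t = dot (gradient W (c t)) (derive1 c t).
Proof.
move=> /derivable1_diffP dc dW.
have dWc : differentiable (W \o c) t by exact: differentiable_comp.
split; first by apply/derivable1_diffP.
rewrite (derive1E' dWc) diff_comp//= -derive_gradient// deriveE//.
by rewrite (derive1E' dc).
Qed.

End ChainRule.

Section UnitSpeedRegularity.
Context {R : realType} {N : nat}.
Variables (W : 'rV[R]_N -> R) (alpha : R).
Hypotheses (Wcont : continuous W) (W0 : forall q, 0 <= W q).
Hypothesis a01 : 0 < alpha < 1.
Hypothesis Wreg : C1alpha_loc alpha (~` zero_set W) W.
Notation d := (dr W).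
Variables (p q : 'rV[R]_N) (c : R -> 'rV[R]_N) (D : R).
Hypotheses (qp : quadratic_at W p) (qq : quadratic_at W q) (Wp : W p = 0) (Wq : W q = 0).
Hypothesis cc : {within `[0, 1], continuous c}.
Hypotheses (c0 : c 0 = p) (c1 : c 1 = q) (D0 : 0 < D).
Hypothesis cW : forall s, 0 < s < 1 -> W (c s) != 0.
Hypothesis cd : forall s t, 0 <= s -> s <= t -> t <= 1 -> d (c s) (c t) = D * t - D * s.

Let s20 : 0 < Num.sqrt 2 :> R. Proof. by rewrite sqrtr_gt0. Qed.
Let f u := D * (Num.sqrt 2 * W (c u))^-1.

Let ccont s : 0 < s < 1 -> {for s, continuous c}.
Proof. exact: within_itv_interior. Qed.

Let Wccont s : 0 < s < 1 -> {for s, continuous (fun u => W (c u))}.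
Proof. by move=> /ccont cs; apply: (@continuous_comp _ _ _ c W); [exact: cs|exact: Wcont]. Qed.

Let Wcpos s : 0 < s < 1 -> 0 < W (c s).
Proof. by move=> s01; rewrite lt_neqAle W0 andbT eq_sym; exact: cW. Qed.

Let sWn0 s : 0 < s < 1 -> Num.sqrt 2 * W (c s) != 0.
Proof. by move=> s01; rewrite mulf_neq0// ?cW// gt_eqF. Qed.

Let fcont s : 0 < s < 1 -> {for s, continuous f}.
Proof.
move=> s01; apply: cvgM; first exact: cvg_cst.
apply: cvgV; first exact: sWn0.
by apply: cvgM; [exact: cvg_cst|exact: Wccont].
Qed.

Let fpos s : 0 < s < 1 -> 0 < f s.
Proof. by move=> s01; rewrite /f mulr_gt0// invr_gt0 mulr_gt0// Wcpos. Qed.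

Let dDE s : derivable (fun t => D * t) s 1 /\ derive1 (fun t => D * t) s = D.
Proof.
have [d1 d2] := derive_affine 0 D s.
by move: d1 d2; rewrite (_ : (fun y : R => 0 + D * y) = *%R D)//; apply/funext => y; rewrite add0r.
Qed.

Let drho s : 0 < s < 1 -> derivable (fun t => D * t) s 1 /\
  derive1 (fun t => D * t) s = Num.sqrt 2 * W (c s) * f s.
Proof.
move=> s01; have [d1 ->] := dDE s; split => //.
by rewrite /f mulrCA mulfV ?mulr1//; exact: sWn0.
Qed.

Let X := oriented f 2^-1.

Let dX s : 0 < s < 1 -> derivable X s 1 /\ derive1 X s = f s.
Proof. by move=> s01; apply: (oriented_derive fcont _ s01); apply/andP; split; lra. Qed.

Let U_ex : exists U : R -> 'rV[R]_N, [/\ forall x, derivable U x 1, forall x, derivable (derive1 U) x 1,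
   forall x, derive1 (derive1 U) x = gradient W (U x) & forall t, 0 < t < 1 -> U (X t) = c t].
Proof.
have [tau [_ _ tauX [ode _ _ _]]] := equipartition_heteroclinic Wcont W0 a01 Wreg qp qq Wp Wq cc c0 c1 cW cd fcont fpos drho.
exists (c \o tau); split.
- by move=> x; have [] := ode x.
- by move=> x; have [] := ode x.
- by move=> x; have [_ _ /eqP] := ode x; rewrite subr_eq0 => /eqP.
- by move=> t t01; rewrite /= tauX.
Qed.

Let U := sval (cid U_ex).
Let dU x : derivable U x 1. Proof. by rewrite /U; case: cid => /= ? []. Qed.
Let ddU x : derivable (derive1 U) x 1. Proof. by rewrite /U; case: cid => /= ? []. Qed.
Let ddUE x : derive1 (derive1 U) x = gradient W (U x). Proof. by rewrite /U; case: cid => /= ? []. Qed.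
Let UX t : 0 < t < 1 -> U (X t) = c t. Proof. by rewrite /U; case: cid => /= ? [_ _ _]; exact. Qed.

Let near01 (t : R) : 0 < t < 1 -> \forall s \near t, 0 < s < 1.
Proof.
by move=> /andP[t0 t1]; near=> s; apply/andP; split; near: s; [exact: lt_nbhsr|exact: lt_nbhsl].
Unshelve. all: by end_near. Qed.

Let V t := derive1 U (X t).

Let dc t : 0 < t < 1 -> derivable c t 1 /\ derive1 c t = f t *: V t.
Proof.
move=> t01; have [d1 E1] := dX t01; have [d2 E2] := derive1_comp_vec d1 (@dU (X t)).
have E : \forall s \near t, c s = (U \o X) s.
  by apply: filterS (near01 t01) => s s01; rewrite /= UX.
by have [e1 e2] := derivable_near E d2; split; [exact: e1|rewrite e2 E2 E1].
Qed.

Let cont_of (g : R -> R) t : derivable g t 1 -> {for t, continuous g}.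
Proof. by move=> dg; apply: differentiable_continuous; apply/derivable1_diffP. Qed.

Let gradWc i t := gradient W (c t) 0 i.

Let dV i t : 0 < t < 1 -> derivable (fun s => V s 0 i) t 1 /\
  derive1 (fun s => V s 0 i) t = f t * gradWc i t.
Proof.
move=> t01; have [d1 E1] := dX t01; have [d2 E2] := derive1_comp_vec d1 (@ddU (X t)).
have [d3 E3] := derivable_coord i d2; split; first exact: d3.
by rewrite E3 E2 E1 ddUE UX// mxE.
Qed.

Let Wdiff t : 0 < t < 1 -> differentiable W (c t).
Proof. by move=> t01; apply: Wreg.1 => /= h; move: (cW t01); rewrite h eqxx. Qed.

Let dWc t : 0 < t < 1 -> derivable (fun s => W (c s)) t 1 /\
  derive1 (fun s => W (c s)) t = \sum_i gradWc i t * (f t * V t 0 i).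
Proof.
move=> t01; have [d1 E1] := dc t01; have [d2 E2] := derive1_comp_gradient d1 (Wdiff t01).
split; first exact: d2.
by rewrite E2 E1; apply: eq_bigr => i _; rewrite /gradWc !mxE.
Qed.

Let gradWc_cont i t : 0 < t < 1 -> {for t, continuous (gradWc i)}.
Proof.
move=> t01; apply: cvg_coord; apply: (@continuous_comp _ _ _ c (gradient W)); first exact: ccont.
exact: (gradient_continuous Wcont a01 Wreg (cW t01)).
Qed.

Let Vcont i t : 0 < t < 1 -> {for t, continuous (fun s => V s 0 i)}.
Proof. by move=> t01; apply: cont_of; have [] := dV i t01. Qed.

Let dWcE t := \sum_i gradWc i t * (f t * V t 0 i).

Let dWc_cont t : 0 < t < 1 -> {for t, continuous dWcE}.
Proof.
move=> t01; apply: cvg_big => [|i _]; first exact: add_continuous.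
by apply: cvgM; [exact: gradWc_cont|apply: cvgM; [exact: fcont|exact: Vcont]].
Qed.

Let h t := (W (c t))^-1.

Let dh t : 0 < t < 1 -> derivable h t 1 /\ derive1 h t = - (h t * h t) * dWcE t.
Proof.
move=> t01; have [d1 E1] := dWc t01; have Wn := cW t01.
split; first exact: derivableV.
rewrite derive1E; have -> := deriveV Wn d1.
by rewrite -derive1E E1 /GRing.scale/= /h expr2 invfM.
Qed.

Let hcont t : 0 < t < 1 -> {for t, continuous h}.
Proof. by move=> t01; apply: cont_of; have [] := dh t01. Qed.

Let k : R := D / Num.sqrt 2.

Let fE t : f t = k * h t.
Proof. by rewrite /f /k /h invfM mulrA. Qed.

Let df t : 0 < t < 1 -> derivable f t 1 /\ derive1 f t = k * (- (h t * h t) * dWcE t).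
Proof.
move=> t01; have [d1 E1] := dh t01.
have -> : f = k *: h by apply/funext => s; rewrite fE.
split; first exact: derivableZ.
by rewrite derive1E; have -> := deriveZ k d1; rewrite -derive1E E1.
Qed.

Let acc i t := k * (- (h t * h t) * dWcE t) * V t 0 i + f t * (f t * gradWc i t).

Let ddc t : 0 < t < 1 -> derivable (derive1 c) t 1 /\ derive1 (derive1 c) t = \row_i acc i t.
Proof.
move=> t01.
have E : \forall s \near t, derive1 c s = f s *: V s.
  by apply: filterS (near01 t01) => s s01; have [_] := dc s01.
have [d1 E1] : derivable (fun s => f s *: V s) t 1 /\ derive1 (fun s => f s *: V s) t = \row_i acc i t.
  apply: derive1_coords => i; have [d1 E1] := df t01; have [d2 E2] := dV i t01.
  have -> : (fun x => (f x *: V x) 0 i) = (fun x => f x * V x 0 i) by apply/funext => s; rewrite mxE.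
  split; first exact: (derivableM d1 d2).
  rewrite derive1E; have -> := deriveM d1 d2; rewrite -!derive1E E1 E2 /GRing.scale/= mxE /acc.
  by rewrite addrC mulrC.
by have [e1 e2] := derivable_near E d1; split; [exact: e1|rewrite e2 E1].
Qed.

(** The second derivative of [c] is a polynomial in [V], [h], [f] and the
components of the gradient along [c]: the first three are C^1, and the last are
Hoelder because [c] is Lipschitz. *)
Lemma unit_speed_C2alpha : C2alpha_loc alpha `]0, 1[ c.
Proof.
split.
  move=> t; rewrite /= in_itv/= => t01; have [d1 _] := dc t01; have [d2 _] := ddc t01.
  by [].
move=> K cK K01; have [a [b [a0 ab b1 Kab]]] := compact_sub_itv cK K01.
have in01 t : a <= t <= b -> 0 < t < 1.
  by move=> /andP[at_ tb]; rewrite (lt_le_trans a0 at_) (le_lt_trans tb b1).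
have /andP[al0 al1] := a01.
have hV i : holder_itv alpha a b (fun s => V s 0 i).
  apply: (C1_holder a01 a0 ab b1 (@dV i)) => t t01.
  by apply: cvgM; [exact: fcont|exact: gradWc_cont].
have hh : holder_itv alpha a b h.
  apply: (C1_holder a01 a0 ab b1 dh) => t t01.
  by apply: cvgM; [apply: cvgN; apply: cvgM; exact: hcont|exact: dWc_cont].
have hf : holder_itv alpha a b f.
  have -> : f = fun t => k * h t by apply/funext => t; exact: fE.
  by apply: (holderM a01 a0 ab b1) => //; exact: holder_cst.
have clip : exists2 L, 0 <= L & forall x y, a <= x <= b -> a <= y <= b -> enorm (c x - c y) <= L * `|x - y|.
  have ci i : exists2 L, 0 <= L & forall x y, a <= x <= b -> a <= y <= b -> `|c x 0 i - c y 0 i| <= L * `|x - y|.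
    apply: (@C1_lipschitz _ _ _ a0 ab b1 (fun s => c s 0 i) (fun s => f s * V s 0 i)).
      move=> t t01; have [d1 E1] := dc t01; have [d2 E2] := derivable_coord i d1.
      by split => //; rewrite E2 E1 mxE.
    by move=> t t01; apply: cvgM; [exact: fcont|exact: Vcont].
  pose L i := sval (cid2 (ci i)).
  have LP i : 0 <= L i /\ forall x y, a <= x <= b -> a <= y <= b -> `|c x 0 i - c y 0 i| <= L i * `|x - y|.
    by rewrite /L; case: cid2.
  exists (\sum_i L i); first by apply: sumr_ge0 => i _; have [] := LP i.
  move=> x y xab yab; apply: (le_trans (enorm_le_sum _)); rewrite mulr_suml; apply: ler_sum => i _.
  by rewrite !mxE; have [_] := LP i; exact.
have hg i : holder_itv alpha a b (gradWc i).
  have [L L0 cL] := clip.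
  have cab : {within `[a, b], continuous c}.
    by apply: continuous_in_subspaceT => t; rewrite inE/= in_itv/= => /in01; exact: ccont.
  have cK' : compact (c @` `[a, b]) by apply: continuous_compact => //; exact: segment_compact.
  have sub : c @` `[a, b] `<=` ~` zero_set W.
    by move=> _ [t + <-]; rewrite /= in_itv/= => /in01/cW h0 h1; rewrite h1 eqxx in h0.
  have [C HC] := Wreg.2 _ cK' sub.
  exists (`|C| * L `^ alpha); first by rewrite mulr_ge0// powR_ge0.
  move=> x y xab yab.
  have -> : gradWc i x - gradWc i y = (gradient W (c x) - gradient W (c y)) 0 i by rewrite /gradWc !mxE.
  apply: (le_trans (coord_le_enorm _ _)).
  have mem t : a <= t <= b -> (c @` `[a, b]) (c t) by move=> tab; exists t => //=; rewrite in_itv.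
  apply: (le_trans (HC _ _ (mem x xab) (mem y yab))).
  apply: (@le_trans _ _ (`|C| * enorm (c x - c y) `^ alpha)).
    by rewrite ler_wpM2r ?powR_ge0// ler_norm.
  rewrite -mulrA ler_wpM2l// -powRM//; apply: ge0_ler_powR; rewrite ?nnegrE ?enorm_ge0 ?mulr_ge0 ?(ltW al0)//.
  exact: cL.
have hd : holder_itv alpha a b dWcE.
  apply: holder_sum => // i; apply: (holderM a01 a0 ab b1) => //.
  exact: (holderM a01 a0 ab b1).
have hacc i : holder_itv alpha a b (acc i).
  have hN : holder_itv alpha a b (fun t => - (h t * h t)).
    have -> : (fun t => - (h t * h t)) = fun t => -1 * (h t * h t) by apply/funext => t; rewrite mulN1r.
    by do 2 (apply: (holderM a01 a0 ab b1); first by [exact: holder_cst|exact: hh]).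
  have hNd := holderM a01 a0 ab b1 hN hd.
  have hk := holderM a01 a0 ab b1 (holder_cst alpha a b k) hNd.
  have h1 := holderM a01 a0 ab b1 hk (hV i).
  have h2 := holderM a01 a0 ab b1 hf (holderM a01 a0 ab b1 hf (hg i)).
  exact: (holderD h1 h2).
pose L i := sval (cid2 (hacc i)).
have LP i : 0 <= L i /\ forall x y, a <= x <= b -> a <= y <= b -> `|acc i x - acc i y| <= L i * `|x - y| `^ alpha.
  by rewrite /L; case: cid2.
exists (\sum_i L i) => x y Kx Ky; have xab := Kab x Kx; have yab := Kab y Ky.
have [_ ->] := ddc (in01 x xab); have [_ ->] := ddc (in01 y yab).
apply: (le_trans (enorm_le_sum _)); rewrite mulr_suml; apply: ler_sum => i _.
by rewrite !mxE; have [_] := LP i; exact.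
Qed.

Lemma unit_speed_derive_neq0 t : 0 < t < 1 -> derive1 c t != 0.
Proof.
move=> t01; have [d1 _] := dc t01; have [_ E] := arc_derive Wcont cd cc t01 (cW t01) d1.
apply/eqP => E0; move: E; have [_ ->] := dDE t; rewrite E0 enorm0 mulr0 => Dz.
by move: D0; rewrite Dz ltxx.
Qed.

End UnitSpeedRegularity.

(** * Parametrizations of a geodesic and the heteroclinic connection *)

Section Represents.
Context {R : realType} {N m : nat}.
Variables (W : 'rV[R]_N -> R) (w : 'I_m -> 'rV[R]_N) (alpha : R).
Hypotheses (Wcont : continuous W) (W0 : forall q, 0 <= W q).
Hypothesis wZ : zero_set W = range w.
Hypothesis a01 : 0 < alpha < 1.
Hypothesis Wreg : C1alpha_loc alpha (~` zero_set W) W.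
Notation d := (dr W).
Variables (p q : 'rV[R]_N) (g : R -> 'rV[R]_N).
Hypotheses (qp : quadratic_at W p) (qq : quadratic_at W q) (Wp : W p = 0) (Wq : W q = 0).
Hypothesis pq : p != q.
Hypothesis gmin : minimizing_geodesic W p q g.
Hypothesis ends : forall t, 0 <= t <= 1 -> W (g t) = 0 -> g t = p \/ g t = q.

Let D := d p q.
Let D0 : 0 < D. Proof. exact: (dr_gt0 Wcont W0 wZ pq). Qed.
Let g0 : g 0 = p. Proof. by have [] := minimizing_ends gmin. Qed.
Let g1 : g 1 = q. Proof. by have [] := minimizing_ends gmin. Qed.
Let s20 : 0 < Num.sqrt 2 :> R. Proof. by rewrite sqrtr_gt0. Qed.

(** The curve [c] is an arc for its distance from [p], whose derivative is [F W]
times the speed. At an inner time it is not at a well: this would be an end of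
the geodesic, where [c] would rest, against the assumption that its derivative
does not vanish. *)
Lemma regular_heteroclinic c : regular_parametrization alpha g c ->
  exists tau : R -> R, [/\ forall x, tau x \in `]0, 1[%R,
    cancel tau (equipartition W c),
    {in `]0 : R, 1[%R, cancel (equipartition W c) tau}
    & minimizing_heteroclinic W p q (c \o tau)].
Proof.
move=> [cc [phi [cphi phim phi0 phi1 gphi]] [dc _] cn0].
have gE t : 0 <= t <= 1 -> g t = c (phi t) by move=> t01; apply: gphi; rewrite in_itv.
have c0 : c 0 = p by rewrite -phi0 -gE ?lexx ?ler01.
have c1 : c 1 = q by rewrite -phi1 -gE ?lexx ?ler01.
have phis s : 0 <= s <= 1 -> exists2 t, 0 <= t <= 1 & phi t = s.
  move=> s01; have [|t] := IVT ler01 cphi (_ : Num.min (phi 0) (phi 1) <= s <= Num.max (phi 0) (phi 1)).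
    by rewrite phi0 phi1 (min_idPl ler01) (max_idPr ler01).
  by rewrite in_itv/= => t01 E; exists t.
pose rho s := d p (c s).
have cd s t : 0 <= s -> s <= t -> t <= 1 -> d (c s) (c t) = rho t - rho s.
  move=> s0; rewrite le_eqVlt => /predU1P[->|st] t1; first by rewrite dr_xx// subrr.
  have [a a01' aE] := phis s (introT andP (conj s0 (le_trans (ltW st) t1))).
  have [b b01 bE] := phis t (introT andP (conj (le_trans s0 (ltW st)) t1)).
  have ab : a <= b.
    rewrite leNgt; apply/negP => /ltW ba; have := phim b a; rewrite !in_itv/= => /(_ b01 a01' ba).
    by rewrite aE bE leNgt st.
  have /andP[a0 _] := a01'; have /andP[_ b1] := b01.
  by rewrite /rho -aE -bE -!gE//; exact: (minimizing_arc Wcont gmin).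
have mono s t : 0 <= s -> s <= t -> t <= 1 -> rho s <= rho t.
  by move=> s0 st t1; rewrite -subr_ge0 -cd// dr_ge0.
(* the derivative would vanish in the middle of the interval *)
have cst0 s t : 0 < s -> s < t -> t < 1 -> (forall u, s <= u <= t -> c u = c s) -> False.
  move=> s_0 st t1 H; pose u := (s + t) / 2.
  have [su ut] : s < u /\ u < t by rewrite /u; split; lra.
  have u01 : u \in `]0 : R, 1[%R by rewrite in_itv/= (lt_trans s_0 su) (lt_trans ut t1).
  have E : \forall v \near u, c v = cst (c s) v.
    near=> v; apply: H; apply/andP; split; apply: ltW; near: v; [exact: lt_nbhsr|exact: lt_nbhsl].
  have [_ E1] := derivable_near E (derivable_cst _ _ _).
  by have := cn0 u u01; rewrite E1 derive1E derive_cst eqxx.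
have cW s : 0 < s < 1 -> W (c s) != 0.
  move=> /andP[s0 s1]; apply/eqP => Wc.
  have [t t01 tE] := phis s (introT andP (conj (ltW s0) (ltW s1))).
  have := ends t01; rewrite gE// tE => /(_ Wc)[cp|cq].
    apply: (@cst0 (s / 2) s) => //; [lra|lra|].
    have cu u : 0 <= u <= s -> c u = p.
      move=> /andP[u0 us]; apply/esym; apply: (dr_eq0 Wcont W0 wZ); apply/le_anti; rewrite dr_ge0// andbT.
      by have := mono u s u0 us (ltW s1); rewrite /rho cp dr_xx.
    move=> u /andP[su us]; rewrite !cu//; apply/andP; split => //; move: s0 su; lra.
  apply: (@cst0 s ((s + 1) / 2)) => //; [lra|lra|].
  have cu u : s <= u <= 1 -> c u = q.
    move=> /andP[su u1]; apply/esym; rewrite -cq; apply: (dr_eq0 Wcont W0 wZ).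
    apply/le_anti; rewrite dr_ge0// andbT (cd s u (ltW s0) su u1) subr_le0 /rho cq -c1.
    by apply: mono => //; exact: le_trans (ltW s0) su.
  move=> u /andP[su us]; rewrite !cu//; apply/andP; split => //; [exact: ltW|move: s1 us; lra].
have dc1 s : 0 < s < 1 -> derivable c s 1 by move=> s01; have [] := dc s; rewrite /= ?in_itv.
have dc2 s : 0 < s < 1 -> derivable (derive1 c) s 1 by move=> s01; have [] := dc s; rewrite /= ?in_itv.
have Fpos s : 0 < s < 1 -> 0 < F W (c s) by move=> s01; apply: F_gt0 => //; exact: cW.
have sE s : Num.sqrt (2 * W (c s)) = Num.sqrt 2 * F W (c s).
  by rewrite sqrtrM//.
pose f u := enorm (derive1 c u) / Num.sqrt (2 * W (c u)).
have fc s : 0 < s < 1 -> {for s, continuous f}.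
  move=> s01; have cs := within_itv_interior cc s01.
  apply: cvgM.
    apply: (@continuous_comp _ _ _ (derive1 c) (@enorm R N)); last exact: continuous_enorm.
    by apply: differentiable_continuous; apply/derivable1_diffP; exact: dc2.
  apply: cvgV; first by rewrite sE mulf_neq0// gt_eqF// Fpos.
  apply: (@continuous_comp _ _ _ (fun u => 2 * W (c u)) (@Num.sqrt R)); last exact: sqrt_continuous.
  apply: cvgM; first exact: cvg_cst.
  by apply: (@continuous_comp _ _ _ c W); [exact: cs|exact: Wcont].
have fpos s : 0 < s < 1 -> 0 < f s.
  move=> s01; rewrite /f sE divr_gt0 ?mulr_gt0 ?Fpos// lt_neqAle enorm_ge0 andbT eq_sym.
  by apply/eqP => /enorm_eq0/eqP; apply/negP; apply: cn0; rewrite in_itv.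
have drho s : 0 < s < 1 -> derivable rho s 1 /\ derive1 rho s = Num.sqrt 2 * W (c s) * f s.
  move=> s01; have [d1 E1] := arc_derive Wcont cd cc s01 (cW s s01) (dc1 s s01).
  split; first exact: d1.
  rewrite E1 /f sE -(F_sqr W0 (c s)); have F0 := Fpos s s01; have s2 := s20.
  have Fn : F W (c s) != 0 by rewrite gt_eqF.
  have sn : Num.sqrt 2 != 0 :> R by rewrite gt_eqF.
  move: Fn sn; move: (F W (c s)) (Num.sqrt 2) (enorm _) => A B C An Bn.
  by field; rewrite An Bn.
have [tau [t01 tX Xt tmin]] := equipartition_heteroclinic Wcont W0 a01 Wreg qp qq Wp Wq cc c0 c1 cW cd fc fpos drho.
by exists tau; split.
Unshelve. all: by end_near. Qed.

(** Parametrize proportionally to the distance from [p]: at parameter [s] take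
the position of [g] at any time when that distance is [D * s]. All such times
give the same point, so the pauses of [g] disappear. *)
Lemma regular_parametrization_exists : exists c, regular_parametrization alpha g c.
Proof.
have [/LipZP[[gc _] _ _] _ _ _] := gmin.
pose rho t := d p (g t).
have rho0 : rho 0 = 0 by rewrite /rho g0 dr_xx.
have rho1 : rho 1 = D by rewrite /rho g1.
have crho : {within `[0, 1], continuous rho}.
  by move=> z; apply: cvg_comp; [exact: gc|exact: dr_continuousr].
have ex s : 0 <= s <= 1 -> exists2 t, 0 <= t <= 1 & rho t = D * s.
  move=> /andP[s0 s1]; have [|t] := IVT ler01 crho (_ : Num.min (rho 0) (rho 1) <= D * s <= Num.max (rho 0) (rho 1)).
    rewrite rho0 rho1 (min_idPl (ltW D0)) (max_idPr (ltW D0)) mulr_ge0 ?(ltW D0)//=.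
    by rewrite ler_piMr// ltW.
  by rewrite in_itv/= => t01 E; exists t.
pose theta s := if pselect (exists2 t, 0 <= t <= 1 & rho t = D * s) is left e then sval (cid2 e) else 0.
have thetaP s : 0 <= s <= 1 -> 0 <= theta s <= 1 /\ rho (theta s) = D * s.
  by move=> /ex h; rewrite /theta; case: pselect => // e; case: (cid2 e).
have arc s t : 0 <= s -> s <= t -> t <= 1 -> d (g s) (g t) = rho t - rho s.
  exact: (minimizing_arc Wcont gmin).
have geq s t : 0 <= s <= 1 -> 0 <= t <= 1 -> rho s = rho t -> g s = g t.
  move=> /andP[s0 s1] /andP[t0 t1] E; have [st|/ltW ts] := leP s t.
    by apply: (dr_eq0 Wcont W0 wZ); rewrite arc// E subrr.
  by apply/esym; apply: (dr_eq0 Wcont W0 wZ); rewrite arc// E subrr.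
pose c s := g (theta s).
have cd s t : 0 <= s -> s <= t -> t <= 1 -> d (c s) (c t) = D * t - D * s.
  move=> s0 st t1.
  have [a01' aE] := thetaP s (introT andP (conj s0 (le_trans st t1))).
  have [b01 bE] := thetaP t (introT andP (conj (le_trans s0 st) t1)).
  have /andP[a0 a1] := a01'; have /andP[b0 b1] := b01.
  have [ab|ba] := leP (theta s) (theta t); first by rewrite /c arc// aE bE.
  have E : D * s = D * t.
    apply/le_anti; rewrite ler_pM2l// st/= -aE -bE -subr_ge0 -arc ?(ltW ba)//.
    exact: dr_ge0.
  have -> : c s = c t by apply: geq => //; rewrite aE bE.
  by rewrite dr_xx// E subrr.
have z01 : 0 <= (0 : R) <= 1 by rewrite lexx ler01.
have o01 : 0 <= (1 : R) <= 1 by rewrite lexx ler01.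
have gc' t : 0 <= t <= 1 -> g t = c (rho t / D).
  move=> t01; have /andP[t0 t1] := t01.
  have r01 : 0 <= rho t / D <= 1.
    rewrite divr_ge0 ?dr_ge0 ?(ltW D0)//= ler_pdivrMr// mul1r -rho1 -subr_ge0 -arc//.
    exact: dr_ge0.
  have [b01 bE] := thetaP _ r01; apply: geq => //.
  by rewrite bE mulrC divfK// gt_eqF.
have c0 : c 0 = p by rewrite -g0 (gc' 0 z01) rho0 mul0r.
have c1 : c 1 = q by rewrite -g1 (gc' 1 o01) rho1 mulfV// gt_eqF.
have cc : {within `[0, 1], continuous c} := unit_speed_continuous Wcont W0 wZ cd.
have cW s : 0 < s < 1 -> W (c s) != 0.
  move=> /andP[s0 s1]; apply/eqP => Wc.
  have [t01 _] := thetaP s (introT andP (conj (ltW s0) (ltW s1))).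
  have [cp|cq] := ends t01 Wc.
    have := cd 0 s (lexx 0) (ltW s0) (ltW s1); rewrite c0 -/(c s) in cp *.
    rewrite [c s]cp dr_xx// mulr0 subr0 => /esym/eqP; rewrite mulf_eq0 !gt_eqF//.
  have := cd s 1 (ltW s0) (ltW s1) (lexx 1); rewrite c1 [c s]cq dr_xx// -mulrBr => /esym/eqP.
  by rewrite mulf_eq0 gt_eqF//= subr_eq0 gt_eqF.
exists c; split => //.
- exists (fun t => rho t / D); split.
  + move=> z; apply: cvgM; [exact: crho|exact: cvg_cst].
  + move=> s t; rewrite !in_itv/= => /andP[s0 _] /andP[_ t1] st.
    by rewrite ler_pM2r ?invr_gt0// -subr_ge0 -arc// dr_ge0.
  + by rewrite rho0 mul0r.
  + by rewrite rho1 mulfV// gt_eqF.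
  + by move=> t; rewrite in_itv/= => /gc'.
- exact: (unit_speed_C2alpha Wcont W0 a01 Wreg qp qq Wp Wq cc c0 c1 D0 cW cd).
move=> t; rewrite in_itv/= => t01.
exact: (unit_speed_derive_neq0 Wcont W0 a01 Wreg qp qq Wp Wq cc c0 c1 D0 cW cd).
Qed.

Lemma minimizing_represents : represents_heteroclinic W alpha g p q.
Proof. by split; [exact: regular_parametrization_exists|exact: regular_heteroclinic]. Qed.

End Represents.

Lemma two_times_ends (R : realType) (N : nat) (W : 'rV[R]_N -> R) (g : R -> 'rV[R]_N) (ts : seq R) t :
  enumerates_zero_times W g ts -> size ts = 2%N -> 0 <= t <= 1 -> W (g t) = 0 ->
  g t = g 0 \/ g t = g 1.
Proof.
move=> [_ h0 l1 zE] sz t01 Wt.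
have : t \in ts by have : zero_times W g t by []; rewrite zE.
case: ts h0 l1 sz {zE} => [|x [|y [|z ts]]]//= -> -> _.
by rewrite !inE => /orP[/eqP->|/eqP->]; [left|right].
Qed.

Theorem corollary3p2 (R : realType) (N m : nat) (hN : (2 <= N)%N)
  (hm : (2 <= m)%N) (W : 'rV[R]_N -> R) (p : 'I_m -> 'rV[R]_N) (alpha : R)
  (hWcont : continuous W)
  (hWge0 : forall q, 0 <= W q)
  (hp : injective p)
  (hZ : zero_set W = range p)
  (hWinf : (0 < liminf_infty W)%E)
  (halpha : 0 < alpha < 1)
  (hWreg : C1alpha_loc alpha (~` zero_set W) W)
  (hWquad : exists C delta : R, [/\ 0 < C, 0 < delta &
     forall (j : 'I_m) (q : 'rV[R]_N),
       enorm (q - p j) < delta -> W q <= C * enorm (q - p j) ^+ 2])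
  (j k : 'I_m) (hjk : p j != p k) :
  let strict_triangle := forall l : 'I_m, l != j -> l != k ->
    (dist W (p j) (p k) < dist W (p j) (p l) + dist W (p l) (p k))%E in
  ((forall (g : R -> 'rV[R]_N) (ts : seq R),
      minimizing_geodesic W (p j) (p k) g -> enumerates_zero_times W g ts ->
      size ts = 2%N)
   <-> strict_triangle) /\
  (forall g : R -> 'rV[R]_N,
     minimizing_geodesic W (p j) (p k) g ->
     (exists2 ts : seq R, enumerates_zero_times W g ts & size ts = 2%N)
       \/ strict_triangle ->
     represents_heteroclinic W alpha g (p j) (p k)).
Proof.
split.
  split; first exact: (strict_triangle_of_two hWcont hWge0 hZ hWinf hp hjk).
  by move=> st g ts; exact: (no_intermediate_wells hWcont hWge0 hZ st).
move=> g gmin h.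
have well i : W (p i) = 0 by apply/(W_eq0P hZ); exists i.
have quad i : quadratic_at W (p i).
  by have [C [de [C0 de0 CW]]] := hWquad; exists C, de; split => // y; exact: CW.
apply: (minimizing_represents hWcont hWge0 hZ halpha hWreg (quad j) (quad k) (well j) (well k) hjk gmin).
move=> t t01 Wt; case: h => [[ts en sz]|st]; last exact: (strict_triangle_on hWcont hZ st gmin t01 Wt).
by have := two_times_ends en sz t01 Wt; have [-> ->] := minimizing_ends gmin.
Qed.
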